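(* Let $N\ge2$, $0<s<1$, $1<p<p_c=2N/(N+s)$ and $sp<1$. Let $u$ be a solution of $\partial_tu+\mathcal L_{s,p}u=0$ in $\mathbb R^N\times(0,\infty)$ corresponding to a locally integrable initial datum $u_0\ge0$, with extinction time $T\in(0,\infty]$. If $u_0$ does not belong to the Morrey space $\widetilde M^{q_*}(\mathbb R^N)$, $q_*=N(2-p)/(sp)$, then $T=\infty$. The following conditions imply positivity for all time: (i) $\lim_{|x|\to\infty}u_0(x)|x|^{sp/(2-p)}=+\infty$. (ii) $\lim_{x\to x_0}u_0(x)|x-x_0|^{sp/(2-p)}=+\infty$ for some $x_0\in\mathbb R^N$. (iii) In particular, if the initial data is a power function $u_0(x)=|x|^{-|\gamma|}$ with $0<|\gamma|<N$, then $u$ has finite extinction time only for $|\gamma|=\gamma_*=sp/(2-p)$. Consequently, for every $q>1$ with $q\ne q_*$ there are initial data in the Morrey space $\widetilde M^q(\mathbb R^N)$ whose solutions do not become extinct in finite time.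
   Context: Let $\Phi_p(z)=|z|^{p-2}z$ and $\mathcal L_{s,p}(u)(x)=P.V.\int_{\mathbb R^N}\frac{\Phi_p(u(x)-u(y))}{|x-y|^{N+sp}}\,dy$. In $L^2(\mathbb R^N)$ it is the subdifferential of the convex functional $J(u)=\frac1{2p}\iint\frac{|u(x)-u(y)|^p}{|x-y|^{N+sp}}\,dxdy$; it generates a contraction semigroup $S_t$ which extends to an order-preserving contraction semigroup on every $L^q(\mathbb R^N)$, $1\le q<\infty$; semigroup solutions are $S_tu_0$ with $u_0\in L^q(\mathbb R^N)$. For more general nonnegative $u_0$, the solution is the minimal solution $u=\lim_nu_n$, where $u_n$ are the semigroup solutions with data any nondecreasing sequence $0\le u_{0,n}\in L^1(\mathbb R^N)\cap L^\infty(\mathbb R^N)$ converging monotonically to $u_0$. The extinction time is the first time $T$ such that $u(\cdot,t)\equiv0$ for $t\ge T$ ($T=\infty$ if there is none). For $q>1$ the Morrey space $\widetilde M^q(\mathbb R^N)$ is the set of locally integrable $f$ such that $\int_{B_R(x_0)}|f(x)|\,dx\le C\,R^{N(q-1)/q}$ for all $x_0\in\mathbb R^N$, $R>0$, for some constant $C$. *)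

(* Defs.v *)
From HB Require Import structures.
From mathcomp Require Import all_boot all_order all_algebra.
From mathcomp Require Import all_classical all_reals all_analysis.

Set Implicit Arguments.
Unset Strict Implicit.
Unset Printing Implicit Defensive.

Import Order.TTheory GRing.Theory Num.Theory.
Import numFieldNormedType.Exports.

Local Open Scope classical_set_scope.
Local Open Scope ring_scope.

(* Points of R^N are tuples, which carry the product (Borel) sigma-algebra. *)
Notation rN R N := (N.-tuple (measurableTypeR R)).

Section Lebesgue.
Context {R : realType}.

Definition snoc_pair n (z : rN R n * measurableTypeR R) : rN R n.+1 :=
  [the n.+1.-tuple (measurableTypeR R) of z.2 :: z.1].

Lemma measurable_snoc_pair n : measurable_fun setT (@snoc_pair n).
Proof. exact: (measurable_cons measurable_snd measurable_fst). Qed.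

(* N-dimensional Lebesgue measure on Borel sets: iterated product measures,
   transported along R^n * R -> R^(n+1); on R^0 it is the unit mass. *)
Fixpoint leb (n : nat) : {measure set (rN R n) -> \bar R} :=
  match n with
  | 0%N => dirac ([tuple] : rN R 0)
  | m.+1 => measure_function_pushforward__canonical__measure_function_Measure
              (leb m \x lebesgue_measure)%E (measurable_snoc_pair (n := m))
  end.

End Lebesgue.

Section Euclidean.
Context {R : realType} {N : nat}.
Implicit Types x y : rN R N.

Definition eucl_dist x y : R := Num.sqrt (\sum_(i < N) (tnth x i - tnth y i) ^+ 2).

Definition eucl_norm x : R := Num.sqrt (\sum_(i < N) tnth x i ^+ 2).

Definition eucl_ball x (r : R) : set (rN R N) := [set y | eucl_dist y x < r].

Definition nbhs_infty : set_system (rN R N) :=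
  filter_from [set: R] (fun r => [set x | r < eucl_norm x]).

Definition nbhs_punctured x : set_system (rN R N) :=
  filter_from [set r : R | 0 < r] (fun r => [set y | 0 < eucl_dist y x < r]).

End Euclidean.

Section Spaces.
Context {R : realType} {N : nat}.
Implicit Types f : rN R N -> R.

Definition locally_integrable_rN f : Prop :=
  measurable_fun setT f /\
  forall x0 r, (\int[leb N]_(x in eucl_ball x0 r) `|f x|%:E < +oo)%E.

Definition morrey (q : R) f : Prop :=
  locally_integrable_rN f /\
  exists C : R, forall (x0 : rN R N) (r : R), 0 < r ->
    (\int[leb N]_(x in eucl_ball x0 r) `|f x|%:E
       <= (C * r `^ (N%:R * (q - 1) / q))%:E)%E.

End Spaces.

Section FractionalPLaplacian.
Context {R : realType} {N : nat}.
Variables (s p : R).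
Implicit Types f g v w : rN R N -> R.

(* At x = y the integrand is 0 / 0 = 0; the diagonal is a null set. *)
Definition energy f : \bar R :=
  ((2 * p)^-1%:E *
   \int[leb N]_x \int[leb N]_y
     (`|f x - f y| `^ p / eucl_dist x y `^ (N%:R + s * p))%:E)%E.

(* [subdiff v g]: g belongs to the subdifferential at v of the functional
   [energy] on L^2(R^N); this is the realization in L^2 of the operator
   L_{s,p}, i.e. g = L_{s,p} v. *)
Definition subdiff v g : Prop :=
  [/\ v \in Lfun (leb N) 2%:E, g \in Lfun (leb N) 2%:E, (energy v < +oo)%E &
      forall w, w \in Lfun (leb N) 2%:E ->
        (energy v + (\int[leb N]_x (g x * (w x - v x)))%R%:E <= energy w)%E].

(* v = (I + lam L_{s,p})^-1 f *)
Definition resolvent (lam : R) f v : Prop :=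
  exists2 g, subdiff v g & {ae leb N, forall x, f x = v x + lam * g x}.

(* [semigroup t f w]: w = S_t f in L^2(R^N), where S is the semigroup generated
   by the maximal monotone operator [subdiff], through the exponential formula
   S_t f = lim_n (I + (t / n) L_{s,p})^-n f. For fixed n, [v n k] is the k-th
   iterate of the resolvent with step t / n.+1. *)
Definition semigroup (t : R) f w : Prop :=
  [/\ f \in Lfun (leb N) 2%:E, w \in Lfun (leb N) 2%:E &
      if t == 0 then {ae leb N, forall x, w x = f x}
      else exists v : nat -> nat -> rN R N -> R,
        [/\ forall n, v n 0%N = f,
            forall n k, resolvent (t / n.+1%:R) (v n k) (v n k.+1) &
            'N[leb N]_2%:E[EFin \o (v n n.+1 \- w)%R]%E @[n --> \oo] --> 0%E]].

(* [semigroup_Lq q t f w]: w = S_t f, where S_t is extended by continuity from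
   the intersection of L^2 and L^q to L^q(R^N). *)
Definition semigroup_Lq (q t : R) f w : Prop :=
  [/\ f \in Lfun (leb N) q%:E, w \in Lfun (leb N) q%:E &
      forall e : R, 0 < e -> exists2 d : R, 0 < d &
        forall g h, g \in Lfun (leb N) 2%:E -> g \in Lfun (leb N) q%:E ->
          ('N[leb N]_q%:E[EFin \o (g \- f)%R] < d%:E)%E -> semigroup t g h ->
          ('N[leb N]_q%:E[EFin \o (h \- w)%R] < e%:E)%E].

Implicit Types u : R -> rN R N -> \bar R.

Definition semigroup_solution (u0 : rN R N -> R) u : Prop :=
  exists2 q : R, 1 <= q &
    exists w : R -> rN R N -> R, forall t, 0 <= t ->
      semigroup_Lq q t u0 (w t) /\
      {ae leb N, forall x, u t x = (w t x)%:E}.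

(* The monotone limit of the approximations may be infinite, whence solutions
   with values in the extended reals. *)
Definition minimal_solution (u0 : rN R N -> R) u : Prop :=
  exists (u0_ : nat -> rN R N -> R) (u_ : nat -> R -> rN R N -> R),
    [/\ forall n, u0_ n \in Lfun (leb N) 1%E /\ u0_ n \in Lfun (leb N) +oo%E,
        {ae leb N, forall x, [/\ forall n, 0 <= u0_ n x,
           forall n, u0_ n x <= u0_ n.+1 x & u0_ n x @[n --> \oo] --> u0 x]},
        forall n t, 0 <= t -> semigroup t (u0_ n) (u_ n t) &
        forall t, 0 <= t ->
          {ae leb N, forall x, (u_ n t x)%:E @[n --> \oo] --> u t x}].

(* Solution of d_t u + L_{s,p} u = 0 in R^N x (0, +oo) with datum u0. *)
Definition is_solution (u0 : rN R N -> R) u : Prop :=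
  semigroup_solution u0 u \/ minimal_solution u0 u.

Definition extinction_time u : \bar R :=
  ereal_inf [set t%:E | t in
    [set t : R | 0 <= t /\
       forall tau, t <= tau -> {ae leb N, forall x, u tau x = 0%E}]].

Definition positive_for_all_time u : Prop :=
  extinction_time u = +oo%E /\
  forall t, 0 < t -> {ae leb N, forall x, (0 < u t x)%E}.

End FractionalPLaplacian.

(* Main.v *)
Require Import Defs.
From HB Require Import structures.
From mathcomp Require Import all_boot all_order all_algebra.
From mathcomp Require Import all_classical all_reals all_analysis.
From mathcomp Require Import measurable_realfun ring lra.

Set Implicit Arguments.
Unset Strict Implicit.
Unset Printing Implicit Defensive.

Import Order.TTheory GRing.Theory Num.Theory.
Import numFieldNormedType.Exports.

Local Open Scope classical_set_scope.
Local Open Scope ring_scope.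

(** The proof follows the mass of a solution against the weights
    [phi = (1 + |x - x0| / r) ^ (- (N + s p))], which decay like the kernel.

    For such a weight the nonlocal variation [int |phi x - phi y| K x y dy] is at
    most [C r ^ (- s p) phi x], because [s p < 1] makes the kernel times the
    distance integrable near the diagonal ([weight_bump]). Since
    [|u x - u y| ^ (p - 1) <= |u x| ^ (p - 1) + |u y| ^ (p - 1)], Hoelder's
    inequality bounds the operator tested with [phi] by the power [p - 1] of the
    mass [m = int u phi], whence [m' >= - c m ^ (p - 1)], and [m ^ (2 - p)]
    decreases at most linearly in time ([mass_semigroup]). If [u] vanishes at
    time [t], the initial mass is therefore at most
    [(C t) ^ (1 / (2 - p)) r ^ (N - gamma)], where [gamma = s p / (2 - p)] is the
    exponent of the statement. As [phi] is bounded below on the ball of radius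
    [r], this is the Morrey condition of exponent [N / gamma].

    Conversely, when the initial mass is large compared with the same power of
    [r], the solution is positive at time [t] ([positivity_semigroup]). The mass
    stays above a level [c] during the time considered, and the kernel is
    bounded below by a product of two weights, so each point where [u] is at
    most [del] receives a jump from the mass lying above [del]. Testing with
    [phi] times a cutoff of [u] at the level [del] shows that the set of small
    values has, on time average, a mass of order [del ^ (p - 1)]; letting [del]
    tend to [0] leaves no room for zeros. The passage from a time average to a
    given time uses the homogeneity and the order preservation of the evolution:
    [t ^ (- 1 / (2 - p)) u] is nonincreasing in time.

    Both estimates are proved for one step of the implicit Euler scheme and pass
    to the limit in the exponential formula. That every square-integrable datum
    has an evolution is needed as well, for the truncations of a general datum
    ([nsemigroup_exists]): resolvents are minimizers, and the schemes converge by
    Kobayashi's inequality. Every solution dominates the evolutions of bounded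
    square-integrable functions that converge to its datum
    ([solution_approximants]), so the two estimates hold for it
    ([extinct_mass_le], [positive_of_mass]).

    The growth conditions at infinity and at a point bound the initial mass from
    below on a cube inside an annulus [r < |x - x0| <= 2 N r], with [r] large or
    small; for a pure power the upper bound holds at all scales [r], which forces
    the critical exponent. The power [|x| ^ (- N / q)] belongs to the Morrey space
    of exponent [q] and serves as the last example. *)

(** * Lebesgue measure of cubes *)

Section LebesgueRN.
Context {R : realType}.

Definition cubeI N (a : rN R N) (l : R) : set (rN R N) :=
  [set x | forall i, tnth a i < tnth x i < tnth a i + l].

Lemma measurable_cubeI N (a : rN R N) l : measurable (cubeI a l).
Proof.
rewrite (_ : cubeI a l = \bigcap_(i in [set: 'I_N])
   ((fun x : rN R N => tnth x i) @^-1` `]tnth a i, tnth a i + l[%classic)); last first.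
  apply/seteqP; split => x /= h.
    by move=> i _ /=; rewrite in_itv /=.
  by move=> i; have := h i I; rewrite /= in_itv /=.
apply: fin_bigcap_measurable => // i _.
rewrite -[X in measurable X]setTI; exact: measurable_tnth.
Qed.

(** The recursive definition of the measure splits off the first coordinate, and
    cubes are products in this splitting. *)
Lemma leb_cubeI N (a : rN R N) (l : R) : 0 <= l ->
  leb N (cubeI a l) = (l ^+ N)%:E.
Proof.
move=> l0; elim: N a => [|N IH] a.
  rewrite /= diracE expr0 mem_set //; by case.
case/tupleP: a => a0 a; rewrite /= /pushforward.
rewrite (_ : snoc_pair (n:=N) @^-1` cubeI _ l =
   cubeI a l `*` `]a0, a0 + l[%classic).
  rewrite product_measure1E //; [|exact: measurable_cubeI].
  rewrite IH [X in (_ * X)%E](_ : _ =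
    lebesgue_measure `]a0, (a0 + l)[%classic) // lebesgue_measure_itv.
  rewrite /= lte_fin ltrDl lt_neqAle l0 andbT eq_sym.
  have [->|_] := eqVneq l 0; first by rewrite mule0 expr0n.
  by rewrite -EFinB -EFinM addrAC subrr add0r exprSr.
apply/seteqP; split => -[x y] /= h.
  split => /=; last by have := h ord0; rewrite in_itv /= !tnth0.
  by move=> i; have := h (lift ord0 i); rewrite !tnthS.
case: h => h1 h2 i; case: (unliftP ord0 i) => [j ->|->].
  by rewrite !tnthS; exact: h1.
by move: h2; rewrite /= in_itv /= !tnth0.
Qed.

Lemma sigma_finite_leb N : sigma_finite setT (leb (R := R) N).
Proof.
exists (fun n => cubeI [tuple - n%:R | _ < N] (n%:R *+ 2)).
  apply/seteqP; split => // x _ /=.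
  have [n hn] : exists n : nat, forall i, `|tnth x i| < n%:R.
    exists (\max_(i < N) Num.bound `|tnth x i|) => i.
    apply: (lt_le_trans (archi_boundP _)) => //.
    by rewrite ler_nat (leq_bigmax i).
  exists n => // i; rewrite tnth_mktuple mulr2n addrA addNr add0r -ltr_norml.
  exact: hn.
move=> n; split; first exact: measurable_cubeI.
by rewrite leb_cubeI ?ltry // mulrn_wge0.
Qed.

(** An alias of [leb N] as a set function, which can bear the sigma-finite
    structure that the Tonelli theorem asks for. *)
Definition lebf N : set (rN R N) -> \bar R := leb (R := R) N.
Arguments lebf N : clear implicits.
HB.instance Definition _ N := Measure.copy (lebf N) (leb (R := R) N).
HB.instance Definition _ N :=
  Measure_isSigmaFinite.Build _ _ _ (lebf N) (sigma_finite_leb N).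

End LebesgueRN.
Arguments lebf {R} N.

(** * Square-integrable functions *)

Section SquareIntegrable.
Context d (T : measurableType d) (R : realType).
Variable mu : {measure set T -> \bar R}.
Implicit Types f g h : T -> R.

Notation L2 := (Lfun mu 2%:E).

Lemma integrable_ge0P (f : T -> R) : (forall x, 0 <= f x) ->
  mu.-integrable setT (EFin \o f) <->
  measurable_fun setT f /\ (\int[mu]_x (f x)%:E < +oo)%E.
Proof.
move=> f0; split=> [/integrableP[mf]|[mf fi]].
  under eq_integral do rewrite /= ger0_norm //.
  by split => //; exact/measurable_EFinP.
apply/integrableP; split; first exact/measurable_EFinP.
by under eq_integral do rewrite /= ger0_norm //.
Qed.

Lemma le_integrableR (f g : T -> R) : measurable_fun setT f ->
  (forall x, `|f x| <= g x) -> mu.-integrable setT (EFin \o g) ->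
  mu.-integrable setT (EFin \o f).
Proof.
move=> mf fg; apply: le_integrable => //; first exact/measurable_EFinP.
by move=> x _ /=; rewrite lee_fin (le_trans (fg x)) // ler_norm.
Qed.

Lemma L2_measurable f : f \in L2 -> measurable_fun setT f.
Proof. by move=> /andP[]; rewrite inE. Qed.

Lemma L2P f : f \in L2 <->
  measurable_fun setT f /\ (\int[mu]_x (f x ^+ 2)%:E < +oo)%E.
Proof.
split=> [Lf|[mf fi]].
  have /integrable_ge0P := Lfun2_integrable_sqr Lf.
  move=> /(_ (fun x => sqr_ge0 _)) [_ ?]; split => //; exact: L2_measurable.
apply/andP; split; rewrite inE //=.
rewrite /finite_norm unlock poweR_lty //.
rewrite (le_lt_trans _ fi) // ge0_le_integral //.
- by move=> x _; rewrite lee_fin powR_ge0.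
- apply/measurable_EFinP.
  apply/(@measurableT_comp _ _ _ _ _ _ (fun x : R => x `^ 2)%R) => //.
  exact/measurableT_comp.
- by apply/measurable_EFinP; exact: measurable_funX.
- by move=> x _; rewrite /= lee_fin powR_mulrn // real_normK // num_real.
Qed.

Lemma L2_le f g : measurable_fun setT g -> (forall x, `|g x| <= `|f x|) ->
  f \in L2 -> g \in L2.
Proof.
move=> mg gf /L2P[mf fi]; apply/L2P; split => //.
rewrite (le_lt_trans _ fi) // ge0_le_integral //.
- by move=> x _; rewrite lee_fin sqr_ge0.
- by apply/measurable_EFinP; exact: measurable_funX.
- by apply/measurable_EFinP; exact: measurable_funX.
- by move=> x _; rewrite lee_fin -(real_normK (num_real (g x)))
    -(real_normK (num_real (f x))) lerXn2r // nnegrE.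
Qed.

Lemma L2_mul f g : f \in L2 -> g \in L2 -> mu.-integrable setT (EFin \o (f \* g)).
Proof. by move=> Lf Lg; apply/Lfun1_integrable; exact: Lfun2_mul_Lfun1. Qed.

Let le12 : (1 <= 2%:E :> \bar R)%E.
Proof. by rewrite lee_fin ler1n. Qed.

Lemma L2_0 : cst 0 \in L2.
Proof. by have [+ _] := Lfun_addr_closed mu le12. Qed.

Lemma L2D f g : f \in L2 -> g \in L2 -> f \+ g \in L2.
Proof. by have [_ +] := Lfun_addr_closed mu le12; apply. Qed.

Lemma L2N f : f \in L2 -> \- f \in L2.
Proof. exact: Lfun_oppr_closed. Qed.

Lemma L2B f g : f \in L2 -> g \in L2 -> f \- g \in L2.
Proof. by move=> Lf Lg; apply: (L2D Lf); exact: L2N. Qed.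

Lemma L2Z c f : f \in L2 -> c \*o f \in L2.
Proof.
move=> Lf; rewrite (_ : c \*o f = c \o* f); first exact: Lfun_scale (ler1n _ 2) _.
by apply/funext => x /=; rewrite mulrC.
Qed.

Definition ip f g : R := \int[mu]_x (f x * g x).

Lemma ipC f g : ip f g = ip g f.
Proof. by apply: eq_Rintegral => x _; rewrite mulrC. Qed.

Lemma ipDl f g h : f \in L2 -> g \in L2 -> h \in L2 ->
  ip (f \+ g) h = ip f h + ip g h.
Proof.
move=> Lf Lg Lh; rewrite /ip -RintegralD //; try exact: L2_mul.
by apply: eq_Rintegral => x _; rewrite /= mulrDl.
Qed.

Lemma ipBl f g h : f \in L2 -> g \in L2 -> h \in L2 ->
  ip (f \- g) h = ip f h - ip g h.
Proof.
move=> Lf Lg Lh; rewrite /ip -RintegralB //; try exact: L2_mul.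
by apply: eq_Rintegral => x _; rewrite /= mulrBl.
Qed.

Lemma ipZl c f h : f \in L2 -> h \in L2 -> ip (c \*o f) h = c * ip f h.
Proof.
move=> Lf Lh; rewrite /ip -RintegralZl //; try exact: L2_mul.
by apply: eq_Rintegral => x _; rewrite /= mulrA.
Qed.

Lemma ipDr f g h : f \in L2 -> g \in L2 -> h \in L2 ->
  ip h (f \+ g) = ip h f + ip h g.
Proof. by move=> *; rewrite ipC ipDl // !(ipC h). Qed.

Lemma ipBr f g h : f \in L2 -> g \in L2 -> h \in L2 ->
  ip h (f \- g) = ip h f - ip h g.
Proof. by move=> *; rewrite ipC ipBl // !(ipC h). Qed.

Lemma ipZr c f h : f \in L2 -> h \in L2 -> ip h (c \*o f) = c * ip h f.
Proof. by move=> *; rewrite ipC ipZl // (ipC h). Qed.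

Lemma Rintegral_ae f g : measurable_fun setT f -> measurable_fun setT g ->
  {ae mu, forall x, f x = g x} -> \int[mu]_x f x = \int[mu]_x g x.
Proof.
move=> mf mg fg; congr fine; apply: ae_eq_integral => //; try exact/measurable_EFinP.
by apply: filterS fg => x /= -> _.
Qed.

Lemma ip_ae f f' g : f \in L2 -> f' \in L2 -> g \in L2 ->
  {ae mu, forall x, f x = f' x} -> ip f g = ip f' g.
Proof.
move=> Lf Lf' Lg ff'; apply: Rintegral_ae.
- by apply: measurable_funM; exact: L2_measurable.
- by apply: measurable_funM; exact: L2_measurable.
- by apply: filterS ff' => x ->.
Qed.

Lemma Rintegral_ge0_ae f : {ae mu, forall x, 0 <= f x} ->
  measurable_fun setT f -> 0 <= \int[mu]_x f x.
Proof.
move=> f0 mf; rewrite (@Rintegral_ae f (fun x => `|f x|)) //.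
- by apply: Rintegral_ge0.
- exact: measurableT_comp.
- by apply: filterS f0 => x /ger0_norm ->.
Qed.

Lemma le_Rintegral_ae f g : mu.-integrable setT (EFin \o f) ->
  mu.-integrable setT (EFin \o g) -> {ae mu, forall x, f x <= g x} ->
  \int[mu]_x f x <= \int[mu]_x g x.
Proof.
move=> fi gi fg; rewrite -subr_ge0 -RintegralB //; apply: Rintegral_ge0_ae.
  by apply: filterS fg => x; rewrite subr_ge0.
by apply: measurable_funB; apply/measurable_EFinP; apply: (measurable_int mu).
Qed.

Lemma ip_ge0 f : 0 <= ip f f.
Proof. by apply: Rintegral_ge0 => x _; rewrite -expr2 sqr_ge0. Qed.

Lemma ip_EFin f : f \in L2 -> (ip f f)%:E = (\int[mu]_x (f x ^+ 2)%:E)%E.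
Proof.
move=> /L2P[mf fi]; rewrite /ip /Rintegral fineK //.
rewrite ge0_fin_numE //; first by rewrite integral_ge0 // => x _; rewrite lee_fin sqr_ge0.
Qed.

Lemma ip_eq0 f : f \in L2 -> ip f f = 0 -> {ae mu, forall x, f x = 0}.
Proof.
move=> Lf f0; have := ip_EFin Lf; rewrite f0 => /esym h.
have mf : measurable_fun setT (fun x => (f x ^+ 2)%:E).
  apply/measurable_EFinP; apply: measurable_funX; exact: L2_measurable.
have /(ae_eq_integral_abs mu measurableT mf).1 : (\int[mu]_x `|(f x ^+ 2)%:E| = 0)%E.
  by transitivity (0%:E : \bar R) => //; rewrite -h; apply: eq_integral => x _; rewrite /= ger0_norm ?sqr_ge0.
apply: filterS => x /(_ Logic.I)[] /eqP.
by rewrite sqrf_eq0 => /eqP.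
Qed.

Lemma cauchy_schwarz f g : f \in L2 -> g \in L2 ->
  ip f g ^+ 2 <= ip f f * ip g g.
Proof.
move=> Lf Lg.
have h c : 0 <= ip f f - 2 * c * ip f g + c ^+ 2 * ip g g.
  have := ip_ge0 (f \- c \*o g).
  rewrite ipBl ?ipBr ?ipZl ?ipZr ?L2B ?L2Z // (ipC g f); lra.
have := ip_ge0 g; rewrite le_eqVlt => /orP[/eqP/esym g0|g0].
  move: h; rewrite g0 => h.
  have [->|fg0] := eqVneq (ip f g) 0; first by rewrite expr0n mulr0.
  (* If [g] has norm zero, a large multiple of it would contradict [h]. *)
  have := h ((ip f f + 1) / (2 * ip f g)); rewrite !mulr0 addr0.
  have -> : 2 * ((ip f f + 1) / (2 * ip f g)) * ip f g = ip f f + 1 by field.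
  lra.
(* The minimum of the quadratic polynomial in [c]. *)
have := h (ip f g / ip g g); rewrite -(@ler_pM2r _ (ip g g)) // mul0r.
have -> : (ip f f - 2 * (ip f g / ip g g) * ip f g +
   (ip f g / ip g g) ^+ 2 * ip g g) * ip g g = ip f f * ip g g - ip f g ^+ 2.
  by field; rewrite gt_eqF.
lra.
Qed.

End SquareIntegrable.

(** * Completeness and almost everywhere limits *)

Section GeometricSeries.
Context {R : realType}.

Lemma nneseries_geometric (c r : R) : 0 <= r -> r < 1 ->
  (\sum_(n <oo) ((geometric c r n : R)%:E) = (c / (1 - r))%:E)%E.
Proof.
move=> r0 r1; have h : `|r| < 1 by rewrite ger0_norm.
rewrite (_ : (fun n => _) = EFin \o series (geometric c r)); last first.
  by apply/funext => n /=; rewrite /series /= sumEFin.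
rewrite EFin_lim; last exact: is_cvg_geometric_series.
by have /cvg_lim -> := @cvg_geometric_series _ c _ h.
Qed.

End GeometricSeries.

Section Completeness.
Context d (T : measurableType d) (R : realType).
Variable mu : {measure set T -> \bar R}.
Implicit Types f g h : T -> R.

Notation L2 := (Lfun mu 2%:E).

(** A limit almost everywhere agrees with the lower limit almost everywhere, and
    the lower limit is subject to Fatou's lemma. *)
Lemma fatou_ae (f_ : nat -> T -> R) f (B : \bar R) :
  (forall n, measurable_fun setT (f_ n)) -> measurable_fun setT f ->
  (forall n x, 0 <= f_ n x) ->
  {ae mu, forall x, f_ n x @[n --> \oo] --> f x} ->
  (\forall n \near \oo, (\int[mu]_x (f_ n x)%:E <= B)%E) ->
  (\int[mu]_x (f x)%:E <= B)%E.
Proof.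
move=> mf_ mf f0 ff fB.
have mEf_ n : measurable_fun setT (EFin \o f_ n) by exact/measurable_EFinP.
have -> : (\int[mu]_x (f x)%:E = \int[mu]_x limn_einf (fun n => (f_ n x)%:E))%E.
  apply: ae_eq_integral => //.
  - exact/measurable_EFinP.
  - apply: measurableT_comp => //.
    apply: measurable_fun_limn_esup => n.
    suff : measurable_fun setT (EFin \o (fun x => - f_ n x)) by [].
    by apply/measurable_EFinP; exact: measurableT_comp.
  - apply: filterS ff => x fx _; apply/esym.
    have h : (f_ n x)%:E @[n --> \oo] --> (f x)%:E by apply: cvg_EFin => //; exact: nearW.
    by rewrite is_cvg_limn_einfE ?(cvg_lim _ h) //; apply/cvg_ex; exists (f x)%:E.
apply: (le_trans (fatou mu measurableT mEf_ _)).
  by move=> n x _; rewrite lee_fin.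
rewrite limn_einf_lim; apply: lime_le; first exact: is_cvg_einfs.
near=> n.
rewrite /einfs /sdrop.
apply: (@le_trans _ _ (\int[mu]_x (f_ n x)%:E)%E); last by near: n; exact: fB.
by apply: ereal_inf_lbound; exists n => //=.
Unshelve. all: by end_near.
Qed.

Lemma fatou_L2 (u : nat -> T -> R) (v : T -> R) (e : R) :
  (forall n, u n \in L2) -> measurable_fun setT v ->
  {ae mu, forall x, u n x @[n --> \oo] --> v x} ->
  (\forall n \near \oo, ip mu (u n) (u n) <= e) ->
  v \in L2 /\ ip mu v v <= e.
Proof.
move=> Lu mv uv ue.
suff h : (\int[mu]_x (v x ^+ 2)%:E <= e%:E)%E.
  have Lv : v \in L2 by apply/L2P; split => //; rewrite (le_lt_trans h) ?ltry.
  by split => //; rewrite -lee_fin ip_EFin.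
apply: (@fatou_ae (fun n x => u n x ^+ 2)).
- by move=> n; apply: measurable_funX; exact: (L2_measurable (Lu n)).
- exact: measurable_funX.
- by move=> n x; exact: sqr_ge0.
- by apply: filterS uv => x uvx; rewrite expr2; under eq_fun do rewrite expr2; exact: cvgM.
- by apply: filterS ue => n une; rewrite -ip_EFin // lee_fin.
Qed.

Lemma cvg_geometric_increments (u : nat -> R) (c : R) :
  (forall n, `|u n.+1 - u n| <= c * (1 / 2) ^+ n) -> cvgn u.
Proof.
move=> h; have -> : u = (fun n => u 0%N + series (fun k => u k.+1 - u k) n).
  apply/funext => n; elim: n => [|n IH]; first by rewrite /series /= big_geq ?addr0.
  by rewrite seriesSr addrA -IH addrC subrK.
have c0 : 0 <= c by have := h 0%N; rewrite expr0 mulr1; apply: le_trans.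
apply: is_cvgD; first exact: is_cvg_cst.
apply: normed_cvg; apply: (@series_le_cvg _ _ (geometric c (1 / 2))) => //.
- by move=> n /=.
- by move=> n /=; rewrite mulr_ge0 // exprn_ge0 // divr_ge0.
- by apply: is_cvg_geometric_series; rewrite ger0_norm; lra.
Qed.

(** The sum of [4 ^ n] times the squared increments is integrable, hence finite
    almost everywhere, and the increments are at most a multiple of [2 ^- n] there. *)
Lemma cvg_ae_fast (u : nat -> T -> R) : (forall n, u n \in L2) ->
  (forall n, ip mu (u n.+1 \- u n) (u n.+1 \- u n) <= (1 / 8) ^+ n) ->
  {ae mu, forall x, cvgn (u ^~ x)}.
Proof.
move=> Lu hu.
pose D n x := (4 ^+ n * (u n.+1 x - u n x) ^+ 2)%:E.
have D0 n x : (0 <= D n x)%E by rewrite lee_fin mulr_ge0 ?sqr_ge0 ?exprn_ge0.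
have LD n : u n.+1 \- u n \in L2 by exact: L2B.
have mD n : measurable_fun setT (D n).
  apply/measurable_EFinP; apply: measurable_funM => //.
  by apply: (measurable_funX 2); exact: L2_measurable (LD n).
have mS : measurable_fun setT (fun x => \sum_(n <oo) D n x)%E.
  by apply: ge0_emeasurable_sum.
have iS : (\int[mu]_x (\sum_(n <oo) D n x) < +oo)%E.
  rewrite integral_nneseries //.
  apply: (@le_lt_trans _ _ (\sum_(n <oo) ((geometric 1 (1 / 2) n : R)%:E)))%E.
    apply: lee_nneseries => [n _ _|n _]; first by apply: integral_ge0 => x _.
    rewrite (_ : (\int[mu]_x D n x)%E = (4 ^+ n * ip mu (u n.+1 \- u n) (u n.+1 \- u n))%:E).
      rewrite lee_fin /= mul1r; apply: (le_trans (ler_wpM2l _ (hu n))).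
        by rewrite exprn_ge0.
      by rewrite -exprMn (_ : 4 * (1 / 8) = 1 / 2 :> R) //; field.
    rewrite EFinM ip_EFin // -ge0_integralZl_EFin //.
    + by move=> x _; rewrite lee_fin sqr_ge0.
    + apply/measurable_EFinP; apply: measurable_funX; exact: L2_measurable (LD n).
  by rewrite nneseries_geometric ?ltry //; lra.
have : mu.-integrable setT (fun x => \sum_(n <oo) D n x)%E.
  apply/integrableP; split => //.
  by under eq_integral do rewrite gee0_abs ?nneseries_ge0 //.
move=> /(integrable_ae measurableT); apply: filterS => x /(_ Logic.I).
move=> /fineK; set S := fine _ => hS.
apply: (@cvg_geometric_increments _ (S + 1)) => n.
have h : 4 ^+ n * (u n.+1 x - u n x) ^+ 2 <= S.
  rewrite -lee_fin hS.
  apply: (@le_trans _ _ (\sum_(0 <= k < n.+1) D k x)%E); last exact: nneseries_lim_ge.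
  by rewrite big_nat_recr //= leeDr // sume_ge0.
have S0 : 0 <= S by rewrite (le_trans _ h) // mulr_ge0 ?sqr_ge0 ?exprn_ge0.
rewrite div1r exprVn ler_pdivlMr ?exprn_gt0 //.
have h2 : (`|u n.+1 x - u n x| * 2 ^+ n) ^+ 2 <= (S + 1) ^+ 2.
  apply: (@le_trans _ _ S); last nra.
  apply: le_trans h; rewrite exprMn real_normK ?num_real // mulrC.
  by rewrite -exprM mulnC exprM (_ : 2 ^+ 2 = 4 :> R) //; ring.
have S1 : 0 <= S + 1 by lra.
by rewrite ler_pXn2r // nnegrE in h2; rewrite // mulr_ge0 // exprn_ge0.
Qed.

(** A subsequence with increments of squared norm at most [8 ^- n] converges almost
    everywhere; by Fatou's lemma its limit is the limit in norm of the whole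
    sequence. *)
Lemma L2_complete (u : nat -> T -> R) : (forall n, u n \in L2) ->
  (forall e : R, 0 < e -> exists n0, forall m n, (n0 <= m)%N -> (n0 <= n)%N ->
     ip mu (u m \- u n) (u m \- u n) <= e) ->
  exists v, [/\ v \in L2,
    exists2 k : nat -> nat, (forall n, (n <= k n)%N) &
      {ae mu, forall x, u (k n) x @[n --> \oo] --> v x} &
    forall e : R, 0 < e -> exists n0, forall n, (n0 <= n)%N ->
      ip mu (u n \- v) (u n \- v) <= e].
Proof.
move=> Lu hu.
have /choice[N0 hN0] : forall n, exists n0, forall i j, (n0 <= i)%N -> (n0 <= j)%N ->
     ip mu (u i \- u j) (u i \- u j) <= (1 / 8) ^+ n.
  by move=> n; apply: hu; rewrite exprn_gt0.
pose k n := (n + \max_(i < n.+1) N0 i)%N.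
have kN n : (N0 n <= k n)%N.
  by rewrite (leq_trans _ (leq_addl _ _)) // (@leq_bigmax _ (fun i : 'I_n.+1 => N0 i) ord_max).
have kN' n : (N0 n <= k n.+1)%N.
  rewrite (leq_trans _ (leq_addl _ _)) //.
  have hn : (n < n.+2)%N by [].
  by rewrite (@leq_bigmax _ (fun i : 'I_n.+2 => N0 i) (Ordinal hn)).
have kc : {ae mu, forall x, cvgn (fun n => u (k n) x)}.
  by apply: (cvg_ae_fast (u := fun n => u (k n))) => // n; exact: hN0.
pose v x := fine (limn_esup (fun n => (u (k n) x)%:E)).
have mv : measurable_fun setT v.
  apply: measurableT_comp => //.
  apply: measurable_fun_limn_esup => n; apply/measurable_EFinP.
  exact: L2_measurable (Lu _).
have kv : {ae mu, forall x, u (k n) x @[n --> \oo] --> v x}.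
  apply: filterS kc => x ux.
  suff -> : v x = limn (fun n => u (k n) x) by [].
  have h : (u (k n) x)%:E @[n --> \oo] --> (limn (fun n => u (k n) x))%:E.
    by apply: cvg_EFin => //; exact: nearW.
  rewrite /v is_cvg_limn_esupE ?(cvg_lim _ h) //.
have main e : 0 < e -> exists n0, forall n, (n0 <= n)%N ->
      u n \- v \in L2 /\ ip mu (u n \- v) (u n \- v) <= e.
  move=> e0; have [n0 hn0] := hu e e0; exists n0 => n nn0.
  apply: (@fatou_L2 (fun j => u n \- u (k j))).
  - by move=> j; exact: L2B.
  - by apply: measurable_funB => //; exact: L2_measurable (Lu _).
  - apply: filterS kv => x ukx; apply: cvgB => //; exact: cvg_cst.
  - exists n0 => // j /= jn0; apply: hn0 => //; exact: leq_trans (leq_addr _ _).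
exists v; split.
- have [n0 /(_ n0 (leqnn _))[h _]] := main 1 ltr01.
  rewrite (_ : v = u n0 \- (u n0 \- v)); first exact: L2B.
  by apply/funext => x /=; rewrite opprB addrC subrK.
- by exists k => // n; exact: leq_addr.
- by move=> e /main[n0 h]; exists n0 => n /h[].
Qed.

End Completeness.

(** * Inequalities for powers *)

Section PowerInequalities.
Context {R : realType}.
Implicit Types a b x y r p : R.

Lemma powR_le r a b : 0 <= r -> 0 <= a -> a <= b -> a `^ r <= b `^ r.
Proof.
by move=> r0 a0 ab; apply: ge0_ler_powR => //; rewrite nnegrE // (le_trans a0).
Qed.

(** Dividing by [a + b] reduces the claim to [c <= c ^ r] on the unit interval. *)
Lemma powR_subadditive r a b : 0 <= r <= 1 -> 0 <= a -> 0 <= b ->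
  (a + b) `^ r <= a `^ r + b `^ r.
Proof.
move=> /andP[r0 r1] a0 b0.
have [ab0|ab0] := eqVneq (a + b) 0.
  have -> : a = 0 by lra.
  by rewrite add0r lerDr powR_ge0.
have s0 : 0 < a + b by rewrite lt_neqAle eq_sym ab0 addr_ge0.
have h c : 0 <= c -> c <= a + b -> c / (a + b) * (a + b) `^ r <= c `^ r.
  move=> c0 cab.
  have [->|c1] := eqVneq c 0; first by rewrite !mul0r powR_ge0.
  have c2 : 0 < c by rewrite lt_neqAle eq_sym c1.
  rewrite -[X in _ <= X `^ r](divfK ab0 c) powRM ?divr_ge0 // ?(ltW s0) //.
  rewrite ler_wpM2r ?powR_ge0 // ger1_powR //.
  by rewrite divr_gt0 //= ler_pdivrMr // mul1r.
apply: le_trans (lerD (h a a0 _) (h b b0 _)); try lra.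
by rewrite -mulrDl -mulrDl divff // mul1r.
Qed.

(** The duality map [a |-> |a| ^ (p - 2) a], written so that its value at [0]
    involves no negative power. *)
Definition Phi p a := Num.sg a * `|a| `^ (p - 1).

Lemma Phi0 p : Phi p 0 = 0.
Proof. by rewrite /Phi sgr0 mul0r. Qed.

Lemma PhiN p a : Phi p (- a) = - Phi p a.
Proof. by rewrite /Phi sgrN normrN mulNr. Qed.

Lemma ge0_Phi p a : 1 < p -> 0 <= a -> Phi p a = a `^ (p - 1).
Proof.
move=> p1; rewrite le_eqVlt => /orP[/eqP <-|a0].
  by rewrite Phi0 powR0 // subr_eq0 gt_eqF.
by rewrite /Phi gtr0_sg // mul1r gtr0_norm.
Qed.

Lemma le0_Phi p a : 1 < p -> a <= 0 -> Phi p a = - (- a) `^ (p - 1).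
Proof. by move=> p1 a0; rewrite -(opprK a) PhiN ge0_Phi ?opprK // oppr_ge0. Qed.

Lemma Phi_self p a : 1 < p -> Phi p a * a = `|a| `^ p.
Proof.
move=> p1; rewrite /Phi -mulrA (mulrC _ a) mulrA -normrEsg mulr_powRB1 //; lra.
Qed.

Lemma norm_Phi p a : 1 < p -> `|Phi p a| = `|a| `^ (p - 1).
Proof.
move=> p1; have [->|a0] := eqVneq a 0.
  by rewrite Phi0 normr0 powR0 // subr_eq0 gt_eqF.
by rewrite /Phi normrM normr_sg a0 mul1r (ger0_norm (powR_ge0 _ _)).
Qed.

Lemma Phi_mono p : 1 < p -> {homo Phi p : a b / a <= b}.
Proof.
move=> p1 a b ab; have p0 : 0 <= p - 1 by lra.
have [a0|a0] := leP 0 a.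
  by rewrite !ge0_Phi // ?(le_trans a0) // powR_le.
have [b0|b0] := leP 0 b.
  rewrite (ge0_Phi p1 b0) (le0_Phi p1 (ltW a0)) (@le_trans _ _ 0) ?powR_ge0 //.
  by rewrite oppr_le0 powR_ge0.
by rewrite !le0_Phi ?(ltW a0) ?(ltW b0) // lerN2 powR_le //; lra.
Qed.

(** Convexity of the power, in the form of Young's inequality for the conjugate
    exponents [p] and [p / (p - 1)]. *)
Lemma powR_tangent p x y : 1 < p ->
  `|x| `^ p + p * Phi p x * (y - x) <= `|y| `^ p.
Proof.
move=> p1; have p0 : 0 < p by lra.
have pq : p^-1 + (p / (p - 1))^-1 = 1 by field; rewrite ?gt_eqF //; lra.
have q0 : 0 < p / (p - 1) by rewrite divr_gt0; lra.
have := conjugate_powR (normr_ge0 y) (powR_ge0 `|x| (p - 1)) p0 q0 pq.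
rewrite -powRrM (_ : (p - 1) * (p / (p - 1)) = p); last by field; rewrite gt_eqF //; lra.
move=> h; have h1 : Phi p x * y <= `|y| * `|x| `^ (p - 1).
  by rewrite -norm_Phi // -normrM mulrC ler_norm.
rewrite mulrBr -(mulrA p _ x) Phi_self //.
have : p * (Phi p x * y) <= p * (`|y| `^ p / p + `|x| `^ p / (p / (p - 1))).
  by rewrite ler_pM2l // (le_trans h1).
have -> : p * (`|y| `^ p / p + `|x| `^ p / (p / (p - 1))) =
   `|y| `^ p + (p - 1) * `|x| `^ p by field; rewrite !gt_eqF //; lra.
lra.
Qed.

Lemma powR_convex p t a b : 1 < p -> 0 <= t <= 1 ->
  `|(1 - t) * a + t * b| `^ p <= (1 - t) * `|a| `^ p + t * `|b| `^ p.
Proof.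
move=> p1 /andP[t0 t1]; set x := _ + _.
have ha := powR_tangent x a p1; have hb := powR_tangent x b p1.
have := lerD (ler_wpM2l (_ : 0 <= 1 - t) ha) (ler_wpM2l t0 hb).
rewrite subr_ge0 => /(_ t1); apply: le_trans.
rewrite le_eqVlt; apply/orP; left; apply/eqP.
rewrite /x; ring.
Qed.

(** On a half line this is the subadditivity of the power [p - 1]; when [a] and [b]
    have opposite signs both are at distance at most [|a - b|] from [0]. *)
Lemma Phi_hoelder p a b : 1 < p -> p <= 2 ->
  `|Phi p a - Phi p b| <= 2 * `|a - b| `^ (p - 1).
Proof.
move=> p1 p2; have r0 : 0 <= p - 1 by lra.
wlog ab : a b / b <= a.
  by move=> h; have [/h//|/ltW/h] := leP b a; rewrite distrC (distrC b).
have pos c e : 0 <= e -> e <= c -> c `^ (p - 1) - e `^ (p - 1) <= (c - e) `^ (p - 1).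
  move=> e0 ec; rewrite lerBlDr (le_trans _ (powR_subadditive _ _ _)) ?subrK //; lra.
have P0 c : 0 <= c `^ (p - 1) by exact: powR_ge0.
rewrite (ger0_norm (_ : 0 <= Phi p a - _)) ?subr_ge0 ?Phi_mono // (ger0_norm (_ : 0 <= a - b)) ?subr_ge0 //.
have [b0|b0] := leP 0 b.
  rewrite !ge0_Phi ?(le_trans b0) //.
  have := pos a b b0 ab; have := P0 (a - b); lra.
have [a0|a0] := leP 0 a.
  rewrite ge0_Phi // le0_Phi ?(ltW b0) //.
  have h1 : a `^ (p - 1) <= (a - b) `^ (p - 1) by rewrite powR_le //; lra.
  have h2 : (- b) `^ (p - 1) <= (a - b) `^ (p - 1) by rewrite powR_le //; lra.
  lra.
rewrite !le0_Phi ?(ltW a0) ?(ltW b0) //.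
have := pos (- b) (- a); rewrite oppr_ge0 lerN2 => /(_ (ltW a0) ab).
rewrite (_ : - b - - a = a - b); last by ring.
have := P0 (a - b); lra.
Qed.

Lemma Phi_young p a b : 1 < p -> `|Phi p a * b| <= `|a| `^ p + `|b| `^ p.
Proof.
move=> p1; rewrite normrM norm_Phi //.
have [ab|ba] := leP `|a| `|b|.
  rewrite (@le_trans _ _ (`|b| `^ p)) ?lerDr ?powR_ge0 //.
  rewrite -(@mulr_powRB1 _ `|b| p) //; last lra.
  by rewrite mulrC ler_wpM2l // powR_le //; lra.
rewrite (@le_trans _ _ (`|a| `^ p)) ?lerDl ?powR_ge0 //.
rewrite -(@mulr_powRB1 _ `|a| p) //; last lra.
by rewrite mulrC ler_wpM2r // ?powR_ge0 // ltW.
Qed.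

(** The tangent inequality at the displaced point, whose slope is compared with the
    slope at [a] by [Phi_hoelder]. *)
Lemma powR_add_le p t a b : 1 < p -> p <= 2 -> 0 <= t ->
  `|a + t * b| `^ p <= `|a| `^ p + p * (t * (Phi p a * b)) + 2 * p * (t `^ p * `|b| `^ p).
Proof.
move=> p1 p2 t0; have := powR_tangent (a + t * b) a p1.
have h : (Phi p (a + t * b) - Phi p a) * (t * b) <= 2 * (t `^ p * `|b| `^ p).
  apply: (le_trans (ler_norm _)); rewrite normrM.
  apply: (le_trans (ler_wpM2r _ (Phi_hoelder _ _ p1 p2))); first exact: normr_ge0.
  rewrite addrAC subrr add0r -mulrA (mulrC (_ `^ _)) mulr_powRB1 //; last lra.
  by rewrite normrM (ger0_norm t0) powRM.
have := ler_wpM2l (_ : 0 <= p) h; have -> : 0 <= p by lra.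
move=> /(_ isT); rewrite (_ : a - (a + t * b) = - (t * b)); last ring.
move: (`|_ + _| `^ p) (`|a| `^ p) (`|b| `^ p) (t `^ p) (Phi p _) (Phi p a) => *.
lra.
Qed.

(** The free parameter [t] makes the concave power linear in [v]; integrated against
    a weight and optimized over [t], the bound becomes Hoelder's inequality. *)
Lemma powR_le_affine r (t v : R) : 0 < r -> r < 1 -> 0 < t -> 0 <= v ->
  v `^ r <= t `^ (r - 1) * v + t `^ r.
Proof.
move=> r0 r1 t0 v0; have [vt|tv] := leP v t.
  by rewrite (@le_trans _ _ (t `^ r)) ?lerDr ?mulr_ge0 ?powR_ge0 // powR_le // ltW.
have v1 : 0 < v by exact: lt_trans tv.
rewrite (@le_trans _ _ (t `^ (r - 1) * v)) ?lerDl ?powR_ge0 //.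
rewrite -(@mulr_powRB1 _ v r) // mulrC ler_wpM2r //.
rewrite -[r - 1]opprB !powRN lef_pV2 ?posrE ?powR_gt0 //.
by rewrite powR_le // ?(ltW tv) ?(ltW t0) //; lra.
Qed.

(** The solutions of [m' = - c m ^ (1 - q)] have [m ^ q] affine in time; an implicit
    Euler step respects this up to the inequality [(1 + y) ^ q <= 1 + y]. *)
Lemma powR_step q c a b : 0 < q -> q < 1 -> 0 <= c -> 0 <= a -> 0 <= b ->
  a <= b + c * b `^ (1 - q) -> a `^ q <= b `^ q + c.
Proof.
move=> q0 q1 c0 a0 b0 ab.
have [bz|bz] := eqVneq b 0.
  have : a = 0.
    apply/le_anti; rewrite a0 andbT; move: ab.
    by rewrite bz powR0 ?mulr0 ?addr0 // subr_eq0 gt_eqF.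
  by move=> ->; rewrite bz lerDl.
have bp : 0 < b by rewrite lt_neqAle eq_sym bz.
set y := c * b `^ (- q).
have y0 : 0 <= y by rewrite mulr_ge0 ?powR_ge0.
have e : b + c * b `^ (1 - q) = b * (1 + y).
  by rewrite mulrDr mulr1 /y mulrCA powRD ?bz ?implybT // powRr1.
rewrite e in ab.
apply: (le_trans (powR_le (ltW q0) a0 ab)).
rewrite powRM ?addr_ge0 //.
have h : (1 + y) `^ q <= 1 + y by rewrite ler1_powR //; lra.
apply: (le_trans (ler_wpM2l (powR_ge0 _ _) h)).
rewrite mulrDr mulr1 lerD2l /y mulrCA -powRD ?subrr ?powRr0 ?mulr1 //.
by rewrite bz implybT.
Qed.

Lemma powR_rootP q a b : 0 < q -> 0 <= a -> 0 <= b ->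
  (a `^ q^-1 <= b) = (a <= b `^ q).
Proof.
move=> q0 a0 b0; have qn : q != 0 by rewrite gt_eqF.
apply/idP/idP => h.
  have := powR_le (ltW q0) (powR_ge0 _ _) h.
  by rewrite -powRrM mulVf // powRr1.
have := powR_le (_ : 0 <= q^-1) a0 h; rewrite invr_ge0 (ltW q0) => /(_ isT).
by rewrite -powRrM mulfV // powRr1.
Qed.

End PowerInequalities.

(** * Nonlocal energy and its subdifferential *)

Section NonlocalEnergy.
Context d (T : measurableType d) (R : realType).
Variable mu : {sigma_finite_measure set T -> \bar R}.
Variables (K : T -> T -> R) (p : R).
Hypothesis K0 : forall x y, 0 <= K x y.
Hypothesis mK : measurable_fun setT (fun z : T * T => K z.1 z.2).
Hypothesis p1 : 1 < p.
Hypothesis p2 : p < 2.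
Implicit Types (f g h v w eta : T -> R) (z : T * T).

Notation L2 := (Lfun mu 2%:E).
Local Notation P := (mu \x mu)%E.

Let pp : 0 < p. Proof. exact: lt_trans p1. Qed.
Let p20 : 0 < 2 * p. Proof. by rewrite mulr_gt0. Qed.
Let c20 : 0 <= (2 * p)^-1. Proof. by rewrite invr_ge0 ltW. Qed.

Lemma ae_prod (A : T -> Prop) : {ae mu, forall x, A x} ->
  {ae P, forall z, A z.1 /\ A z.2}.
Proof.
move=> [N [mN N0 hN]]; exists ((N `*` setT) `|` (setT `*` N)); split.
- by apply: measurableU; exact: measurableX.
- have e1 : P (N `*` setT) = 0%E by rewrite product_measure1E // [X in (X * _)%E](_ : _ = 0%E) // mul0e.
  have e2 : P (setT `*` N) = 0%E by rewrite product_measure1E // [X in (_ * X)%E](_ : _ = 0%E) // mule0.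
  by rewrite measureU0 //; exact: measurableX.
- move=> z /= nA; apply: contrapT => h; apply: nA; split; apply: contrapT => nAz; apply: h.
    by left; split => //; exact: hN.
  by right; split => //; exact: hN.
Qed.

Definition dpow f z : R := `|f z.1 - f z.2| `^ p * K z.1 z.2.

(** The energy of an abstract kernel on a sigma-finite space. What follows depends
    on the geometry of the kernel only through the weights introduced later. *)
Definition nenergy f : \bar R :=
  ((2 * p)^-1%:E * \int[mu]_x \int[mu]_y (`|f x - f y| `^ p * K x y)%:E)%E.

Lemma dpow_ge0 f z : 0 <= dpow f z.
Proof. by rewrite mulr_ge0 ?powR_ge0. Qed.

Lemma measurable_diff f : measurable_fun setT f ->
  measurable_fun setT (fun z => f z.1 - f z.2).
Proof. by move=> mf; apply: measurable_funB; exact: measurableT_comp. Qed.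

Lemma measurable_dpow f : measurable_fun setT f -> measurable_fun setT (dpow f).
Proof.
move=> mf; apply: measurable_funM => //.
apply: (measurableT_comp (measurable_powR _)) => //.
by apply: measurableT_comp => //; exact: measurable_diff.
Qed.

(** Tonelli's theorem makes the energy an integral for the product measure, to
    which the linear theory of integrable functions applies. *)
Lemma nenergyE f : measurable_fun setT f ->
  nenergy f = ((2 * p)^-1%:E * \int[P]_z (dpow f z)%:E)%E.
Proof.
move=> mf; rewrite (fubini_tonelli1 (fun z => (dpow f z)%:E)) //.
  by apply/measurable_EFinP; exact: measurable_dpow.
by move=> z; rewrite lee_fin dpow_ge0.
Qed.

Definition fin_energy f := measurable_fun setT f /\ P.-integrable setT (EFin \o dpow f).

Definition fine_energy f : R := (2 * p)^-1 * \int[P]_z dpow f z.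

Lemma nenergy_fe f : measurable_fun setT f -> (nenergy f < +oo)%E <-> fin_energy f.
Proof.
move=> mf; rewrite nenergyE // /fin_energy (integrable_ge0P _ (dpow_ge0 f)); split.
  move=> h; split => //; split; first exact: measurable_dpow.
  rewrite ltNge leye_eq; apply: contraTN h => /eqP ->.
  by rewrite gt0_muley ?lte_fin ?ltxx // invr_gt0.
move=> [_ [_ h]]; rewrite lte_mul_pinfty // lee_fin.
Qed.

Lemma nenergy_en f : fin_energy f -> nenergy f = (fine_energy f)%:E.
Proof.
move=> [mf fi]; rewrite nenergyE // /fine_energy /Rintegral EFinM fineK //.
exact: integrable_fin_num.
Qed.

Lemma en_ge0 f : 0 <= fine_energy f.
Proof.
rewrite mulr_ge0 //.
by apply: Rintegral_ge0 => z _; exact: dpow_ge0.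
Qed.

(** Through [(a + b) ^ p <= 2 ^ p * (a ^ p + b ^ p)]. *)
Lemma fe_le2 f g h : measurable_fun setT h -> fin_energy f -> fin_energy g ->
  (forall x y, `|h x - h y| <= `|f x - f y| + `|g x - g y|) -> fin_energy h.
Proof.
move=> mh [mf fi] [mg gi] hfg; split => //.
apply: (@le_integrableR _ _ _ P _ (fun z => 2 `^ p * (dpow f z + dpow g z))).
- exact: measurable_dpow.
- move=> z; rewrite ger0_norm ?dpow_ge0 // /dpow -mulrDl mulrA ler_wpM2r //.
  apply: (@le_trans _ _ ((2 * Num.max `|f z.1 - f z.2| `|g z.1 - g z.2|) `^ p)).
    rewrite powR_le ?(ltW pp) // (le_trans (hfg _ _)) //.
    rewrite mulr_natl mulr2n lerD // le_max lexx ?orbT //.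
  rewrite powRM ?le_max ?normr_ge0 // ler_wpM2l ?powR_ge0 //.
  by rewrite /Num.max; case: ifPn => _; rewrite ?lerDl ?lerDr ?powR_ge0.
- have := integrableZl measurableT (2 `^ p) (integrableD measurableT fi gi).
  by apply: eq_integrable.
Qed.

Lemma fe0 : fin_energy (cst 0).
Proof.
split; first exact: measurable_cst.
rewrite (_ : EFin \o _ = cst 0%E); first exact: integrable0.
by apply/funext => z; rewrite /dpow /= subr0 normr0 powR0 ?mul0r // gt_eqF.
Qed.

Lemma fe_le f h : measurable_fun setT h -> fin_energy f ->
  (forall x y, `|h x - h y| <= `|f x - f y|) -> fin_energy h.
Proof.
move=> mh ff hf; apply: (fe_le2 mh ff fe0) => x y.
by rewrite /= subrr normr0 addr0.
Qed.

Lemma feZ c f : fin_energy f -> fin_energy (c \*o f).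
Proof.
move=> [mf fi]; split; first exact: measurable_funM.
rewrite (_ : EFin \o _ = (fun z => (`|c| `^ p)%:E * (EFin \o dpow f) z)%E).
  exact: integrableZl.
by apply/funext => z; rewrite /dpow /= -mulrBr normrM powRM // -EFinM mulrA.
Qed.

Lemma feD f g : fin_energy f -> fin_energy g -> fin_energy (f \+ g).
Proof.
move=> ff fg; apply: (fe_le2 _ ff fg); first by apply: measurable_funD; [case: ff|case: fg].
by move=> x y /=; rewrite opprD addrACA ler_normD.
Qed.

Lemma feN f : fin_energy f -> fin_energy (\- f).
Proof.
move=> ff; apply: (fe_le _ ff); first by apply: measurableT_comp => //; case: ff.
by move=> x y /=; rewrite -opprD normrN.
Qed.

Lemma feB f g : fin_energy f -> fin_energy g -> fin_energy (f \- g).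
Proof. by move=> ff fg; apply: (feD ff); exact: feN. Qed.

Lemma en_scale c f : fin_energy f -> fine_energy (c \*o f) = `|c| `^ p * fine_energy f.
Proof.
move=> [mf fi]; rewrite /fine_energy [RHS]mulrCA; congr ((2 * p)^-1 * _).
rewrite -RintegralZl //; apply: eq_Rintegral => z _.
by rewrite /dpow /= -mulrBr normrM powRM // mulrA.
Qed.

Lemma en_convex t f g : 0 <= t <= 1 -> fin_energy f -> fin_energy g ->
  fine_energy ((1 - t) \*o f \+ t \*o g) <= (1 - t) * fine_energy f + t * fine_energy g.
Proof.
move=> t01 ff fg; rewrite /fine_energy.
have [mf fi] := ff; have [mg gi] := fg.
have [_ hi] := feD (feZ (1 - t) ff) (feZ t fg).
rewrite !(mulrCA _ (2 * p)^-1) -mulrDr ler_wpM2l //.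
rewrite -!RintegralZl // -RintegralD //; last 2 first.
- by have := integrableZl measurableT (1 - t) fi; apply: eq_integrable.
- by have := integrableZl measurableT t gi; apply: eq_integrable.
apply: le_Rintegral => //.
  have := integrableD measurableT (integrableZl measurableT (1 - t) fi)
    (integrableZl measurableT t gi).
  by apply: eq_integrable.
move=> z _; rewrite /dpow /= !mulrA -mulrDl ler_wpM2r //.
rewrite (_ : _ - _ = (1 - t) * (f z.1 - f z.2) + t * (g z.1 - g z.2)); last by ring.
exact: powR_convex.
Qed.

(** The integrand of the derivative of the energy at [v] in the direction
    [eta]. *)
Definition dform v eta z : R :=
  Phi p (v z.1 - v z.2) * (eta z.1 - eta z.2) * K z.1 z.2.

Lemma measurable_Phi : measurable_fun setT (@Phi R p).
Proof. by apply: nondecreasing_measurable => // a b; exact: Phi_mono. Qed.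

Lemma measurable_dform v eta : measurable_fun setT v -> measurable_fun setT eta ->
  measurable_fun setT (dform v eta).
Proof.
move=> mv me; apply: measurable_funM => //; apply: measurable_funM.
  by apply: (measurableT_comp measurable_Phi); exact: measurable_diff.
exact: measurable_diff.
Qed.

Lemma integrable_dform v eta : fin_energy v -> fin_energy eta -> P.-integrable setT (EFin \o dform v eta).
Proof.
move=> [mv vi] [me ei]; apply: (@le_integrableR _ _ _ P _ (fun z => dpow v z + dpow eta z)).
- exact: measurable_dform.
- move=> z; rewrite /dform /dpow -mulrDl normrM (ger0_norm (K0 _ _)) ler_wpM2r //.
  exact: Phi_young.
- by have := integrableD measurableT vi ei; apply: eq_integrable.
Qed.

Definition nsubdiff v g : Prop :=
  [/\ v \in L2, g \in L2, (nenergy v < +oo)%E &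
      forall w, w \in L2 ->
        (nenergy v + (\int[mu]_x (g x * (w x - v x)))%R%:E <= nenergy w)%E].

Lemma nsubdiff_fe v g : nsubdiff v g -> fin_energy v.
Proof. by move=> [Lv _ + _]; rewrite nenergy_fe //; exact: L2_measurable Lv. Qed.

(** Competitors of infinite energy give no condition. *)
Lemma nsubdiffP v g : nsubdiff v g <-> [/\ v \in L2, g \in L2, fin_energy v &
  forall w, w \in L2 -> fin_energy w -> fine_energy v + ip mu g (w \- v) <= fine_energy w].
Proof.
split=> [h|[Lv Lg fv h]].
  have fv := nsubdiff_fe h; case: h => Lv Lg _ h; split => // w Lw fw.
  by rewrite -lee_fin -nenergy_en // EFinD -nenergy_en //; exact: h.
split => //; first by rewrite nenergy_fe //; exact: L2_measurable Lv.
move=> w Lw; have mw := L2_measurable Lw.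
have [fw|nfw] := pselect (fin_energy w).
  by rewrite !nenergy_en // -EFinD lee_fin; exact: h.
have -> : nenergy w = +oo%E; last exact: leey.
by apply/eqP; rewrite -leye_eq leNgt; apply/negP => /(nenergy_fe mw).
Qed.

(** The subdifferential is contained in the weak form of the nonlocal operator:
    dividing the subdifferential inequality for [v + t eta] by [t], the terms of
    order [t ^ p] vanish as [t] tends to [0]. *)
Lemma euler_lagrange v g eta : nsubdiff v g -> eta \in L2 -> fin_energy eta ->
  ip mu g eta <= 2^-1 * \int[P]_z dform v eta z.
Proof.
move=> /nsubdiffP[Lv Lg fv hv] Le fe_.
have [mv vi] := fv; have [me ei] := fe_.
have step t : 0 < t ->
    ip mu g eta <= 2^-1 * \int[P]_z dform v eta z +
       t `^ (p - 1) * \int[P]_z dpow eta z.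
  move=> t0.
  have ft : fin_energy (v \+ t \*o eta) by apply: feD => //; exact: feZ.
  have := hv (v \+ t \*o eta) (L2D Lv (L2Z _ Le)) ft.
  rewrite (_ : (v \+ t \*o eta) \- v = t \*o eta); last first.
    by apply/funext => x /=; rewrite addrAC subrr add0r.
  rewrite ipZr // /fine_energy.
  have hI : \int[P]_z dpow (v \+ t \*o eta) z <= \int[P]_z dpow v z +
      p * t * \int[P]_z dform v eta z + 2 * p * t `^ p * \int[P]_z dpow eta z.
    have di := integrable_dform fv fe_.
    have i2 : P.-integrable setT (EFin \o (fun z => p * t * dform v eta z)).
      by have := integrableZl measurableT (p * t) di; apply: eq_integrable.
    have i3 : P.-integrable setT (EFin \o (fun z => 2 * p * t `^ p * dpow eta z)).
      by have := integrableZl measurableT (2 * p * t `^ p) ei; apply: eq_integrable.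
    have i12 : P.-integrable setT (EFin \o (fun z => dpow v z + p * t * dform v eta z)).
      by have := integrableD measurableT vi i2; apply: eq_integrable.
    rewrite -!RintegralZl // -!RintegralD //.
    apply: le_Rintegral => //; first by case: ft.
      by have := integrableD measurableT i12 i3; apply: eq_integrable.
    move=> z _; rewrite /dpow /dform /= opprD addrACA -mulrBr.
    have := powR_add_le (v z.1 - v z.2) (eta z.1 - eta z.2) p1 (ltW p2) (ltW t0).
    move=> /(ler_wpM2r (K0 z.1 z.2)) h; apply: (le_trans h); rewrite le_eqVlt; apply/orP; left; apply/eqP; ring.
  move=> h; have {h} := le_trans h (ler_wpM2l c20 hI).
  rewrite -(@ler_pM2l _ (2 * p)) // mulrDr !mulrA !divff ?gt_eqF // !mul1r.
  rewrite -addrA lerD2l.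
  rewrite -(@mulr_powRB1 _ t p) //; last exact: ltW.
  move: (ip mu g eta) (\int[P]_z _) (\int[P]_z _) (t `^ _) => A B C D h.
  rewrite -(@ler_pM2l _ (2 * p * t)) ?mulr_gt0 //.
  apply: le_trans h _; rewrite le_eqVlt; apply/orP; left; apply/eqP; by field.
set I2 := \int[P]_z dpow eta z in step.
set A := ip mu g eta in step *; set B := 2^-1 * _ in step *.
have I20 : 0 <= I2 by apply: Rintegral_ge0 => z _; exact: dpow_ge0.
apply/ler_addgt0Pr => e e0.
have q0 : 0 < p - 1 by rewrite subr_gt0.
have I21 : 0 < I2 + 1 by rewrite ltr_wpDl.
have e1 : 0 < e / (I2 + 1) by rewrite divr_gt0.
have := step _ (powR_gt0 (p - 1)^-1 e1).
rewrite -powRrM mulVf ?gt_eqF // powRr1 ?(ltW e1) // => h; apply: (le_trans h).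
rewrite lerD2l mulrAC ler_pdivrMr // ler_pM2l // lerDl.
exact: ler01.
Qed.

(** * Order and homogeneity of the resolvent *)

Lemma measurable_pos f : measurable_fun setT f ->
  measurable_fun setT (fun x => Num.max 0 (f x)).
Proof. by move=> mf; apply: measurable_maxr => //; exact: measurable_cst. Qed.

Lemma pos_lip (a b : R) : `|Num.max 0 a - Num.max 0 b| <= `|a - b|.
Proof.
by rewrite /Num.max; case: ifPn; case: ifPn; rewrite -?leNgt => h1 h2;
  rewrite ler_norml; apply/andP; split; case: (ger0P (a - b)); lra.
Qed.

Lemma norm_pos (a : R) : `|Num.max 0 a| <= `|a|.
Proof. by have := pos_lip a 0; rewrite /Num.max ltxx !subr0. Qed.

Lemma L2_pos f : f \in L2 -> (fun x => Num.max 0 (f x)) \in L2.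
Proof.
move=> Lf; apply: (L2_le _ _ Lf); first exact: measurable_pos (L2_measurable Lf).
by move=> x; exact: norm_pos.
Qed.

Lemma fe_pos f : fin_energy f -> fin_energy (fun x => Num.max 0 (f x)).
Proof.
move=> ff; apply: (fe_le _ ff); first by apply: measurable_pos; case: ff.
by move=> x y; exact: pos_lip.
Qed.

Definition nresolvent (lam : R) f v : Prop :=
  exists2 g, nsubdiff v g & {ae mu, forall x, f x = v x + lam * g x}.

Lemma nresolvent_L2 lam f v : nresolvent lam f v -> v \in L2.
Proof. by move=> [g [Lv _ _ _] _]. Qed.

Lemma nresolvent_fe lam f v : nresolvent lam f v -> fin_energy v.
Proof. by move=> [g /nsubdiff_fe]. Qed.

Lemma ip_resolvent lam f v g h : f \in L2 -> v \in L2 -> g \in L2 -> h \in L2 ->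
  {ae mu, forall x, f x = v x + lam * g x} -> ip mu f h = ip mu v h + lam * ip mu g h.
Proof.
move=> Lf Lv Lg Lh fvg; rewrite -ipZl // -ipDl ?L2Z //.
by apply: ip_ae => //; rewrite ?L2D ?L2Z.
Qed.

Lemma Rintegral_le0 d' (T' : measurableType d') (nu : {measure set T' -> \bar R})
   (f : T' -> R) : (forall x, f x <= 0) -> \int[nu]_x f x <= 0.
Proof.
move=> f0; apply: fine_le0; rewrite integralE (eq_integral (cst 0%E)).
  by rewrite integral0 sub0e oppe_le0 integral_ge0.
by move=> x _; rewrite funeposE /= max_r // lee_fin.
Qed.

(** Testing with the positive part of [v1 - v2]: both the nonlocal form and the
    identity part of the resolvent equation are monotone on it. *)
Lemma nresolvent_le lam f1 f2 v1 v2 : 0 < lam -> f1 \in L2 -> f2 \in L2 ->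
  nresolvent lam f1 v1 -> nresolvent lam f2 v2 ->
  {ae mu, forall x, f1 x <= f2 x} -> {ae mu, forall x, v1 x <= v2 x}.
Proof.
move=> l0 Lf1 Lf2 [g1 s1 e1] [g2 s2 e2] f12.
have [Lv1 Lg1 _ _] := s1; have [Lv2 Lg2 _ _] := s2.
have fv1 := nsubdiff_fe s1; have fv2 := nsubdiff_fe s2.
pose chi x := Num.max 0 (v1 x - v2 x).
have Lchi : chi \in L2 by apply: (@L2_pos (v1 \- v2)); exact: L2B.
have fchi : fin_energy chi by apply: (@fe_pos (v1 \- v2)); exact: feB.
have h1 := euler_lagrange s1 (L2N Lchi) (feN fchi).
have h2 := euler_lagrange s2 Lchi fchi.
have h12 : \int[P]_z dform v1 (\- chi) z + \int[P]_z dform v2 chi z <= 0.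
  have i1 := integrable_dform fv1 (feN fchi); have i2 := integrable_dform fv2 fchi.
  rewrite -RintegralD //.
  apply: Rintegral_le0 => z; rewrite /dform /= -mulrDl mulr_le0_ge0 //.
  rewrite (_ : - chi z.1 - - chi z.2 = - (chi z.1 - chi z.2)); last by ring.
  rewrite mulrN -mulNr -mulrDl addrC.
  have [st|ts] := leP (v1 z.1 - v2 z.1) (v1 z.2 - v2 z.2).
    rewrite mulr_ge0_le0 // ?subr_ge0 ?subr_le0.
      by apply: Phi_mono => //; lra.
    by rewrite /chi; apply: le_max2 => //.
  rewrite mulr_le0_ge0 // ?subr_ge0 ?subr_le0.
    by apply: Phi_mono => //; lra.
  by rewrite /chi; apply: le_max2 => //; exact: ltW.
have hN : ip mu g1 (\- chi) = - ip mu g1 chi.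
  by rewrite (_ : \- chi = (-1) \*o chi) ?ipZr ?mulN1r //; apply/funext => x /=; rewrite mulN1r.
have E1 := ip_resolvent Lf1 Lv1 Lg1 Lchi e1.
have E2 := ip_resolvent Lf2 Lv2 Lg2 Lchi e2.
have hf : 0 <= ip mu (f2 \- f1) chi.
  apply: Rintegral_ge0_ae.
    apply: filterS f12 => x f12x; rewrite mulr_ge0 //= ?subr_ge0 // /chi le_max lexx //.
  by apply: measurable_funM; apply: (@L2_measurable _ _ _ mu); rewrite ?L2B.
have hv : ip mu (v1 \- v2) chi = ip mu chi chi.
  apply: eq_Rintegral => x _; rewrite /chi /Num.max /=.
  by case: ifPn => // _; rewrite mulr0 mul0r.
rewrite ipBl // in hf; rewrite ipBl // in hv.
have hc := ip_ge0 mu chi.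
have c0 : ip mu chi chi = 0.
  apply/le_anti; rewrite hc andbT; move: h1 h2 h12 hf; rewrite -hv hN E1 E2.
  move: (ip mu g1 chi) (ip mu g2 chi) (ip mu v1 chi) (ip mu v2 chi).
  move: (\int[P]_z _) (\int[P]_z _) => I1 I2 a1 a2 b1 b2 h1 h2 h12 hf.
  have a12 : a2 - a1 <= 0 by lra.
  have := mulr_ge0_le0 (ltW l0) a12; rewrite mulrBr; lra.
have := ip_eq0 Lchi c0; apply: filterS => x; rewrite /chi => h.
by rewrite -subr_le0 -h le_max lexx orbT.
Qed.

(** Testing with the excess of [v] over [M]. Comparison with a constant solution is
    not available, as constants need not be square-integrable. *)
Lemma nresolvent_ub lam f v (M : R) : 0 < lam -> 0 <= M -> f \in L2 ->
  nresolvent lam f v ->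
  {ae mu, forall x, f x <= M} -> {ae mu, forall x, v x <= M}.
Proof.
move=> l0 M0 Lf [g s e] fM.
have [Lv Lg _ _] := s; have fv := nsubdiff_fe s.
pose chi x := Num.max 0 (v x - M).
have mv := L2_measurable Lv.
have mchi : measurable_fun setT chi.
  by apply: measurable_pos; apply: measurable_funB => //; exact: measurable_cst.
have Lchi : chi \in L2.
  apply: (L2_le mchi _ Lv) => x; rewrite /chi /Num.max; case: ifPn => // h.
  by rewrite !gtr0_norm //; lra.
  by rewrite normr0.
have fchi : fin_energy chi.
  apply: (fe_le mchi fv) => x y; apply: (le_trans (pos_lip _ _)).
  by rewrite opprB addrA subrK.
have h1 := euler_lagrange s (L2N Lchi) (feN fchi).
have h0 : \int[P]_z dform v (\- chi) z <= 0.
  apply: Rintegral_le0 => z; rewrite /dform /= mulr_le0_ge0 //.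
  rewrite (_ : - chi z.1 - - chi z.2 = - (chi z.1 - chi z.2)); last by ring.
  rewrite mulrN oppr_le0.
  have [st|ts] := leP (v z.1) (v z.2).
    rewrite mulr_le0 // ?subr_le0.
      by rewrite -(Phi0 p); apply: Phi_mono => //; rewrite subr_le0.
    by rewrite /chi; apply: le_max2 => //; rewrite lerD2r.
  rewrite mulr_ge0 // ?subr_ge0.
    by rewrite -(Phi0 p); apply: Phi_mono => //; rewrite subr_ge0 ltW.
  by rewrite /chi; apply: le_max2 => //; rewrite lerD2r ltW.
have hN : ip mu g (\- chi) = - ip mu g chi.
  by rewrite (_ : \- chi = (-1) \*o chi) ?ipZr ?mulN1r //; apply/funext => x /=; rewrite mulN1r.
have E := ip_resolvent Lf Lv Lg Lchi e.
have hf : 0 <= ip mu (v \- f) chi - ip mu chi chi.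
  rewrite -ipBl ?L2B //; apply: Rintegral_ge0_ae.
    apply: filterS fM => x fMx /=; rewrite /chi /Num.max; case: ifPn => h; last by rewrite mulr0.
    by rewrite opprB addrC addrA subrK mulr_ge0 ?(ltW h) // subr_ge0.
  by apply: measurable_funM; apply: (@L2_measurable _ _ _ mu); rewrite ?L2B.
rewrite ipBl // in hf.
have hc := ip_ge0 mu chi.
have c0 : ip mu chi chi = 0.
  apply/le_anti; rewrite hc andbT; move: h1 h0 hf; rewrite hN E.
  move: (ip mu g chi) (ip mu v chi) (ip mu chi chi) (\int[P]_z _) => a b c I h1 h0 hf.
  have a0 : 0 <= a by lra.
  have := mulr_ge0 (ltW l0) a0; lra.
have := ip_eq0 Lchi c0; apply: filterS => x; rewrite /chi => h.
by rewrite -subr_le0 -h le_max lexx orbT.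
Qed.

Lemma nsubdiff0 : nsubdiff (cst 0) (cst 0).
Proof.
have L0 := L2_0 mu.
apply/nsubdiffP; split => //; first exact: fe0.
move=> w Lw fw; rewrite /ip /Rintegral.
under eq_integral do rewrite mul0r; rewrite integral0 addr0.
rewrite {1}/fine_energy /Rintegral (eq_integral (cst 0%E)) ?integral0 ?mulr0 ?en_ge0 //.
by move=> z _; rewrite /dpow /= subr0 normr0 powR0 ?mul0r // gt_eqF.
Qed.

Lemma nresolvent0 lam : nresolvent lam (cst 0) (cst 0).
Proof. by exists (cst 0); [exact: nsubdiff0|apply: aeW => x /=; rewrite mulr0 addr0]. Qed.

Lemma nresolvent_ge0 lam f v : 0 < lam -> f \in L2 -> nresolvent lam f v ->
  {ae mu, forall x, 0 <= f x} -> {ae mu, forall x, 0 <= v x}.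
Proof. by move=> l0 Lf; apply: nresolvent_le => //; [exact: L2_0|exact: nresolvent0]. Qed.

Lemma nsubdiff_mono v1 v2 g1 g2 : nsubdiff v1 g1 -> nsubdiff v2 g2 ->
  0 <= ip mu (g1 \- g2) (v1 \- v2).
Proof.
move=> /nsubdiffP[Lv1 Lg1 fv1 h1] /nsubdiffP[Lv2 Lg2 fv2 h2].
have := h1 _ Lv2 fv2; have := h2 _ Lv1 fv1.
rewrite !ipBr ?ipBl ?L2B //.
move: (ip mu g1 v1) (ip mu g1 v2) (ip mu g2 v1) (ip mu g2 v2) (fine_energy v1) (fine_energy v2).
move=> *; lra.
Qed.

(** The energy is homogeneous of degree [p], hence its subdifferential of degree
    [p - 1]. *)
Lemma nresolvent_scale lam c f v : 0 < c -> nresolvent lam f v ->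
  nresolvent (c `^ (2 - p) * lam) (c \*o f) (c \*o v).
Proof.
move=> c0 [g /nsubdiffP[Lv Lg fv h] e]; exists (c `^ (p - 1) \*o g); last first.
  apply: filterS e => x /= ->.
  have cn : c != 0 by rewrite gt_eqF.
  rewrite mulrDr mulrACA -powRD ?cn ?implybT //.
  by rewrite (_ : 2 - p + (p - 1) = 1) ?powRr1 ?(ltW c0) ?mulrA //; ring.
apply/nsubdiffP; split; [exact: L2Z|exact: L2Z|exact: feZ|] => w Lw fw.
have := h (c^-1 \*o w) (L2Z _ Lw) (feZ _ fw).
rewrite !en_scale // !ipBr ?L2Z // ?ipZl ?ipZr ?L2Z //.
have cn : c != 0 by rewrite gt_eqF.
have e1 : c `^ p * `|c^-1| `^ p = 1.
  by rewrite gtr0_norm ?invr_gt0 // -powRM ?invr_ge0 ?(ltW c0) // divff // powR1.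
have e2 := mulr_powRB1 (ltW c0) pp.
move=> h1; have := ler_wpM2l (powR_ge0 c p) h1; rewrite [leRHS]mulrA e1 mul1r.
apply: le_trans; rewrite (gtr0_norm c0) -e2 le_eqVlt; apply/orP; left; apply/eqP.
by field.
Qed.

(** * Existence of the resolvent *)

Lemma cvg_powR_norm (a_ : nat -> R) (a : R) : a_ n @[n --> \oo] --> a ->
  `|a_ n| `^ p @[n --> \oo] --> `|a| `^ p.
Proof.
move=> aa.
have h0 : a_ n - a @[n --> \oo] --> (0 : R) by rewrite -(subrr a); apply: cvgB => //; exact: cvg_cst.
apply: (@squeeze_cvgr _ _ _ _ (fun n => `|a| `^ p + p * Phi p a * (a_ n - a))
  (fun n => `|a| `^ p + p * Phi p a * (a_ n - a) + 2 * p * `|a_ n - a|)).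
- have h1 : \forall n \near \oo, `|a_ n - a| <= 1 by apply: (cvgr0_norm_le _ h0).
  apply: filterS h1 => n hn.
  apply/andP; split; first exact: powR_tangent.
  have := powR_add_le a (a_ n - a) p1 (ltW p2) ler01.
  rewrite powR1 !mul1r subrKC mulrA => h; apply: (le_trans h).
  rewrite lerD2l ler_pM2l // -[leLHS]ger0_norm ?powR_ge0 //.
  have [->|z] := eqVneq (a_ n - a) 0; first by rewrite normr0 powR0 ?normr0 // gt_eqF.
  by rewrite ger0_norm ?powR_ge0 // ge1r_powR ?normr_gt0 ?z ?hn // ltW.
- rewrite -[X in _ --> X]addr0; apply: cvgD; first exact: cvg_cst.
  by rewrite -(mulr0 (p * Phi p a)); apply: cvgM => //; exact: cvg_cst.
- rewrite -[X in _ --> X]addr0; apply: cvgD.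
    rewrite -[X in _ --> X]addr0; apply: cvgD; first exact: cvg_cst.
    by rewrite -(mulr0 (p * Phi p a)); apply: cvgM => //; exact: cvg_cst.
  rewrite -(mulr0 (2 * p)); apply: cvgM; first exact: cvg_cst.
  by rewrite -(@normr0 _ R); exact: cvg_norm.
Qed.

Lemma fatou_en (u : nat -> T -> R) (v : T -> R) (B : R) :
  (forall n, fin_energy (u n)) -> measurable_fun setT v ->
  {ae mu, forall x, u n x @[n --> \oo] --> v x} ->
  (\forall n \near \oo, fine_energy (u n) <= B) -> fin_energy v /\ fine_energy v <= B.
Proof.
move=> fu mv uv uB.
have h : (\int[P]_z (dpow v z)%:E <= (2 * p * B)%:E)%E.
  apply: (@fatou_ae _ _ _ P (fun n => dpow (u n))).
  - by move=> n; apply: measurable_dpow; case: (fu n).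
  - exact: measurable_dpow.
  - by move=> n z; exact: dpow_ge0.
  - apply: filterS (ae_prod uv) => z [h1 h2].
    rewrite /dpow; apply: cvgM; last exact: cvg_cst.
    by apply: cvg_powR_norm; exact: cvgB.
  - apply: filterS uB => n unB.
    rewrite -lee_fin in unB; apply: le_trans (_ : _ <= (2 * p * fine_energy (u n))%:E)%E _.
      rewrite /fine_energy mulrA divff ?gt_eqF // mul1r /Rintegral fineK //.
      by have [_ hi] := fu n; exact: integrable_fin_num.
    by rewrite lee_fin ler_pM2l.
have fv : fin_energy v.
  split => //; apply/integrable_ge0P; first exact: dpow_ge0.
  split; first exact: measurable_dpow.
  by rewrite (le_lt_trans h) ?ltry.
split => //; rewrite /fine_energy ler_pdivrMl // -lee_fin /Rintegral fineK //.
by apply: integrable_fin_num => //; case: fv.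
Qed.

Definition L2cvg (u : nat -> T -> R) (v : T -> R) : Prop := forall e : R, 0 < e ->
  \forall n \near \oo, ip mu (u n \- v) (u n \- v) <= e.

Lemma L2cvg_ip u v h : (forall n, u n \in L2) -> v \in L2 -> h \in L2 ->
  L2cvg u v -> ip mu (u n) h @[n --> \oo] --> ip mu v h.
Proof.
move=> Lu Lv Lh uv; apply/cvgrPdist_le => e e0.
have H0 := ip_ge0 mu h.
have H1 : 0 < ip mu h h + 1 by rewrite ltr_wpDl.
apply: filterS (uv (e ^+ 2 / (ip mu h h + 1)) _) => [n hn|]; last by rewrite divr_gt0 ?exprn_gt0.
rewrite distrC -ipBl // -(@ler_pXn2r _ 2) ?nnegrE ?normr_ge0 ?(ltW e0) //.
rewrite real_normK ?num_real //.
apply: (le_trans (cauchy_schwarz (L2B (Lu n) Lv) Lh)).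
apply: (le_trans (ler_wpM2r H0 hn)).
by rewrite mulrAC ler_pdivrMr // ler_wpM2l ?sqr_ge0 // lerDl ler01.
Qed.

Lemma ip_sq_le0 a b : a \in L2 -> b \in L2 ->
  ip mu (a \+ b) (a \+ b) <= 2 * ip mu a a + 2 * ip mu b b.
Proof.
move=> La Lb; have := ip_ge0 mu (a \- b).
rewrite !ipBr ?ipBl ?ipDr ?ipDl ?L2B ?L2D // (ipC mu b a).
move: (ip mu a a) (ip mu a b) (ip mu b b) => *; lra.
Qed.

(** By the direct method: [v] minimizes the functional
    [fine_energy v + |v - f| ^ 2 / (2 * lam)]. Minimizing sequences are Cauchy
    because the quadratic term is uniformly convex, the energy is lower
    semicontinuous, and comparing the minimum with the points of the segments issued
    from it gives the subdifferential inequality. *)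
Lemma nresolvent_exists lam f : 0 < lam -> f \in L2 -> exists v, nresolvent lam f v.
Proof.
move=> l0 Lf.
pose c : R := (2 * lam)^-1.
have c0 : 0 < c by rewrite invr_gt0 mulr_gt0.
pose F v := fine_energy v + c * ip mu (v \- f) (v \- f).
pose S := [set F v | v in [set v | v \in L2 /\ fin_energy v]].
have F0 v : 0 <= F v by rewrite addr_ge0 ?en_ge0 // mulr_ge0 ?ip_ge0 // ltW.
have hS : has_inf S.
  split; first by exists (F (cst 0)); exists (cst 0) => //; split; [exact: L2_0|exact: fe0].
  by exists 0 => _ [v _ <-].
pose m := inf S.
have mF v : v \in L2 -> fin_energy v -> m <= F v.
  by move=> Lv fv; apply: ge_inf; [case: hS|exists v].
have /choice[u hu] : forall n : nat, exists v, [/\ v \in L2, fin_energy v & F v <= m + n.+1%:R^-1].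
  move=> n; have n0 : 0 < n.+1%:R^-1 :> R by rewrite invr_gt0.
  have [_ [v [Lv fv] <-] h] := inf_adherent n0 hS.
  by exists v; split => //; exact: ltW.
have Lu n : u n \in L2 by case: (hu n).
have fu n : fin_energy (u n) by case: (hu n).
(* The parallelogram identity at the midpoint of [u i] and [u j]. *)
have cau i j : ip mu (u i \- u j) (u i \- u j) <= (4 * c^-1) * (i.+1%:R^-1 + j.+1%:R^-1) / 2.
  have [_ _ hi] := hu i; have [_ _ hj] := hu j.
  pose w := (1 - 2^-1) \*o u i \+ 2^-1 \*o u j.
  have Lw : w \in L2 by rewrite L2D ?L2Z.
  have fw : fin_energy w by apply: feD; exact: feZ.
  have h1 := mF w Lw fw.
  have h2 : fine_energy w <= (1 - 2^-1) * fine_energy (u i) + 2^-1 * fine_energy (u j).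
    by apply: en_convex => //; lra.
  have h3 : ip mu (w \- f) (w \- f) = 2^-1 * ip mu (u i \- f) (u i \- f) +
     2^-1 * ip mu (u j \- f) (u j \- f) - 4^-1 * ip mu (u i \- u j) (u i \- u j).
    rewrite /w !(ipBr, ipBl, ipDr, ipDl, ipZl, ipZr) ?L2B ?L2D ?L2Z //.
    rewrite (ipC mu (u j) (u i)) (ipC mu f (u i)) (ipC mu f (u j)); by field.
  move: h1 h2 hi hj; rewrite /F h3; clearbody c.
  move: (ip mu (u i \- u j) _) (ip mu (u i \- f) _) (ip mu (u j \- f) _) (fine_energy w)
    (fine_energy (u i)) (fine_energy (u j)) (i.+1%:R^-1) (j.+1%:R^-1) => D A B E1 E2 E3 x y h1 h2 hi hj.
  have -> : 4 / c * (x + y) / 2 = (c / 4)^-1 * ((x + y) / 2) by field; rewrite gt_eqF.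
  rewrite ler_pdivlMl ?divr_gt0 //; lra.
have small (e : R) : 0 < e -> exists n0, forall n, (n0 <= n)%N -> n.+1%:R^-1 <= e.
  move=> e0; exists (Num.bound e^-1) => n hn.
  rewrite -(invrK e) lef_pV2 ?posrE ?invr_gt0 //.
  have := archi_boundP (ltW (_ : 0 < e^-1)); rewrite invr_gt0 => /(_ e0) h.
  by rewrite (le_trans (ltW h)) // ler_nat (leq_trans hn).
have cau' (e : R) : 0 < e -> exists n0, forall i j, (n0 <= i)%N -> (n0 <= j)%N ->
    ip mu (u i \- u j) (u i \- u j) <= e.
  move=> e0; have [n0 hn0] := small (c * e / 4) (divr_gt0 (mulr_gt0 c0 e0) (ltr0n _ 4)).
  exists n0 => i j /hn0 hi /hn0 hj; apply: (le_trans (cau i j)).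
  clearbody c; move: (i.+1%:R^-1) (j.+1%:R^-1) hi hj => x y hi hj.
  have -> : 4 / c * (x + y) / 2 = c^-1 * (2 * (x + y)) by field; rewrite gt_eqF.
  by rewrite ler_pdivrMl //; lra.
have [v [Lv [k hk kv] uv]] := L2_complete Lu cau'.
have mv := L2_measurable Lv.
have uvk : L2cvg (fun n => u (k n)) v.
  move=> e e0; have [n0 hn0] := uv e e0; exists n0 => // n /= hn.
  by apply: hn0; exact: leq_trans (hk n).
have Lb : v \- f \in L2 by exact: L2B.
(* Lower semicontinuity, the quadratic term being continuous along the sequence. *)
have key (e : R) : 0 < e -> fin_energy v /\ fine_energy v <= m - c * ip mu (v \- f) (v \- f) + e.
  move=> e0; apply: (fatou_en (fun n => fu (k n)) mv kv).
  have hw := L2cvg_ip (fun n => Lu (k n)) Lv Lb uvk.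
  have e2 : 0 < e / (4 * c) by rewrite divr_gt0 // mulr_gt0.
  have hw2 : \forall n \near \oo, `|ip mu v (v \- f) - ip mu (u (k n)) (v \- f)| <= e / (4 * c).
    by move/cvgrPdist_le : hw; exact.
  have [n1 hn1] := small (e / 2) (divr_gt0 e0 (ltr0n _ 2)).
  near=> n.
  have [_ _ hn] := hu (k n).
  have h1 : (k n).+1%:R^-1 <= e / 2.
    by apply: hn1; rewrite (leq_trans _ (hk n)) //; near: n; exists n1.
  have h2 : `|ip mu v (v \- f) - ip mu (u (k n)) (v \- f)| <= e / (4 * c) by near: n.
  have h3 := ip_ge0 mu (u (k n) \- v).
  have h4 : ip mu (u (k n) \- f) (u (k n) \- f) = ip mu (v \- f) (v \- f) -
     2 * (ip mu v (v \- f) - ip mu (u (k n)) (v \- f)) + ip mu (u (k n) \- v) (u (k n) \- v).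
    rewrite !(ipBr, ipBl) ?L2B //.
    by rewrite (ipC mu v (u _)) (ipC mu f (u _)) (ipC mu f v); ring.
  move: hn; rewrite /F h4; clearbody c.
  move: (ip mu v _ - _) h2 => X; rewrite ler_norml => /andP[X1 X2].
  move: (ip mu (v \- f) _) (ip mu (u (k n) \- v) _) (fine_energy _) h1 h3 => A B E h1 h3 h.
  have h5 : c * X <= e / 4.
    by have := ler_wpM2l (ltW c0) X2; rewrite (_ : c * (e / (4 * c)) = e / 4) //; field; rewrite gt_eqF.
  have h6 := mulr_ge0 (ltW c0) h3.
  move: h h1 h5 h6; rewrite mulrDr mulrBr mulrCA.
  move: (c * A) (c * X) (c * B) (_^-1) => cA cX cB y h h1 h5 h6; lra.
have fv : fin_energy v by have [] := key 1 ltr01.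
have hv : fine_energy v + c * ip mu (v \- f) (v \- f) <= m.
  by apply/ler_addgt0Pr => e /key[_]; lra.
exists v; exists (lam^-1 \*o (f \- v)); last first.
  by apply: aeW => x /=; rewrite mulrA divff ?gt_eqF // mul1r addrC subrK.
apply/nsubdiffP; split => //; first by rewrite L2Z ?L2B.
move=> w Lw fw; rewrite ipZl ?L2B //.
apply/ler_addgt0Pr => e e0.
pose W := ip mu (w \- v) (w \- v).
have W0 : 0 <= W := ip_ge0 _ _.
(* Small enough for the term of order [t ^ 2] to be absorbed in [t * e]. *)
pose t := Num.min 1 (e / (c * (W + 1))).
have cW : 0 < c * (W + 1) by rewrite mulr_gt0 // ltr_wpDl.
have t0 : 0 < t by rewrite lt_min ltr01 divr_gt0.
have t1 : t <= 1 by rewrite ge_min lexx.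
have tW : c * (t * W) <= e.
  have : t <= e / (c * (W + 1)) by rewrite ge_min lexx orbT.
  rewrite ler_pdivlMr // => h; apply: le_trans h; rewrite mulrCA.
  by rewrite ler_wpM2l ?(ltW t0) // ler_wpM2l ?(ltW c0) // lerDl ler01.
have t01 : 0 <= t <= 1 by rewrite t1 ltW.
pose z := (1 - t) \*o v \+ t \*o w.
have Lz : z \in L2 by rewrite L2D ?L2Z.
have fz : fin_energy z by apply: feD; exact: feZ.
have h1 := mF z Lz fz; have h2 := en_convex t01 fv fw.
have h3 : ip mu (z \- f) (z \- f) = ip mu (v \- f) (v \- f) -
    2 * t * ip mu (f \- v) (w \- v) + t ^+ 2 * W.
  rewrite /W /z !(ipBr, ipBl, ipDr, ipDl, ipZl, ipZr) ?L2B ?L2D ?L2Z //.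
  by rewrite (ipC mu w v) (ipC mu f v) (ipC mu w f); ring.
move: h1; rewrite /F h3 -/z in h2 *.
have cl : c = 2^-1 * lam^-1 by rewrite /c invfM.
clearbody z t W; clear t1 t01 cW h3.
move=> h1; move: h1 tW hv; rewrite cl.
have li : 0 < lam^-1 by rewrite invr_gt0.
move: (lam^-1) li h2 => q q0.
move: (ip mu (v \- f) _) (ip mu (f \- v) _) (fine_energy z) (fine_energy v) (fine_energy w) => A B Ez Ev Ew.
move=> h2 h1 tW hv; have h4 := ler_wpM2l (ltW t0) tW.
rewrite -(@ler_pM2l _ t) //.
clear -h1 h2 hv h4; move: h1 h2 hv h4; clearbody m.
move: m e => m e h1 h2 hv h4.
have : t * q * B <= t * Ew + t * e - t * Ev by lra.
lra.
Unshelve. all: by end_near.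
Qed.

(** * Implicit Euler schemes *)

(** The implicit Euler scheme with step [lam] and initial value [f]. *)
Definition scheme (lam : R) f (v : nat -> T -> R) : Prop :=
  v 0%N = f /\ forall k, nresolvent lam (v k) (v k.+1).

Lemma scheme_L2 lam f (v : nat -> T -> R) k : f \in L2 -> scheme lam f v -> v k \in L2.
Proof. by move=> Lf [v0 hv]; case: k => [|k]; rewrite ?v0 //; exact: nresolvent_L2 (hv k). Qed.

Lemma scheme_exists (lam : R) f : 0 < lam -> f \in L2 -> exists v : nat -> T -> R, scheme lam f v.
Proof.
move=> l0 Lf.
have /choice[J hJ] : forall h, exists v, h \in L2 -> nresolvent lam h v.
  move=> h; have [Lh|nLh] := pselect (h \in L2); last by exists h => /nLh.
  by have [v hv] := nresolvent_exists l0 Lh; exists v.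
exists (fun k => iter k J f); split => // k; rewrite iterS; apply: (hJ).
by elim: k => // k IH; rewrite iterS; exact: nresolvent_L2 (hJ _ IH).
Qed.

Lemma scheme_shift lam f (v : nat -> T -> R) : scheme lam f v -> scheme lam (v 1%N) (fun k => v k.+1).
Proof. by move=> [v0 hv]; split. Qed.

Lemma scheme_le lam f1 f2 (v1 v2 : nat -> T -> R) k : 0 < lam -> f1 \in L2 -> f2 \in L2 ->
  scheme lam f1 v1 -> scheme lam f2 v2 ->
  {ae mu, forall x, f1 x <= f2 x} -> {ae mu, forall x, v1 k x <= v2 k x}.
Proof.
move=> l0 Lf1 Lf2 s1 s2 f12; elim: k => [|k IH]; first by rewrite s1.1 s2.1.
by apply: (nresolvent_le l0 _ _ (s1.2 k) (s2.2 k) IH); [exact: scheme_L2 s1|exact: scheme_L2 s2].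
Qed.

Lemma scheme_ge0 lam f (v : nat -> T -> R) k : 0 < lam -> f \in L2 -> scheme lam f v ->
  {ae mu, forall x, 0 <= f x} -> {ae mu, forall x, 0 <= v k x}.
Proof.
move=> l0 Lf s f0; elim: k => [|k IH]; first by rewrite s.1.
by apply: (nresolvent_ge0 l0 _ (s.2 k) IH); exact: scheme_L2 s.
Qed.

Lemma scheme_ub lam f (v : nat -> T -> R) M k : 0 < lam -> 0 <= M -> f \in L2 -> scheme lam f v ->
  {ae mu, forall x, f x <= M} -> {ae mu, forall x, v k x <= M}.
Proof.
move=> l0 M0 Lf s fM; elim: k => [|k IH]; first by rewrite s.1.
by apply: (nresolvent_ub l0 M0 _ (s.2 k) IH); exact: scheme_L2 s.
Qed.

Lemma scheme_scale lam c f (v : nat -> T -> R) : 0 < c -> scheme lam f v ->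
  scheme (c `^ (2 - p) * lam) (c \*o f) (fun k => c \*o v k).
Proof.
move=> c0 [v0 hv]; split; first by rewrite v0.
by move=> k; exact: nresolvent_scale.
Qed.

(** Pairing the monotonicity inequality with weights chosen so that the
    increments appear as differences of squares. *)
Lemma nresolvent_kobayashi lam nu f1 f2 v1 v2 : 0 < lam -> 0 < nu ->
  f1 \in L2 -> f2 \in L2 -> nresolvent lam f1 v1 -> nresolvent nu f2 v2 ->
  (lam + nu) * ip mu (v1 \- v2) (v1 \- v2) <=
    nu * ip mu (f1 \- v2) (f1 \- v2) + lam * ip mu (v1 \- f2) (v1 \- f2).
Proof.
move=> l0 n0 Lf1 Lf2 [g1 s1 e1] [g2 s2 e2].
have [Lv1 Lg1 _ _] := s1; have [Lv2 Lg2 _ _] := s2.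
have hm := nsubdiff_mono s1 s2.
have E1 h : h \in L2 -> lam * ip mu g1 h = ip mu f1 h - ip mu v1 h.
  by move=> Lh; rewrite (ip_resolvent Lf1 Lv1 Lg1 Lh e1) addrAC subrr add0r.
have E2 h : h \in L2 -> nu * ip mu g2 h = ip mu f2 h - ip mu v2 h.
  by move=> Lh; rewrite (ip_resolvent Lf2 Lv2 Lg2 Lh e2) addrAC subrr add0r.
have q1 := ip_ge0 mu (f1 \- v1); have q2 := ip_ge0 mu (f2 \- v2).
move: hm q1 q2; rewrite !(ipBr, ipBl) ?L2B //.
move: (E1 v1 Lv1) (E1 v2 Lv2) (E2 v1 Lv1) (E2 v2 Lv2).
rewrite (ipC mu v2 v1) (ipC mu v1 f1) (ipC mu v2 f1) (ipC mu v1 f2) (ipC mu v2 f2).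
move: (ip mu g1 v1) (ip mu g1 v2) (ip mu g2 v1) (ip mu g2 v2) => a1 a2 b1 b2.
move: (ip mu f1 v1) (ip mu f1 v2) (ip mu f2 v1) (ip mu f2 v2) => c1 c2 d1 d2.
move: (ip mu f1 f1) (ip mu f2 f2) (ip mu v1 v1) (ip mu v1 v2) (ip mu v2 v2) => F1 F2 V1 V12 V2.
move=> h1 h2 h3 h4 h5 h6 h7.
have h8 : 0 <= nu * (lam * a1 - lam * a2) - lam * (nu * b1 - nu * b2).
  have -> : nu * (lam * a1 - lam * a2) - lam * (nu * b1 - nu * b2) =
    (lam * nu) * (a1 - a2 - (b1 - b2)) by ring.
  rewrite mulr_ge0 ?mulr_ge0 ?(ltW l0) ?(ltW n0) //; lra.
rewrite h1 h2 h3 h4 in h8.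
have h9 := mulr_ge0 (ltW n0) h6; have h10 := mulr_ge0 (ltW l0) h7.
nra.
Qed.

(** The subdifferential is monotone. *)
Lemma nresolvent_contraction lam f1 f2 v1 v2 : 0 < lam ->
  f1 \in L2 -> f2 \in L2 -> nresolvent lam f1 v1 -> nresolvent lam f2 v2 ->
  ip mu (v1 \- v2) (v1 \- v2) <= ip mu (f1 \- f2) (f1 \- f2).
Proof.
move=> l0 Lf1 Lf2 [g1 s1 e1] [g2 s2 e2].
have [Lv1 Lg1 _ _] := s1; have [Lv2 Lg2 _ _] := s2.
have hm := nsubdiff_mono s1 s2.
have E1 h : h \in L2 -> ip mu f1 h = ip mu v1 h + lam * ip mu g1 h.
  by move=> Lh; exact: (ip_resolvent Lf1 Lv1 Lg1 Lh e1).
have E2 h : h \in L2 -> ip mu f2 h = ip mu v2 h + lam * ip mu g2 h.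
  by move=> Lh; exact: (ip_resolvent Lf2 Lv2 Lg2 Lh e2).
have q := ip_ge0 mu ((f1 \- f2) \- (v1 \- v2)).
have LV : v1 \- v2 \in L2 by exact: L2B.
have LF : f1 \- f2 \in L2 by exact: L2B.
rewrite ipBr ?L2B // !(ipBl LF LV) // in q.
have h : ip mu (f1 \- f2) (v1 \- v2) = ip mu (v1 \- v2) (v1 \- v2) +
    lam * ip mu (g1 \- g2) (v1 \- v2).
  rewrite (ipBl Lf1 Lf2 LV) E1 // E2 // (ipBl Lg1 Lg2 LV) (ipBl Lv1 Lv2 LV); ring.
have h2 := mulr_ge0 (ltW l0) hm.
rewrite (ipC mu (v1 \- v2) (f1 \- f2)) h in q.
move: q h2; move: (ip mu (v1 \- v2) _) (ip mu (f1 \- f2) _) (lam * _) => A B C q h2.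
lra.
Qed.

Lemma scheme_contraction lam f1 f2 (v1 v2 : nat -> T -> R) k : 0 < lam ->
  f1 \in L2 -> f2 \in L2 -> scheme lam f1 v1 -> scheme lam f2 v2 ->
  ip mu (v1 k \- v2 k) (v1 k \- v2 k) <= ip mu (f1 \- f2) (f1 \- f2).
Proof.
move=> l0 Lf1 Lf2 s1 s2; elim: k => [|k IH]; first by rewrite s1.1 s2.1.
apply: le_trans IH; apply: (nresolvent_contraction l0 _ _ (s1.2 k) (s2.2 k)).
  exact: scheme_L2 s1.
exact: scheme_L2 s2.
Qed.

(** The energy decreases along the scheme, by at least the squared increment
    divided by the step; Cauchy-Schwarz turns the sum of these into a bound on
    the distance to the initial value. *)
Lemma scheme_dist lam y (u : nat -> T -> R) k : 0 < lam -> y \in L2 -> fin_energy y ->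
  scheme lam y u -> fin_energy (u k) /\
  ip mu (u k \- y) (u k \- y) <= k%:R * lam * (fine_energy y - fine_energy (u k)).
Proof.
move=> l0 Ly fy s; elim: k => [|k [fk IH]].
  rewrite s.1; split => //; rewrite !mul0r.
  by rewrite !(ipBr, ipBl) ?L2B // !subrr.
have Lk := scheme_L2 k Ly s.
have [g hg e] := s.2 k; have [Lu' Lg fu' hmin] := (nsubdiffP _ _).1 hg.
split; first exact: fu'.
have h1 := hmin _ Lk fk.
set du := u k.+1 \- u k.
have Ld : du \in L2 by exact: L2B.
have E : lam * ip mu g (u k \- u k.+1) = ip mu du du.
  rewrite -[LHS](addKr (ip mu (u k.+1) (u k \- u k.+1))).
  rewrite -(ip_resolvent Lk Lu' Lg (L2B Lk Lu') e) /du.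
  rewrite !(ipBr, ipBl) ?L2B // (ipC mu (u k.+1) (u k)).
  ring.
have h2 : ip mu du du <= lam * (fine_energy (u k) - fine_energy (u k.+1)).
  by rewrite -E ler_wpM2l ?(ltW l0) // lerBrDl.
(* Young inequality for the squared norm of a sum, with the parameter [k]. *)
have h3 : k%:R * ip mu (u k.+1 \- y) (u k.+1 \- y) <=
   (k%:R + 1) * ip mu (u k \- y) (u k \- y) + k%:R * (k%:R + 1) * ip mu du du.
  have := ip_ge0 mu ((u k \- y) \- k%:R \*o du).
  rewrite /du !(ipBr, ipBl, ipZr, ipZl) ?L2B ?L2Z ?L2B //.
  rewrite (ipC mu y (u k)) (ipC mu y (u k.+1)) (ipC mu (u k.+1) (u k)).
  move: (ip mu (u k) (u k)) (ip mu (u k) y) (ip mu (u k) (u k.+1)) (ip mu y y)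
    (ip mu (u k.+1) y) (ip mu (u k.+1) (u k.+1)) (k%:R) => A B C D E1 F n h.
  rewrite -subr_ge0; apply: (le_trans h); rewrite le_eqVlt; apply/orP; left; apply/eqP; ring.
rewrite -natr1.
have [k0|k0] := posnP k.
  have -> : u k.+1 \- y = du by rewrite /du k0 s.1.
  rewrite k0 add0r mul1r; move: h2; rewrite k0 s.1; exact.
have kp : 0 < k%:R :> R by rewrite ltr0n.
rewrite -(@ler_pM2l _ k%:R) //; apply: (le_trans h3).
move: IH h2; move: (ip mu (u k \- y) _) (ip mu du du) (fine_energy y) (fine_energy (u k)) (fine_energy (u k.+1)) (k%:R) kp.
move=> A B E0 E1 E2 n n0 h4 h5.
have n1 : 0 <= n + 1 by rewrite addr_ge0 ?(ltW n0).
have h6 := ler_wpM2l n1 h4.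
have h7 := ler_wpM2l (mulr_ge0 (ltW n0) n1) h5.
apply: (le_trans (lerD h6 h7)); rewrite le_eqVlt; apply/orP; left; apply/eqP; ring.
Qed.

(** Kobayashi's estimate. By [nresolvent_kobayashi] the squared distance at [(k, l)]
    is at most an average of those at [(k - 1, l)] and [(k, l - 1)]; the right-hand
    side satisfies the same recursion with equality, and it dominates the bound of
    [scheme_dist] when [k] or [l] vanishes. The parameter [e] linearizes the
    square root of the usual form of the estimate. *)
Lemma scheme_kobayashi lam nu y (u w : nat -> T -> R) (e : R) k l :
  0 < lam -> 0 < nu -> 0 < e -> y \in L2 -> fin_energy y -> scheme lam y u -> scheme nu y w ->
  ip mu (u k \- w l) (u k \- w l) <= 2^-1 * fine_energy y *
    (((k%:R * lam - l%:R * nu) ^+ 2 + k%:R * lam ^+ 2 + l%:R * nu ^+ 2) / e + e).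
Proof.
move=> l0 n0 e0 Ly fy su sw.
have E0 := en_ge0 y.
have bd (x z : R) : 0 <= x -> 0 <= z -> x * fine_energy y <= 2^-1 * fine_energy y * ((x ^+ 2 + z) / e + e).
  move=> x0 z0; rewrite mulrC -mulrA (mulrCA 2^-1) ler_wpM2l // ler_pdivlMl //.
  have : 0 <= z / e by rewrite divr_ge0 // ltW.
  have : 0 <= (x - e) ^+ 2 / e by rewrite divr_ge0 ?sqr_ge0 // ltW.
  rewrite (_ : (x - e) ^+ 2 / e = x ^+ 2 / e - 2 * x + e); last by field; rewrite gt_eqF.
  rewrite mulrDl; lra.
have dist0 (la : R) (v : nat -> T -> R) j : 0 < la -> scheme la y v ->
    ip mu (v j \- y) (v j \- y) <= j%:R * la * fine_energy y.
  move=> la0 sv; have [_ h] := scheme_dist j la0 Ly fy sv.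
  apply: (le_trans h); rewrite ler_wpM2l ?mulr_ge0 ?(ltW la0) //.
  by rewrite gerBl en_ge0.
elim: k l => [|k IHk] l.
  rewrite su.1 (_ : ip _ _ _ = ip mu (w l \- y) (w l \- y)); last first.
    by apply: eq_Rintegral => x _ /=; ring.
  apply: (le_trans (dist0 _ _ l n0 sw)).
  rewrite !mul0r sub0r sqrrN addr0; apply: bd; rewrite ?mulr_ge0 ?sqr_ge0 ?(ltW n0) //.
elim: l => [|l IHl].
  rewrite sw.1; apply: (le_trans (dist0 _ _ k.+1 l0 su)).
  rewrite !mul0r subr0 addr0; apply: bd; rewrite ?mulr_ge0 ?sqr_ge0 ?(ltW l0) //.
have h := nresolvent_kobayashi l0 n0 (scheme_L2 k Ly su) (scheme_L2 l Ly sw) (su.2 k) (sw.2 l).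
have h1 := ler_wpM2l (ltW n0) (IHk l.+1); have h2 := ler_wpM2l (ltW l0) IHl.
rewrite -(@ler_pM2l _ (lam + nu)) ?addr_gt0 //.
apply: (le_trans h); apply: (le_trans (lerD h1 h2)).
rewrite le_eqVlt; apply/orP; left; apply/eqP; rewrite -!natr1.
move: (fine_energy y) (k%:R) (l%:R) => E a b; by field; rewrite gt_eqF.
Qed.

(** * The semigroup *)

Lemma Lnorm2_ip f : f \in L2 -> 'N[mu]_2%:E[EFin \o f]%E = (Num.sqrt (ip mu f f))%:E.
Proof.
move=> Lf; rewrite -powR12_sqrt ?ip_ge0 // -poweR_EFin ip_EFin // unlock /Lnorm.
congr poweR; apply: eq_integral => x _ /=.
by rewrite powR_mulrn // real_normK // num_real.
Qed.

Lemma Lnorm2_cvg0 (u : nat -> T -> R) w : (forall n, u n \in L2) -> w \in L2 ->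
  'N[mu]_2%:E[EFin \o (u n \- w)%R]%E @[n --> \oo] --> 0%E <-> L2cvg u w.
Proof.
move=> Lu Lw.
have -> : (fun n => 'N[mu]_2%:E[EFin \o (u n \- w)%R]%E) =
    (fun n => (Num.sqrt (ip mu (u n \- w) (u n \- w)))%:E).
  by apply/funext => n; rewrite Lnorm2_ip // L2B.
split.
  move=> /fine_cvgP[_ /cvgrPdist_le h] e e0.
  apply: filterS (h (Num.sqrt e) _); last by rewrite sqrtr_gt0.
  move=> n /=; rewrite sub0r normrN ger0_norm ?sqrtr_ge0 // ler_sqrt //.
  exact: ltW.
move=> h; apply: cvg_EFin; first exact: nearW.
apply/cvgrPdist_le => e e0; apply: filterS (h (e ^+ 2) _); last by rewrite exprn_gt0.
move=> n /= hn; rewrite sub0r normrN ger0_norm ?sqrtr_ge0 //.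
by rewrite -[leRHS]ger0_norm ?(ltW e0) // -sqrtr_sqr ler_sqrt ?sqr_ge0.
Qed.

(** The exponential formula for the abstract energy. *)
Definition nsemigroup (t : R) f w : Prop :=
  [/\ f \in L2, w \in L2 &
      if t == 0 then {ae mu, forall x, w x = f x}
      else exists v : nat -> nat -> T -> R,
        [/\ forall n, v n 0%N = f,
            forall n k, nresolvent (t / n.+1%:R) (v n k) (v n k.+1) &
            'N[mu]_2%:E[EFin \o (v n n.+1 \- w)%R]%E @[n --> \oo] --> 0%E]].

Lemma ip_tri3 a b c : a \in L2 -> b \in L2 -> c \in L2 ->
  ip mu (a \+ (b \+ c)) (a \+ (b \+ c)) <= 4 * (ip mu a a + ip mu b b + ip mu c c).
Proof.
move=> La Lb Lc; apply: (le_trans (ip_sq_le0 La (L2D Lb Lc))).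
have := ip_sq_le0 Lb Lc; have := ip_ge0 mu a.
move: (ip mu a a) (ip mu b b) (ip mu c c) (ip mu (b \+ c) _) => *; lra.
Qed.

(** Without any density of the domain: the first step [v] of the scheme
    converges as the step [lam] decreases, since [|f - v| ^ 2] decreases too and
    controls the variation of [v]. *)
Lemma first_step_cauchy lam nu f v1 v2 : 0 < nu -> nu < lam -> f \in L2 ->
  nresolvent lam f v1 -> nresolvent nu f v2 ->
  ip mu (v2 \- v1) (v2 \- v1) <= ip mu (f \- v1) (f \- v1) - ip mu (f \- v2) (f \- v2).
Proof.
move=> n0 nl Lf [g1 s1 e1] [g2 s2 e2]; have l0 : 0 < lam by exact: lt_trans nl.
have [Lv1 Lg1 _ _] := s1; have [Lv2 Lg2 _ _] := s2.
have hm := nsubdiff_mono s1 s2.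
have LV : v1 \- v2 \in L2 by exact: L2B.
have E1 : lam * ip mu g1 (v1 \- v2) = ip mu (f \- v1) (v1 \- v2).
  by rewrite ipBl // (ip_resolvent Lf Lv1 Lg1 LV e1) addrAC subrr add0r.
have E2 : nu * ip mu g2 (v1 \- v2) = ip mu (f \- v2) (v1 \- v2).
  by rewrite ipBl // (ip_resolvent Lf Lv2 Lg2 LV e2) addrAC subrr add0r.
have h : 0 <= nu * ip mu (f \- v1) (v1 \- v2) - lam * ip mu (f \- v2) (v1 \- v2).
  rewrite -E1 -E2 mulrCA -!mulrBr -ipBl //.
  by rewrite mulr_ge0 ?(ltW l0) // mulr_ge0 ?(ltW n0).
have A0 := ip_ge0 mu (v2 \- v1); move: h A0.
rewrite !(ipBr, ipBl) ?L2B // (ipC mu v2 v1) (ipC mu v1 f) (ipC mu v2 f).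
move: (ip mu f f) (ip mu f v1) (ip mu f v2) (ip mu v1 v1) (ip mu v1 v2) (ip mu v2 v2).
move=> F F1 F2 V1 V12 V2 h A0.
set A := V2 - V12 - (V12 - V1) in A0 *.
set B := F - F1 - (F1 - V1) - (F - F2 - (F2 - V2)).
have h2 : (lam + nu) * A <= (lam - nu) * B.
  rewrite -subr_ge0; apply: (le_trans (mulr_ge0 (ler0n R 2) h)).
  rewrite le_eqVlt; apply/orP; left; apply/eqP; rewrite /A /B; ring.
have d0 : 0 < lam - nu by rewrite subr_gt0.
have s0 : 0 < lam + nu by rewrite addr_gt0.
have B0 : 0 <= B.
  by rewrite -(@pmulr_rge0 _ (lam - nu)) // (le_trans _ h2) // mulr_ge0 // ltW.
rewrite -(@ler_pM2l _ (lam + nu)) //; apply: (le_trans h2).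
by rewrite ler_wpM2r // lerD2l (@le_trans _ _ 0) ?oppr_le0 // ltW.
Qed.

(** The schemes started at [f] are compared, after their first step, with schemes
    started at the first iterate [y] of a single fine scheme: the contraction
    property bounds the difference by the variation of the first step, which is
    small, and [y] has finite energy, so that the schemes started at [y] satisfy
    Kobayashi's estimate. *)
Lemma nsemigroup_exists (t : R) f : 0 <= t -> f \in L2 -> exists w, nsemigroup t f w.
Proof.
move=> t0 Lf; have [tz|tn0] := eqVneq t 0.
  by exists f; split => //; rewrite tz eqxx; exact: aeW.
have tp : 0 < t by rewrite lt_neqAle eq_sym tn0.
pose l (n : nat) : R := t / n.+1%:R.
have l0 n : 0 < l n by rewrite divr_gt0.
have /choice[V hV] : forall n, exists v : nat -> T -> R, scheme (l n) f v.
  by move=> n; exact: scheme_exists.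
have LV n k : V n k \in L2 by exact: scheme_L2 (hV n).
have lmono i j : (i < j)%N -> l j < l i.
  by move=> ij; rewrite ltr_pM2l // ltf_pV2 ?posrE // ltr_nat.
have lsmall (e : R) : 0 < e -> exists n0, forall n, (n0 <= n)%N -> l n <= e.
  move=> e0; exists (Num.bound (t / e)) => n hn.
  rewrite ler_pdivrMr // mulrC -ler_pdivrMr //.
  have h := archi_boundP (ltW (divr_gt0 tp e0)).
  by rewrite (le_trans (ltW h)) // ler_nat (leq_trans hn).
have R1 n : nresolvent (l n) f (V n 1%N) by have [h0 h] := hV n; rewrite -h0.
pose a n := ip mu (f \- V n 1%N) (f \- V n 1%N).
have aV i j : (i <= j)%N -> ip mu (V j 1%N \- V i 1%N) (V j 1%N \- V i 1%N) <= a i - a j.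
  rewrite leq_eqVlt => /orP[/eqP ->|ij].
    by rewrite subrr !(ipBr, ipBl) ?L2B // !subrr.
  exact: first_step_cauchy (l0 j) (lmono _ _ ij) Lf (R1 i) (R1 j).
have amono i j : (i <= j)%N -> a j <= a i.
  by move=> /aV h; rewrite -subr_ge0; apply: le_trans h; exact: ip_ge0.
have acau (e : R) : 0 < e -> exists n1, forall n, (n1 <= n)%N -> a n1 - a n <= e.
  move=> e0; have hS : has_inf (range a).
    by split; [exists (a 0%N); exists 0%N|exists 0 => _ [n _ <-]; exact: ip_ge0].
  have [_ [n1 _ <-] h] := inf_adherent e0 hS.
  exists n1 => n n1n; have : inf (range a) <= a n by apply: ge_inf; [case: hS|exists n].
  move: h; move: (inf _) (a n) (a n1) => I x y; lra.
(* The approximation of the value at time [t] by the scheme with step [t / n.+1]. *)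
pose z n := V n n.+1.
have Lz n : z n \in L2 by exact: LV.
have cau (e : R) : 0 < e -> exists n0, forall i j, (n0 <= i)%N -> (n0 <= j)%N ->
    ip mu (z i \- z j) (z i \- z j) <= e.
  move=> e0; have e12 : 0 < e / 12 by rewrite divr_gt0.
  have [n1 hn1] := acau _ e12.
  pose y := V n1 1%N.
  have Ly : y \in L2 by exact: LV.
  have fy : fin_energy y by exact: nresolvent_fe (R1 n1).
  have /choice[Y hY] : forall n, exists v : nat -> T -> R, scheme (l n) y v.
    by move=> n; exact: scheme_exists.
  have LY n k : Y n k \in L2 by exact: scheme_L2 (hY n).
  (* The scheme for [y] lags one step behind the scheme for [f]. *)
  have near_y n : (n1 <= n)%N -> ip mu (z n \- Y n n) (z n \- Y n n) <= e / 12.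
    move=> n1n; apply: le_trans (hn1 n n1n); apply: le_trans (aV _ _ n1n).
    exact: (scheme_contraction n (l0 n) (LV n 1%N) Ly (scheme_shift (hV n)) (hY n)).
  have E0 := en_ge0 y.
  pose del := e / 12 / (fine_energy y + 1).
  have del0 : 0 < del by rewrite divr_gt0 // ltr_wpDl.
  have d1 : 0 < del ^+ 2 / (t * 4) by rewrite divr_gt0 ?exprn_gt0 // mulr_gt0.
  have [n2 hn2] := lsmall _ d1.
  have [n3 hn3] := lsmall _ (divr_gt0 del0 (ltr0n R 2)).
  have YY i j : (maxn n2 n3 <= i)%N -> (maxn n2 n3 <= j)%N ->
      ip mu (Y i i \- Y j j) (Y i i \- Y j j) <= e / 12.
    rewrite !geq_max => /andP[i2 i3] /andP[j2 j3].
    apply: (le_trans (scheme_kobayashi i j (l0 i) (l0 j) del0 Ly fy (hY i) (hY j))).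
    have nl n : n%:R * l n = t - l n.
      by rewrite -[n%:R](addrK 1) natr1 mulrBl mul1r /l mulrCA divff ?mulr1.
    have nl2 n : n%:R * l n ^+ 2 <= t * l n.
      by rewrite expr2 mulrA ler_wpM2r ?(ltW (l0 n)) // nl gerBl ltW.
    have hi := hn2 i i2; have hj := hn2 j j2; have hi3 := hn3 i i3; have hj3 := hn3 j j3.
    have b1 : (i%:R * l i - j%:R * l j) ^+ 2 <= del ^+ 2 / 4.
      rewrite !nl; have li := l0 i; have lj := l0 j.
      have -> : del ^+ 2 / 4 = (del / 2) ^+ 2 by field.
      rewrite -(real_normK (num_real _)) lerXn2r ?nnegrE //.
        by rewrite ltW // divr_gt0.
      rewrite ler_norml; move: hi3 hj3 li lj; clear.
      move: (del / 2) (l i) (l j) => *; lra.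
    have b2 n : l n <= del ^+ 2 / (t * 4) -> n%:R * l n ^+ 2 <= del ^+ 2 / 4.
      move=> h; apply: (le_trans (nl2 n)); apply: (le_trans (ler_wpM2l t0 h)).
      by rewrite le_eqVlt; apply/orP; left; apply/eqP; field.
    have b3 : ((i%:R * l i - j%:R * l j) ^+ 2 + i%:R * l i ^+ 2 + j%:R * l j ^+ 2) / del + del
        <= 2 * del.
      rewrite [leRHS]mulr_natl mulr2n lerD2r ler_pdivrMr //.
      have := b2 i hi; have := b2 j hj; rewrite -expr2.
      move: b1; move: (_ ^+ 2) (_ * l i ^+ 2) (_ * l j ^+ 2) (del ^+ 2) (sqr_ge0 del) => *; lra.
    apply: (le_trans (ler_wpM2l _ b3)); first by rewrite mulr_ge0.
    have -> : 2^-1 * fine_energy y * (2 * del) = fine_energy y * del by field.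
    rewrite /del mulrCA ler_piMr ?(ltW e12) // ler_pdivrMr ?mul1r ?lerDl ?ler01 //.
    by rewrite ltr_wpDl.
  exists (maxn n1 (maxn n2 n3)) => i j; rewrite !(geq_max _ n1) => /andP[i1 i2] /andP[j1 j2].
  have := ip_tri3 (L2B (Lz i) (LY i i)) (L2B (LY i i) (LY j j)) (L2B (LY j j) (Lz j)).
  have -> : ip mu (Y j j \- z j) (Y j j \- z j) = ip mu (z j \- Y j j) (z j \- Y j j).
    by apply: eq_Rintegral => x _ /=; ring.
  have -> : ip mu ((z i \- Y i i) \+ ((Y i i \- Y j j) \+ (Y j j \- z j)))
      ((z i \- Y i i) \+ ((Y i i \- Y j j) \+ (Y j j \- z j))) =
      ip mu (z i \- z j) (z i \- z j).
    by apply: eq_Rintegral => x _ /=; ring.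
  have := near_y i i1; have := near_y j j1; have := YY i j i2 j2.
  move: (ip mu (z i \- Y i i) _) (ip mu (z j \- Y j j) _) (ip mu (Y i i \- Y j j) _) => A B C hC hB hA h.
  apply: (le_trans h); lra.
have [w [Lw _ zw]] := L2_complete Lz cau.
exists w; split => //; rewrite (negbTE tn0); exists V; split.
- by move=> n; case: (hV n).
- by move=> n; case: (hV n).
- apply/(@Lnorm2_cvg0 z) => // e /zw[n0 hn0]; exists n0 => // n /=; exact: hn0.
Qed.

(** * Decay of the weighted mass *)

Hypothesis Ksym : forall x y, K x y = K y x.

(** The bound for the nonlocal variation of the weight governs the decay of the mass,
    and the lower bound for the kernel the propagation of positivity. *)
Record weight (phi : T -> R) (F C0 kappa : R) : Prop := Weight {
  weight_measurable : measurable_fun setT phi;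
  weight_gt0 : forall x, 0 < phi x;
  weight_le1 : forall x, phi x <= 1;
  weight_mass : (\int[mu]_x (phi x)%:E <= F%:E)%E;
  weight_var : forall x, (\int[mu]_y (`|phi x - phi y| * K x y)%:E <= (C0 * phi x)%:E)%E;
  weight_kernel : forall x y, x <> y -> kappa * (phi x * phi y) <= K x y;
  weight_F : 0 < F;
  weight_C0 : 0 <= C0;
  weight_kappa : 0 < kappa }.

Section Weighted.
Variables (phi : T -> R) (F C0 kappa : R).
Hypothesis W : weight phi F C0 kappa.

Let mphi := weight_measurable W.
Let phi0 x : 0 <= phi x. Proof. exact: ltW (weight_gt0 W x). Qed.
Let F0 := weight_F W.

Lemma integrable_weight : mu.-integrable setT (EFin \o phi).
Proof.
apply/integrable_ge0P => //; split; first exact: mphi.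
by rewrite (le_lt_trans (weight_mass W)) ?ltry.
Qed.

Lemma L2_weight : phi \in L2.
Proof.
apply/L2P; split; first exact: mphi.
apply: le_lt_trans (_ : (\int[mu]_x (phi x)%:E < +oo)%E).
  apply: ge0_le_integral => //.
  - by move=> x _; rewrite lee_fin sqr_ge0.
  - by apply/measurable_EFinP; exact: measurable_funX.
  - by apply/measurable_EFinP; exact: mphi.
  - by move=> x _; rewrite lee_fin expr2 ler_piMr // (weight_le1 W).
by rewrite (le_lt_trans (weight_mass W)) ?ltry.
Qed.

Definition varphi z : R := `|phi z.1 - phi z.2| * K z.1 z.2.

Lemma varphi_ge0 z : 0 <= varphi z.
Proof. by rewrite mulr_ge0. Qed.

Lemma measurable_varphi : measurable_fun setT varphi.
Proof.
apply: measurable_funM => //; apply: measurableT_comp => //.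
exact: (measurable_diff mphi).
Qed.

Lemma weighted_var1 (a : T -> R) : measurable_fun setT a -> (forall x, 0 <= a x) ->
  (\int[P]_z (a z.1 * varphi z)%:E <= C0%:E * \int[mu]_x (a x * phi x)%:E)%E.
Proof.
move=> ma a0.
have ma1 : measurable_fun setT (fun z : T * T => a z.1) by exact: measurableT_comp.
rewrite (fubini_tonelli1 (fun z => (a z.1 * varphi z)%:E)) /=; last 2 first.
- by apply/measurable_EFinP; apply: measurable_funM => //; exact: measurable_varphi.
- by move=> z; rewrite lee_fin mulr_ge0 ?varphi_ge0.
rewrite -ge0_integralZl_EFin ?(weight_C0 W) //; last 2 first.
- by move=> x _; rewrite lee_fin mulr_ge0.
- by apply/measurable_EFinP; apply: measurable_funM.
have mv x : measurable_fun setT (fun y => varphi (x, y)).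
  exact: (measurableT_comp measurable_varphi (measurable_pair1 x)).
apply: ge0_le_integral => //.
- move=> x _; apply: integral_ge0 => y _; rewrite lee_fin mulr_ge0 ?varphi_ge0 //.
- apply: (measurable_fun_fubini_tonelli_F (fun z => (a z.1 * varphi z)%:E)).
    by apply/measurable_EFinP; apply: measurable_funM => //; exact: measurable_varphi.
  by move=> z; rewrite lee_fin mulr_ge0 ?varphi_ge0.
- by apply/measurable_EFinP; apply: measurable_funM => //; apply: measurable_funM.
- move=> x _; rewrite /fubini_F.
  under eq_integral do rewrite EFinM /=.
  rewrite ge0_integralZl_EFin //; last 2 first.
  + by move=> y _; rewrite lee_fin varphi_ge0.
  + by apply/measurable_EFinP; exact: mv.
  rewrite -EFinM mulrCA EFinM; apply: lee_wpmul2l; first by rewrite lee_fin.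
  exact: (weight_var W).
Qed.

Lemma weighted_var2 (a : T -> R) : measurable_fun setT a -> (forall x, 0 <= a x) ->
  (\int[P]_z (a z.2 * varphi z)%:E <= C0%:E * \int[mu]_x (a x * phi x)%:E)%E.
Proof.
move=> ma a0; apply: le_trans (weighted_var1 ma a0).
have ma1 : measurable_fun setT (fun z : T * T => a z.1) by exact: measurableT_comp.
have ma2 : measurable_fun setT (fun z : T * T => a z.2) by exact: measurableT_comp.
rewrite (fubini_tonelli2 (fun z => (a z.2 * varphi z)%:E)) /=; last 2 first.
- by apply/measurable_EFinP; apply: measurable_funM => //; exact: measurable_varphi.
- by move=> z; rewrite lee_fin mulr_ge0 ?varphi_ge0.
rewrite (fubini_tonelli1 (fun z => (a z.1 * varphi z)%:E)) /=; last 2 first.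
- by apply/measurable_EFinP; apply: measurable_funM => //; exact: measurable_varphi.
- by move=> z; rewrite lee_fin mulr_ge0 ?varphi_ge0.
rewrite le_eqVlt; apply/orP; left; apply/eqP.
apply: eq_integral => x _; apply: eq_integral => y _.
by rewrite /varphi /= distrC Ksym.
Qed.

Lemma varphi_mass : (\int[P]_z (varphi z)%:E <= (C0 * F)%:E)%E.
Proof.
have := weighted_var1 (measurable_cst (1 : R)) (fun=> ler01).
under eq_integral do rewrite mul1r.
move=> h; apply: (le_trans h); rewrite EFinM lee_wpmul2l ?lee_fin ?(weight_C0 W) //.
by under eq_integral do rewrite mul1r; exact: weight_mass W.
Qed.

Lemma integrable_varphi : P.-integrable setT (EFin \o varphi).
Proof.
apply/integrable_ge0P; first exact: varphi_ge0.
split; first exact: measurable_varphi.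
by rewrite (le_lt_trans varphi_mass) ?ltry.
Qed.

Lemma fe_weight : fin_energy phi.
Proof.
split; first exact: mphi.
apply: (@le_integrableR _ _ _ P _ varphi); last exact: integrable_varphi.
  exact: measurable_dpow mphi.
move=> z; rewrite ger0_norm ?dpow_ge0 // /dpow /varphi ler_wpM2r //.
have [->|h] := eqVneq (phi z.1 - phi z.2) 0; first by rewrite normr0 powR0 // gt_eqF.
rewrite ge1r_powR ?(ltW p1) // normr_gt0 h /= ler_norml.
have := weight_gt0 W z.1; have := weight_gt0 W z.2.
have := weight_le1 W z.1; have := weight_le1 W z.2.
move: (phi z.1) (phi z.2) => a b *; apply/andP; split; lra.
Qed.

Definition cK : R := 2 * C0 * F `^ (2 - p).

Lemma cK_ge0 : 0 <= cK.
Proof. by rewrite /cK !mulr_ge0 ?powR_ge0 ?(weight_C0 W). Qed.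

(** Hoelder's inequality in linearized form, with the free parameter [t]. *)
Lemma weighted_power v (t : R) : v \in L2 -> {ae mu, forall x, 0 <= v x} -> 0 < t ->
  (\int[mu]_x (`|v x| `^ (p - 1) * phi x)%:E <=
    (t `^ (p - 2) * ip mu v phi + t `^ (p - 1) * F)%:E)%E.
Proof.
move=> Lv v0 t0; have mv := L2_measurable Lv.
pose a x := `|v x|.
have La : a \in L2.
  by apply: (L2_le _ _ Lv) => [|x]; [exact: measurableT_comp|rewrite normr_id].
have -> : ip mu v phi = ip mu a phi.
  apply: ip_ae => //; first exact: L2_weight.
  by apply: filterS v0 => x /ger0_norm.
have i1 := L2_mul La L2_weight; have i2 := integrable_weight.
have j1 : mu.-integrable setT (EFin \o (fun x => t `^ (p - 2) * (a x * phi x))).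
  by have := integrableZl measurableT (t `^ (p - 2)) i1; apply: eq_integrable.
have j2 : mu.-integrable setT (EFin \o (fun x => t `^ (p - 1) * phi x)).
  by have := integrableZl measurableT (t `^ (p - 1)) i2; apply: eq_integrable.
have j : mu.-integrable setT (EFin \o (fun x => t `^ (p - 2) * (a x * phi x) + t `^ (p - 1) * phi x)).
  by have := integrableD measurableT j1 j2; apply: eq_integrable.
apply: (@le_trans _ _ (\int[mu]_x (t `^ (p - 2) * (a x * phi x) + t `^ (p - 1) * phi x)%:E)%E).
  apply: ge0_le_integral => //.
  - by move=> x _; rewrite lee_fin mulr_ge0 ?powR_ge0.
  - apply/measurable_EFinP; apply: measurable_funM => //.
    by apply: (measurableT_comp (measurable_powR _)) => //; exact: measurableT_comp.
  - exact: (measurable_int mu).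
  - move=> x _; rewrite lee_fin mulrA -mulrDl ler_wpM2r //.
    have -> : p - 2 = (p - 1) - 1 by ring.
    by apply: powR_le_affine; rewrite // ?subr_gt0 // ltrBlDr.
rewrite -(fineK (integrable_fin_num measurableT j)) lee_fin -/(Rintegral _ _ _).
rewrite RintegralD // !RintegralZl // lerD2l ler_wpM2l ?powR_ge0 //.
rewrite -lee_fin /Rintegral fineK; first exact: weight_mass W.
exact: integrable_fin_num.
Qed.

Lemma ip_weight_gt0 f : f \in L2 -> {ae mu, forall x, 0 <= f x} -> 0 <= ip mu f phi.
Proof.
move=> Lf f0; apply: Rintegral_ge0_ae.
  by apply: filterS f0 => x fx; rewrite mulr_ge0.
by apply: measurable_funM; [exact: L2_measurable Lf|exact: mphi].
Qed.

(** [weighted_power] with [t] the mean of [v] for the weight, [ip mu v phi / F]; a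
    vanishing mass is covered by letting [t] tend to [0]. *)
Lemma weighted_operator v g : nsubdiff v g -> {ae mu, forall x, 0 <= v x} ->
  ip mu g phi <= cK * ip mu v phi `^ (p - 1).
Proof.
move=> s v0; have [Lv Lg _ _] := s; have fv := nsubdiff_fe s.
have mv := L2_measurable Lv.
have b0 := ip_weight_gt0 Lv v0; set b := ip mu v phi in b0 *.
have h1 := euler_lagrange s L2_weight fe_weight.
have key t : 0 < t -> ip mu g phi <= C0 * (t `^ (p - 2) * b + t `^ (p - 1) * F).
  move=> t0; apply: (le_trans h1); rewrite ler_pdivrMl //.
  pose q x := `|v x| `^ (p - 1).
  have q0 x : 0 <= q x by exact: powR_ge0.
  have mq : measurable_fun setT q.
    by apply: (measurableT_comp (measurable_powR _)) => //; exact: measurableT_comp.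
  have mq1 : measurable_fun setT (fun z : T * T => q z.1) by exact: measurableT_comp.
  have mq2 : measurable_fun setT (fun z : T * T => q z.2) by exact: measurableT_comp.
  have di := integrable_dform fv fe_weight.
  have mvp := measurable_varphi.
  rewrite -lee_fin (_ : (\int[P]_z dform v phi z)%:E = \int[P]_z (dform v phi z)%:E)%E; last first.
    by rewrite /Rintegral fineK //; exact: integrable_fin_num.
  apply: (@le_trans _ _ (\int[P]_z (q z.1 * varphi z + q z.2 * varphi z)%:E)%E).
    apply: (le_trans (lee_abs _)); apply: (le_trans (le_abse_integral _ _ _)) => //.
      by apply/measurable_EFinP; apply: measurable_dform => //; exact: mphi.
    apply: ge0_le_integral => //.
    - apply/measurable_EFinP; apply: measurableT_comp => //.
      by apply: measurable_dform => //; exact: mphi.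
    - by apply/measurable_EFinP; apply: measurable_funD; apply: measurable_funM.
    - move=> z _; rewrite /= lee_fin /dform /varphi 2!normrM norm_Phi // (ger0_norm (K0 _ _)).
      rewrite -mulrDl -mulrA ler_wpM2r ?mulr_ge0 // /q.
      apply: le_trans (powR_subadditive _ _ _); rewrite ?normr_ge0 //.
        by rewrite powR_le ?subr_ge0 ?(ltW p1) // ler_normB.
      by rewrite subr_ge0 (ltW p1) /= lerBlDr (ltW p2).
  under eq_integral do rewrite EFinD.
  rewrite ge0_integralD //; last 4 first.
  - by move=> z _; rewrite lee_fin mulr_ge0 ?varphi_ge0.
  - by apply/measurable_EFinP; apply: measurable_funM.
  - by move=> z _; rewrite lee_fin mulr_ge0 ?varphi_ge0.
  - by apply/measurable_EFinP; apply: measurable_funM.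
  apply: (le_trans (leeD (weighted_var1 mq q0) (weighted_var2 mq q0))).
  have hw := lee_wpmul2l (_ : (0 <= C0%:E)%E) (weighted_power Lv v0 t0).
  apply: (le_trans (leeD (hw _) (hw _))); rewrite ?lee_fin ?(weight_C0 W) //.
  by rewrite mulr_natl mulr2n.
have [bz|bn] := eqVneq b 0.
  rewrite bz powR0 ?mulr0; last by rewrite subr_eq0 gt_eqF.
  apply/ler_addgt0Pr => e e0; rewrite add0r.
  have q0 : 0 < p - 1 by rewrite subr_gt0.
  have CF : 0 < C0 * F + 1 by rewrite ltr_wpDl // mulr_ge0 ?(weight_C0 W) // ltW.
  have e1 : 0 < e / (C0 * F + 1) by rewrite divr_gt0.
  apply: (le_trans (key _ (powR_gt0 (p - 1)^-1 e1))).
  rewrite bz mulr0 add0r -powRrM mulVf ?gt_eqF // powRr1 ?(ltW e1) //.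
  have -> : C0 * (e / (C0 * F + 1) * F) = e * (C0 * F) / (C0 * F + 1) by ring.
  by rewrite ler_pdivrMr // ler_pM2l // lerDl ler01.
have bp : 0 < b by rewrite lt_neqAle eq_sym bn.
have bF : 0 < b / F by rewrite divr_gt0.
apply: (le_trans (key _ bF)).
rewrite le_eqVlt; apply/orP; left; apply/eqP.
have Fi : (F^-1) `^ (p - 1) * F = F `^ (2 - p).
  rewrite -[F^-1]powR_inv1 ?(ltW F0) // -powRrM mulN1r -{2}(powRr1 (ltW F0)).
  by rewrite -powRD ?(gt_eqF F0) ?implybT //; congr (_ `^ _); ring.
have e1 : (b / F) `^ (p - 2) * b = (b / F) `^ (p - 1) * F.
  have -> : p - 2 = (p - 1) - 1 by ring.
  rewrite -[in RHS](@mulr_powRB1 _ (b / F) (p - 1)) ?(ltW bF) ?subr_gt0 //.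
  by rewrite mulrAC divfK ?gt_eqF // mulrC.
rewrite e1 powRM ?(ltW bp) ?invr_ge0 ?(ltW F0) // -mulrA Fi /cK.
ring.
Qed.

Lemma mass_step lam f v : 0 < lam -> f \in L2 -> {ae mu, forall x, 0 <= f x} ->
  nresolvent lam f v ->
  ip mu f phi `^ (2 - p) <= ip mu v phi `^ (2 - p) + lam * cK.
Proof.
move=> l0 Lf f0 r; have v0 := nresolvent_ge0 l0 Lf r f0.
have Lv := nresolvent_L2 r; have [g s e] := r; have [_ Lg _ _] := s.
apply: powR_step.
- by rewrite subr_gt0.
- by have := p1; lra.
- by rewrite mulr_ge0 ?(ltW l0) ?cK_ge0.
- exact: ip_weight_gt0.
- exact: ip_weight_gt0.
rewrite (ip_resolvent Lf Lv Lg L2_weight e) lerD2l -mulrA ler_wpM2l ?(ltW l0) //.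
have -> : 1 - (2 - p) = p - 1 by ring.
exact: weighted_operator.
Qed.

Lemma mass_scheme lam f (u : nat -> T -> R) k : 0 < lam -> f \in L2 ->
  {ae mu, forall x, 0 <= f x} -> scheme lam f u ->
  ip mu f phi `^ (2 - p) <= ip mu (u k) phi `^ (2 - p) + k%:R * lam * cK.
Proof.
move=> l0 Lf f0 s; elim: k => [|k IH]; first by rewrite s.1 !mul0r addr0.
apply: (le_trans IH); rewrite -[k.+1%:R]natr1.
have h := mass_step l0 (scheme_L2 k Lf s) (scheme_ge0 k l0 Lf s f0) (s.2 k).
apply: (le_trans (lerD h (lexx _))).
by rewrite -addrA !mulrDl mul1r (addrC (lam * cK)).
Qed.

Lemma nsemigroup_L2cvg t f w : 0 < t -> nsemigroup t f w ->
  exists2 V : nat -> nat -> T -> R, (forall n, scheme (t / n.+1%:R) f (V n)) &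
    L2cvg (fun n => V n n.+1) w.
Proof.
move=> t0 [Lf Lw]; rewrite gt_eqF // => -[V [V0 hV cV]].
have sV n : scheme (t / n.+1%:R) f (V n) by split.
exists V => //; apply/Lnorm2_cvg0 => // n; exact: scheme_L2 (sV n).
Qed.

(** The decay of the mass along the schemes passes to the limit, since the mass is
    continuous in [L2]; the positive part gives the power a meaning for every limit
    [w]. *)
Lemma mass_semigroup t f w : 0 <= t -> nsemigroup t f w ->
  {ae mu, forall x, 0 <= f x} ->
  ip mu f phi `^ (2 - p) <= Num.max 0 (ip mu w phi) `^ (2 - p) + t * cK.
Proof.
move=> t0 S f0; have [Lf Lw hS] := S.
have q0 : 0 < 2 - p by rewrite subr_gt0.
have [tz|tn] := eqVneq t 0.
  move: hS; rewrite tz eqxx mul0r addr0 => wf.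
  rewrite (ip_ae Lw Lf L2_weight wf) max_r //; exact: ip_weight_gt0.
have tp : 0 < t by rewrite lt_neqAle eq_sym tn.
have [V sV cV] := nsemigroup_L2cvg tp S.
rewrite -lerBlDr; set A := _ - _.
have [A0|A0] := leP A 0; first by rewrite (le_trans A0) ?powR_ge0.
have LV n : V n n.+1 \in L2 by exact: scheme_L2 (sV n).
have cI := L2cvg_ip LV Lw L2_weight cV.
have AV n : A `^ (2 - p)^-1 <= ip mu (V n n.+1) phi.
  have l0 : 0 < t / n.+1%:R by rewrite divr_gt0.
  have h := mass_scheme n.+1 l0 Lf f0 (sV n).
  have m0 : 0 <= ip mu (V n n.+1) phi.
    by apply: ip_weight_gt0 => //; exact: scheme_ge0 (sV n) f0.
  rewrite powR_rootP ?(ltW A0) // /A lerBlDr; apply: (le_trans h).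
  by rewrite [_ * (t / _)]mulrC divfK.
have m : A `^ (2 - p)^-1 <= ip mu w phi by apply: (cvgr_to_ge cI); exact: nearW.
by rewrite -powR_rootP ?(ltW A0) ?le_max ?lexx // m orbT.
Qed.

Lemma mass_scheme_lb t f (u : nat -> T -> R) (lam : R) k : 0 < lam -> f \in L2 ->
  {ae mu, forall x, 0 <= f x} -> scheme lam f u -> k%:R * lam <= t ->
  t * cK <= ip mu f phi `^ (2 - p) ->
  (ip mu f phi `^ (2 - p) - t * cK) `^ (2 - p)^-1 <= ip mu (u k) phi.
Proof.
move=> l0 Lf f0 s kt tf.
have q0 : 0 < 2 - p by rewrite subr_gt0.
have m0 : 0 <= ip mu (u k) phi.
  by apply: ip_weight_gt0; [exact: scheme_L2 s|exact: scheme_ge0 s f0].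
have A0 : 0 <= ip mu f phi `^ (2 - p) - t * cK by rewrite subr_ge0.
rewrite (powR_rootP q0 A0 m0) lerBlDr; apply: (le_trans (mass_scheme k l0 Lf f0 s)).
by rewrite lerD2l ler_wpM2r ?cK_ge0.
Qed.

Definition cut (del a : R) : R := Num.max 0 (1 - Num.max 0 a / del).

Section Cut.
Variable del : R.
Hypothesis del0 : 0 < del.
Let h := cut del.

Lemma cut_ge0 a : 0 <= h a. Proof. by rewrite /h /cut le_max lexx. Qed.

Lemma cut_le1 a : h a <= 1.
Proof.
rewrite /h /cut ge_max ler01 /= lerBlDr lerDl divr_ge0 ?(ltW del0) //.
by rewrite le_max lexx.
Qed.

Lemma cut_neg a : a <= 0 -> h a = 1.
Proof. by move=> a0; rewrite /h /cut (max_l a0) mul0r subr0 max_r. Qed.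

Lemma cut_big a : del <= a -> h a = 0.
Proof.
move=> da; rewrite /h /cut max_l // subr_le0.
by rewrite max_r ?(le_trans (ltW del0)) // ler_pdivlMr // mul1r.
Qed.

Lemma cut_small a : 0 <= a -> a <= del -> h a = 1 - a / del.
Proof.
move=> a0 ad; rewrite /h /cut (max_r a0) max_r // subr_ge0.
by rewrite ler_pdivrMr // mul1r.
Qed.

Lemma cut_anti a b : a <= b -> h b <= h a.
Proof.
move=> ab; rewrite /h /cut; apply: le_max2 => //.
by rewrite lerD2l lerN2 ler_wpM2r ?invr_ge0 ?(ltW del0) // le_max2.
Qed.

Lemma cut_lip a b : `|h a - h b| <= `|a - b| / del.
Proof.
apply: (le_trans (pos_lip _ _)).
rewrite opprD opprK addrACA subrr add0r addrC -mulrBl normrM.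
rewrite (ger0_norm (_ : 0 <= del^-1)) ?invr_ge0 ?(ltW del0) //.
by rewrite ler_wpM2r ?invr_ge0 ?(ltW del0) // distrC pos_lip.
Qed.

Lemma measurable_cut : measurable_fun setT h.
Proof. by apply: nonincreasing_measurable => // a b; exact: cut_anti. Qed.

(** The time derivative paired with [h v] is that of a primitive of [h],
    which is [del / 2 * (1 - h ^ 2)]. *)
Lemma cut_primitive a b : 0 <= a -> 0 <= b ->
  del / 2 * (h b ^+ 2 - h a ^+ 2) <= (a - b) * h b.
Proof.
move=> a0 b0; have [db|bd] := leP del b.
  rewrite (cut_big db) mulr0 expr0n sub0r mulrN oppr_le0.
  by rewrite mulr_ge0 ?sqr_ge0 ?divr_ge0 // ltW.
have hb := cut_small b0 (ltW bd).
have ha : 1 - a / del <= h a by rewrite /h /cut (max_r a0) le_max lexx orbT.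
have hb0 := cut_ge0 b.
have eb : b = del * (1 - h b) by rewrite hb; field; rewrite gt_eqF.
have ea : del * (1 - h a) <= a.
  by rewrite mulrC -ler_pdivlMr // lerBlDr addrC -lerBlDr.
rewrite {2}eb; move: ea hb0; move: (h a) (h b) => A B ea B0.
have : (del * (1 - A) - del * (1 - B)) * B <= (a - del * (1 - B)) * B.
  by rewrite ler_wpM2r // lerD2r.
apply: le_trans; rewrite -subr_ge0.
have -> : (del * (1 - A) - del * (1 - B)) * B - del / 2 * (B ^+ 2 - A ^+ 2) =
  del / 2 * (B - A) ^+ 2 by field.
by rewrite mulr_ge0 ?sqr_ge0 ?divr_ge0 // ltW.
Qed.

(** Pointwise form of the positivity estimate: a small value [a] next to a large
    value [b] contributes with a sign, whereas the variation of the weight costs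
    only [del ^ (p - 1)]. *)
Lemma cut_form (M a b f1 f2 : R) : 0 <= f1 -> 0 <= f2 -> 0 <= a -> 0 <= b -> b <= M ->
  0 < M ->
  Phi p (a - b) * (f1 * h a - f2 * h b) <=
    del `^ (p - 1) * `|f1 - f2| - f1 * h a * (M `^ (p - 2) * Num.max 0 (b - del)).
Proof.
move=> f10 f20 a0 b0 bM M0.
have q0 : 0 <= p - 1 by rewrite subr_ge0 ltW.
have [ba|ab] := leP b a.
  have -> : f1 * h a * (M `^ (p - 2) * Num.max 0 (b - del)) = 0.
    have [ad|da] := leP del a; first by rewrite (cut_big ad) mulr0 mul0r.
    by rewrite (max_l (_ : b - del <= 0)) ?mulr0 // subr_le0 ltW // (le_lt_trans ba).
  rewrite subr0 ge0_Phi ?subr_ge0 //.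
  have [ad|da] := leP del a.
    rewrite (cut_big ad) mulr0 sub0r mulrN (@le_trans _ _ 0) ?oppr_le0 //.
      by rewrite mulr_ge0 ?powR_ge0 // mulr_ge0 // cut_ge0.
    by rewrite mulr_ge0 ?powR_ge0.
  have h1 : f1 * h a - f2 * h b <= `|f1 - f2|.
    have := cut_anti ba; have := cut_ge0 a; have := cut_le1 a.
    move: (h a) (h b) => A B A1 A0 AB.
    have : f2 * A <= f2 * B by rewrite ler_wpM2l.
    have : (f1 - f2) * A <= `|f1 - f2| * A by rewrite ler_wpM2r // ler_norm.
    have : `|f1 - f2| * A <= `|f1 - f2| by rewrite ler_piMr.
    rewrite mulrBl; move: (f1 * A) (f2 * A) (f2 * B) (`|f1 - f2|) (`|_| * A) => *; lra.
  apply: (le_trans (ler_wpM2l (powR_ge0 _ _) h1)); rewrite ler_wpM2r //.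
  rewrite powR_le ?subr_ge0 //; lra.
have ab' := ltW ab.
have D0 : 0 <= del `^ (p - 1) * `|f1 - f2| by rewrite mulr_ge0 ?powR_ge0.
have [ad|da] := leP del a.
  by rewrite (cut_big ad) (cut_big (le_trans ad ab')) !mulr0 subrr mulr0 mul0r subr0.
rewrite le0_Phi ?subr_le0 // opprB.
have hab := cut_anti ab'; have hb0 := cut_ge0 b; have hb1 := cut_le1 b.
have ha0 := cut_ge0 a.
have [db|bd] := leP del b.
  rewrite (cut_big db) mulr0 subr0 max_r ?subr_ge0 //.
  have mG : M `^ (p - 2) * (b - del) <= (b - a) `^ (p - 1).
    have bd0 : 0 <= b - del by rewrite subr_ge0.
    apply: (@le_trans _ _ ((b - del) `^ (p - 1))); last first.
      by rewrite powR_le // lerD2l lerN2 ltW.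
    move: bd0; rewrite le_eqVlt => /orP[/eqP <-|bd0]; first by rewrite mulr0 powR_ge0.
    rewrite -(@mulr_powRB1 _ (b - del) (p - 1)) ?(ltW bd0) ?subr_gt0 //.
    rewrite mulrC ler_wpM2l ?(ltW bd0) //.
    have -> : p - 1 - 1 = - (2 - p) by ring.
    have -> : p - 2 = - (2 - p) by ring.
    rewrite !powRN lef_pV2 ?posrE ?powR_gt0 // powR_le ?subr_ge0 ?(ltW p2) ?(ltW bd0) //.
    by rewrite lerBlDr (le_trans bM) // lerDl ltW.
  have := ler_wpM2l (mulr_ge0 f10 ha0) mG.
  move: ((b - a) `^ _) (f1 * h a) (M `^ _ * _) (_ * `|_|) D0 => X A G D D0; rewrite mulNr (mulrC X).
  move: (A * X) (A * G) => *; lra.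
rewrite (max_l (_ : b - del <= 0)) ?subr_le0 ?(ltW bd) // !mulr0 subr0.
have X1 : (b - a) `^ (p - 1) <= del `^ (p - 1).
  apply: powR_le => //; first by rewrite subr_ge0.
  by rewrite lerBlDr (le_trans (ltW bd)) // lerDl.
have h1 : f2 * h b - f1 * h a <= `|f1 - f2|.
  move: hab hb0 hb1 ha0; move: (h a) (h b) => A B AB B0 B1 A0.
  have : f1 * B <= f1 * A by rewrite ler_wpM2l.
  have : (f2 - f1) * B <= `|f1 - f2| * B by rewrite ler_wpM2r // distrC ler_norm.
  have : `|f1 - f2| * B <= `|f1 - f2| by rewrite ler_piMr.
  rewrite mulrBl; move: (f1 * A) (f1 * B) (f2 * B) (`|f1 - f2|) (`|_| * B) => *; lra.
rewrite mulNr -mulrN opprB; apply: (le_trans (ler_wpM2l (powR_ge0 _ _) h1)).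
by rewrite ler_wpM2r.
Qed.

End Cut.

(** * Positivity *)

(** Separation of variables in the gain term of the positivity estimate. *)
Lemma prod_integral (a b : T -> R) : (forall x, 0 <= a x) -> (forall x, 0 <= b x) ->
  mu.-integrable setT (EFin \o a) -> mu.-integrable setT (EFin \o b) ->
  P.-integrable setT (EFin \o (fun z => a z.1 * b z.2)) /\
  \int[P]_z (a z.1 * b z.2) = \int[mu]_x a x * \int[mu]_x b x.
Proof.
move=> a0 b0 ia ib.
have [ma fa] := (integrable_ge0P mu a0).1 ia; have [mb fb] := (integrable_ge0P mu b0).1 ib.
have mab : measurable_fun setT (fun z : T * T => a z.1 * b z.2).
  by apply: measurable_funM; exact: measurableT_comp.
have ab0 (z : T * T) : 0 <= a z.1 * b z.2 by rewrite mulr_ge0.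
have e : (\int[P]_z (a z.1 * b z.2)%:E =
    (\int[mu]_x a x * \int[mu]_x b x)%:E)%E.
  rewrite (fubini_tonelli1 (fun z => (a z.1 * b z.2)%:E)) //; last 1 first.
  - exact/measurable_EFinP.
  rewrite /fubini_F /=.
  transitivity (\int[mu]_x ((a x)%:E * (\int[mu]_x b x)%:E))%E.
    apply: eq_integral => x _.
    under eq_integral do rewrite EFinM /=.
    rewrite ge0_integralZl_EFin //; last 2 first.
    + by move=> y _; rewrite lee_fin.
    + exact/measurable_EFinP.
    by rewrite /Rintegral fineK //; exact: integrable_fin_num.
  rewrite ge0_integralZr //; last 3 first.
  - exact/measurable_EFinP.
  - by move=> x _; rewrite lee_fin.
  - by rewrite lee_fin; apply: Rintegral_ge0.
  by rewrite EFinM /Rintegral !fineK //; exact: integrable_fin_num.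
split; last by rewrite {1}/Rintegral e.
by apply/integrable_ge0P => //; split => //; rewrite e ltry.
Qed.

Section Positivity.
Variables (del M c : R).
Hypotheses (del0 : 0 < del) (M0 : 0 < M) (c0 : 0 < c) (delc : del * F <= c / 2).
Let h := cut del.

(** The mass, for the weight [phi ^ 2], of the set where [v] takes values below
    [del]; the second weight comes from the lower bound for the kernel. *)
Definition low_mass v : R := \int[mu]_x (phi x * (phi x * h (v x))).
(** Up to a constant and the factor [- del / 2], the primitive whose time derivative
    is the time derivative of [v] tested with [phi * h v]. *)
Definition cut_mass v : R := \int[mu]_x (phi x * h (v x) ^+ 2).

Let h0 a : 0 <= h a. Proof. exact: cut_ge0. Qed.
Let h1 a : h a <= 1. Proof. exact: cut_le1. Qed.

Let mh v : measurable_fun setT v -> measurable_fun setT (fun x => h (v x)).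
Proof. by move=> mv; apply: (measurableT_comp (measurable_cut del0)). Qed.

Lemma cut_mass_integrable v : measurable_fun setT v ->
  mu.-integrable setT (EFin \o (fun x => phi x * h (v x) ^+ 2)).
Proof.
move=> mv; apply: (le_integrableR _ _ integrable_weight) => [|x].
  by apply: measurable_funM; [exact: mphi|apply: measurable_funX; exact: mh].
by rewrite ger0_norm ?mulr_ge0 ?sqr_ge0 // ler_piMr // expr_le1 //.
Qed.

Lemma low_mass_integrable v : measurable_fun setT v ->
  mu.-integrable setT (EFin \o (fun x => phi x * (phi x * h (v x)))).
Proof.
move=> mv; apply: (le_integrableR _ _ integrable_weight) => [|x].
  by do 2 (apply: measurable_funM; first exact: mphi); exact: mh.
by rewrite ger0_norm ?mulr_ge0 // ler_piMr // mulr_ile1 // (weight_le1 W).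
Qed.

Lemma cut_mass_ge0 v : 0 <= cut_mass v.
Proof. by apply: Rintegral_ge0 => x _; rewrite mulr_ge0 ?sqr_ge0. Qed.

Lemma low_mass_ge0 v : 0 <= low_mass v.
Proof. by apply: Rintegral_ge0 => x _; rewrite !mulr_ge0. Qed.

Lemma weight_mass_real : \int[mu]_x phi x <= F.
Proof.
rewrite -lee_fin /Rintegral fineK; first exact: weight_mass W.
exact: integrable_fin_num integrable_weight.
Qed.

Lemma cut_mass_le v : measurable_fun setT v -> cut_mass v <= F.
Proof.
move=> mv; apply: le_trans weight_mass_real; apply: le_Rintegral => //.
- exact: cut_mass_integrable.
- exact: integrable_weight.
- by move=> x _; rewrite ler_piMr // expr_le1.
Qed.

(** The rate at which jumps from the mass above [del], which is at least [c / 2],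
    raise the small values: [kappa] bounds the kernel and [M ^ (p - 2)] the slope of
    the power [p - 1] between [0] and [M]. *)
Definition gain : R := kappa * M `^ (p - 2) * (c / 2).

Lemma gain_gt0 : 0 < gain.
Proof. by rewrite /gain !mulr_gt0 ?powR_gt0 ?(weight_kappa W) ?invr_gt0. Qed.

(** The resolvent equation tested with [phi * h v]. The time difference is handled
    by [cut_primitive] and the nonlocal form by [cut_form], whose negative part
    separates into the mass of small values and the mass above [del]. *)
Lemma positivity_step lam f v : 0 < lam -> f \in L2 ->
  {ae mu, forall x, 0 <= f x} -> {ae mu, forall x, f x <= M} ->
  nresolvent lam f v -> c <= ip mu v phi ->
  lam * gain * low_mass v <= del * (cut_mass f - cut_mass v) + lam * (del `^ (p - 1) * (C0 * F)).
Proof.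
move=> l0 Lf f0 fM r cv.
have v0 := nresolvent_ge0 l0 Lf r f0; have vM := nresolvent_ub l0 (ltW M0) Lf r fM.
have fv := nresolvent_fe r; have Lv := nresolvent_L2 r.
have [g s e] := r; have [_ Lg _ _] := s.
have mv := L2_measurable Lv; have mf := L2_measurable Lf.
pose eta x := phi x * h (v x).
have meta : measurable_fun setT eta by apply: measurable_funM; [exact: mphi|exact: mh].
have Leta : eta \in L2.
  apply: (L2_le meta _ L2_weight) => x.
  by rewrite /eta normrM ler_piMr // ger0_norm.
have feta : fin_energy eta.
  apply: (fe_le2 meta fe_weight (feZ del^-1 fv)) => x y.
  rewrite /eta /= (_ : _ - _ = (phi x - phi y) * h (v x) + phi y * (h (v x) - h (v y))); last by ring.
  apply: (le_trans (ler_normD _ _)); apply: lerD.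
    by rewrite normrM ler_piMr // ger0_norm.
  rewrite normrM -mulrBr normrM (ger0_norm (phi0 y)) (ger0_norm (_ : 0 <= del^-1)) ?invr_ge0 ?(ltW del0) //.
  rewrite mulrC (le_trans (ler_piMr _ (weight_le1 W y))) // mulrC.
  exact: cut_lip.
have EL := euler_lagrange s Leta feta.
pose G x := Num.max 0 (v x - del).
have G0 x : 0 <= G x by rewrite /G le_max lexx.
have mG : measurable_fun setT G.
  by apply: measurable_pos; apply: measurable_funB => //; exact: measurable_cst.
have LG : G \in L2.
  apply: (L2_le mG _ Lv) => x; rewrite (ger0_norm (G0 x)) /G ge_max normr_ge0 /=.
  by apply: le_trans (ler_norm _); rewrite gerBl ltW.
have iG : mu.-integrable setT (EFin \o (fun x => phi x * G x)).
  by have := L2_mul L2_weight LG; apply: eq_integrable.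
have iA := low_mass_integrable mv.
have [iS eS] := @prod_integral (fun x => phi x * (phi x * h (v x))) (fun x => phi x * G x)
  (fun x => mulr_ge0 (phi0 x) (mulr_ge0 (phi0 x) (h0 (v x))))
  (fun x => mulr_ge0 (phi0 x) (G0 x)) iA iG.
set S := (fun z => _) in iS eS.
have Gc : c / 2 <= \int[mu]_x (phi x * G x).
  have iv := L2_mul Lv L2_weight.
  have id : mu.-integrable setT (EFin \o (fun x => del * phi x)).
    by have := integrableZl measurableT del integrable_weight; apply: eq_integrable.
  have ib : mu.-integrable setT (EFin \o (fun x => v x * phi x - del * phi x)).
    by have := integrableB measurableT iv id; apply: eq_integrable.
  apply: (@le_trans _ _ (\int[mu]_x (v x * phi x - del * phi x))).
    rewrite RintegralB // RintegralZl ?integrable_weight //.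
    have := ler_wpM2l (ltW del0) weight_mass_real; move: cv delc; rewrite /ip.
    move: (Rintegral _ _ _) (del * Rintegral _ _ _) (del * F) => *; lra.
  apply: le_Rintegral => // x _; rewrite -mulrBl mulrC ler_wpM2l // /G le_max lexx orbT //.
have form : \int[P]_z dform v eta z <=
    del `^ (p - 1) * (C0 * F) - kappa * M `^ (p - 2) * (low_mass v * \int[mu]_x (phi x * G x)).
  have i1 : P.-integrable setT (EFin \o (fun z => del `^ (p - 1) * varphi z)).
    by have := integrableZl measurableT (del `^ (p - 1)) integrable_varphi; apply: eq_integrable.
  have i2 : P.-integrable setT (EFin \o (fun z => kappa * M `^ (p - 2) * S z)).
    by have := integrableZl measurableT (kappa * M `^ (p - 2)) iS; apply: eq_integrable.
  have i3 : P.-integrable setT (EFin \o (fun z => del `^ (p - 1) * varphi z - kappa * M `^ (p - 2) * S z)).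
    by have := integrableB measurableT i1 i2; apply: eq_integrable.
  apply: (@le_trans _ _ (\int[P]_z (del `^ (p - 1) * varphi z - kappa * M `^ (p - 2) * S z))).
    apply: le_Rintegral_ae => //; first exact: integrable_dform.
    apply: filterS2 (ae_prod v0) (ae_prod vM) => z [va0 vb0] [_ vbM].
    rewrite /dform /S /varphi /eta.
    have := cut_form del0 (phi0 z.1) (phi0 z.2) va0 vb0 vbM M0.
    move=> /(ler_wpM2r (K0 z.1 z.2)) hz; apply: (le_trans hz); rewrite mulrBl -[X in X - _ <= _]mulrA lerD2l lerN2.
    (* On the diagonal, where the kernel has no lower bound, one of the two factors vanishes. *)
    have [e12|ne] := pselect (z.1 = z.2).
      rewrite /G -e12; have [vd|dv] := leP del (v z.1).
        by rewrite /h (cut_big del0 vd) !(mulr0, mul0r).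
      by rewrite max_l ?subr_le0 ?(ltW dv) // !(mulr0, mul0r).
    have kk := weight_kernel W ne.
    have q0 : 0 <= phi z.1 * h (v z.1) * (M `^ (p - 2) * G z.2).
      by rewrite !mulr_ge0 ?powR_ge0.
    apply: le_trans (ler_wpM2l q0 kk).
    by rewrite le_eqVlt; apply/orP; left; apply/eqP; ring.
  rewrite RintegralB // !RintegralZl //; last exact: integrable_varphi.
  rewrite eS lerD2r ler_wpM2l ?powR_ge0 //.
  rewrite -lee_fin /Rintegral fineK; first exact: varphi_mass.
  exact: integrable_fin_num integrable_varphi.
have time : del / 2 * (cut_mass v - cut_mass f) <= lam * ip mu g eta.
  have E := ip_resolvent Lf Lv Lg Leta e.
  have -> : lam * ip mu g eta = ip mu (f \- v) eta by rewrite ipBl // E addrAC subrr add0r.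
  have if_ := cut_mass_integrable mf; have iv := cut_mass_integrable mv.
  rewrite -RintegralB // -RintegralZl //; last first.
    by have := integrableB measurableT iv if_; apply: eq_integrable.
  apply: le_Rintegral_ae.
  - have := integrableZl measurableT (del / 2) (integrableB measurableT iv if_).
    by apply: eq_integrable.
  - by apply: L2_mul => //; exact: L2B.
  - apply: filterS2 f0 v0 => x fx vx; rewrite /eta /=.
    have := ler_wpM2l (phi0 x) (cut_primitive del0 fx vx).
    rewrite -/h; move: (h (f x)) (h (v x)) => a b hab.
    by rewrite -mulrBr mulrCA [leRHS]mulrCA.
have g0 := gain_gt0.
have form2 : \int[P]_z dform v eta z <= del `^ (p - 1) * (C0 * F) - gain * low_mass v.
  apply: (le_trans form); rewrite lerD2l lerN2 /gain -mulrA.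
  rewrite ler_wpM2l ?mulr_ge0 ?powR_ge0 ?(ltW (weight_kappa W)) //.
  by rewrite mulrC ler_wpM2l // low_mass_ge0.
have := ler_wpM2l (ltW l0) (le_trans EL (ler_wpM2l (_ : 0 <= 2^-1) form2)).
rewrite invr_ge0 => /(_ (ler0n _ 2)).
move: time; move: (cut_mass v) (cut_mass f) (low_mass v) gain (ip mu g eta) (del `^ _ * _).
move=> Bv Bf A g' I D h1' h2'.
have := le_trans h1' h2'; nra.
Qed.

End Positivity.

Lemma positivity_sum del M c lam f (u : nat -> T -> R) m :
  0 < del -> 0 < M -> 0 < c -> del * F <= c / 2 -> 0 < lam -> f \in L2 ->
  {ae mu, forall x, 0 <= f x} -> {ae mu, forall x, f x <= M} -> scheme lam f u ->
  (forall k, (k < m)%N -> c <= ip mu (u k.+1) phi) ->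
  lam * gain M c * \sum_(k < m) low_mass del (u k.+1) <=
    del * F + m%:R * lam * (del `^ (p - 1) * (C0 * F)).
Proof.
move=> d0 M0 c0 dc l0 Lf f0 fM s mc.
suff h : lam * gain M c * \sum_(k < m) low_mass del (u k.+1) + del * cut_mass del (u m) <=
    del * F + m%:R * lam * (del `^ (p - 1) * (C0 * F)).
  by apply: le_trans h; rewrite lerDl mulr_ge0 ?(ltW d0) // cut_mass_ge0.
elim: m mc => [|m IH] mc.
  rewrite big_ord0 mulr0 add0r !mul0r addr0 ler_wpM2l ?(ltW d0) // s.1.
  by apply: cut_mass_le => //; exact: L2_measurable Lf.
have {IH}IH := IH (fun k km => mc k (ltn_trans km (ltnSn m))).
have step := positivity_step d0 M0 c0 dc l0 (scheme_L2 m Lf s) (scheme_ge0 m l0 Lf s f0)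
  (scheme_ub m l0 (ltW M0) Lf s fM) (s.2 m) (mc m (ltnSn m)).
rewrite big_ord_recr /= mulrDr -[m.+1%:R]natr1 !mulrDl mul1r.
move: IH step; rewrite mulrBr.
move: (lam * gain M c * \sum_(_ < m) _) (lam * gain M c * low_mass _ _)
  (del * cut_mass del (u m)) (del * cut_mass del (u m.+1))
  (lam * (del `^ _ * _)) (m%:R * lam * _) (del * F) => *; lra.
Qed.

Lemma low_mass_le del (a b : T -> R) : 0 < del -> measurable_fun setT a -> measurable_fun setT b ->
  {ae mu, forall x, b x <= a x} -> low_mass del a <= low_mass del b.
Proof.
move=> d0 ma mb ab; apply: le_Rintegral_ae; [exact: low_mass_integrable|exact: low_mass_integrable|].
apply: filterS ab => x abx; do 2 rewrite ler_wpM2l //; exact: cut_anti.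
Qed.

Lemma low_mass_lip del (a b : T -> R) : 0 < del -> a \in L2 -> b \in L2 ->
  low_mass del b <= low_mass del a + del^-1 * ip mu (fun x => `|a x - b x|) phi.
Proof.
move=> d0 La Lb.
have Ld : (fun x => `|a x - b x|) \in L2.
  apply: (L2_le _ _ (L2B La Lb)) => [|x]; last by rewrite normr_id.
  by apply: measurableT_comp => //; exact: L2_measurable (L2B La Lb).
have i1 := L2_mul Ld L2_weight.
have ia := low_mass_integrable d0 (L2_measurable La).
have ib := low_mass_integrable d0 (L2_measurable Lb).
have i2 : mu.-integrable setT (EFin \o (fun x => del^-1 * (`|a x - b x| * phi x))).
  by have := integrableZl measurableT del^-1 i1; apply: eq_integrable.
rewrite /low_mass /ip -RintegralZl // -RintegralD //.
apply: le_Rintegral => //.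
  by have := integrableD measurableT ia i2; apply: eq_integrable.
move=> x _; rewrite -lerBlDl -!mulrBr.
have hl := cut_lip d0 (b x) (a x); have px := weight_le1 W x.
apply: (@le_trans _ _ (phi x * (phi x * (`|a x - b x| / del)))).
  do 2 rewrite ler_wpM2l //; apply: le_trans (ler_norm _) _.
  by rewrite (distrC (a x)).
rewrite mulrA (mulrC _ del^-1) mulrCA ler_wpM2l ?invr_ge0 ?(ltW d0) // mulrC.
by rewrite ler_wpM2l // ler_piMr.
Qed.

Lemma L2cvg_norm_weight (z : nat -> T -> R) (w : T -> R) (e : R) : (forall n, z n \in L2) -> w \in L2 ->
  L2cvg z w -> 0 < e ->
  \forall n \near \oo, ip mu (fun x => `|z n x - w x|) phi <= e.
Proof.
move=> Lz Lw zw e0.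
have H0 := ip_ge0 mu phi.
have H1 : 0 < ip mu phi phi + 1 by rewrite ltr_wpDl.
apply: filterS (zw (e ^+ 2 / (ip mu phi phi + 1)) _) => [n hn|]; last by rewrite divr_gt0 ?exprn_gt0.
have Ld : (fun x => `|z n x - w x|) \in L2.
  apply: (L2_le _ _ (L2B (Lz n) Lw)) => [|x]; last by rewrite normr_id.
  by apply: measurableT_comp => //; exact: L2_measurable (L2B (Lz n) Lw).
have i0 : 0 <= ip mu (fun x => `|z n x - w x|) phi.
  by apply: Rintegral_ge0 => x _; rewrite mulr_ge0.
have := cauchy_schwarz Ld L2_weight.
have -> : ip mu (fun x => `|z n x - w x|) (fun x => `|z n x - w x|) =
    ip mu (z n \- w) (z n \- w).
  by apply: eq_Rintegral => x _; rewrite -expr2 real_normK ?num_real // expr2.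
move=> h; rewrite -(@ler_pXn2r _ 2) ?nnegrE ?(ltW e0) //; apply: (le_trans h).
apply: (le_trans (ler_wpM2r H0 hn)).
by rewrite mulrAC ler_pdivrMr // ler_wpM2l ?sqr_ge0 // lerDl ler01.
Qed.

(** Comparing the scheme of [k] steps up to one time with the scheme of [k] steps up
    to an earlier time: by homogeneity the former, multiplied by a constant at most
    [1], solves the latter scheme with smaller data. At most halving the step costs
    the fixed factor [2 ^ (- 1 / (2 - p))]. *)
Lemma scheme_time_monotone lam nu f (u z : nat -> T -> R) k :
  0 < nu -> nu <= lam -> lam <= 2 * nu -> f \in L2 ->
  {ae mu, forall x, 0 <= f x} -> scheme lam f u -> scheme nu f z ->
  {ae mu, forall x, 2^-1 `^ (2 - p)^-1 * u k x <= z k x}.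
Proof.
move=> n0 nl ln Lf f0 su sz; have l0 : 0 < lam by exact: lt_le_trans nl.
pose c : R := (nu / lam) `^ (2 - p)^-1.
have q0 : 0 < 2 - p by rewrite subr_gt0.
have c0 : 0 < c by rewrite powR_gt0 // divr_gt0.
have nl1 : nu / lam <= 1 by rewrite ler_pdivrMr // mul1r.
have nl0 : 0 <= nu / lam by rewrite divr_ge0 // ltW.
have c1 : c <= 1 by rewrite powR_rootP // powR1.
have c2 : 2^-1 `^ (2 - p)^-1 <= c.
  by rewrite powR_le ?invr_ge0 ?(ltW q0) // ler_pdivlMr // ler_pdivrMl.
have := scheme_scale c0 su.
rewrite /c -powRrM mulVf ?gt_eqF // powRr1 // divfK ?gt_eqF // -/c => sc.
have cf : {ae mu, forall x, (c \*o f) x <= f x}.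
  by apply: filterS f0 => x fx /=; rewrite ler_piMl.
have h := scheme_le k n0 (L2Z c Lf) Lf sc sz cf.
have h0 := scheme_ge0 k l0 Lf su f0.
apply: filterS2 h h0 => x hx h0x; apply: le_trans hx.
by rewrite /= ler_wpM2r.
Qed.

(** The scheme of step [t / n] is run up to time [2 * t]; summing [positivity_step]
    over it yields an index [k] between [n] and [2 * n] at which the mass of small
    values is at most [om del]. By [scheme_time_monotone], the value of this scheme
    at step [k] is comparable with the value at time [t] of the scheme of step
    [t / k], so that the same bound holds for [w] as [n] tends to infinity. Then
    [del] tends to [0]. *)
Lemma positivity_semigroup t M f w : 0 < t -> 0 < M -> nsemigroup t f w ->
  {ae mu, forall x, 0 <= f x} -> {ae mu, forall x, f x <= M} ->
  2 * t * cK < ip mu f phi `^ (2 - p) -> {ae mu, forall x, 0 < w x}.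
Proof.
move=> t0 M0 S f0 fM big; have [Lf Lw _] := S.
have [V sV cV] := nsemigroup_L2cvg t0 S.
have LV n k : V n k \in L2 by exact: scheme_L2 (sV n).
have Lz n : V n n.+1 \in L2 by exact: LV.
pose c := (ip mu f phi `^ (2 - p) - 2 * t * cK) `^ (2 - p)^-1.
have c0 : 0 < c by rewrite powR_gt0 // subr_gt0.
pose a : R := 2^-1 `^ (2 - p)^-1.
have a0 : 0 < a by rewrite powR_gt0 // invr_gt0.
have g0 : 0 < gain M c by exact: gain_gt0.
have l0 n : 0 < t / n.+1%:R :> R by rewrite divr_gt0.
(* The bound that summing over the steps gives, divided by the total gain up to time [t]. *)
pose om del := (del * F + 2 * t * (del `^ (p - 1) * (C0 * F))) / (t * gain M c).
have mV n k : (k <= 2 * n.+1)%N -> c <= ip mu (V n k) phi.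
  move=> kn; apply: (mass_scheme_lb (l0 n) Lf f0 (sV n)); last exact: ltW.
  rewrite mulrCA [2 * t]mulrC ler_wpM2l ?(ltW t0) // ler_pdivrMr // -natrM ler_nat //.
(* Otherwise the second half of the sum would exceed the bound for the whole sum. *)
have pick del n : 0 < del -> del * F <= c / 2 ->
    exists2 k, (n.+1 <= k)%N & (k < 2 * n.+1)%N /\ low_mass del (V n k.+1) <= om del.
  move=> d0 dc.
  have := positivity_sum d0 M0 c0 dc (l0 n) Lf f0 fM (sV n) (m := 2 * n.+1)
    (fun k km => mV n k.+1 km).
  rewrite mulSn mul1n big_split_ord /= => hs.
  apply: contrapT => no.
  have {no} no (i : 'I_n.+1) : om del < low_mass del (V n (n.+1 + i).+1).
    rewrite ltNge; apply/negP => h; apply: no; exists (n.+1 + i)%N; first exact: leq_addr.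
    by split => //; rewrite ltn_add2l ltn_ord.
  have s1 : n.+1%:R * om del < \sum_(i < n.+1) low_mass del (V n (rshift n.+1 i).+1).
    have -> : n.+1%:R * om del = \sum_(i < n.+1) om del.
      by rewrite sumr_const card_ord mulr_natl.
    by apply: ltr_sum => [|i _]; [apply/hasP; exists ord0; rewrite ?mem_index_enum|exact: no].
  have s2 : 0 <= \sum_(i < n.+1) low_mass del (V n (lshift n.+1 i).+1).
    by apply: sumr_ge0 => i _; exact: low_mass_ge0.
  have lg : 0 < t / n.+1%:R * gain M c by rewrite mulr_gt0.
  have h2 : t / n.+1%:R * gain M c * (n.+1%:R * om del) < del * F +
      (n.+1 + n.+1)%:R * (t / n.+1%:R) * (del `^ (p - 1) * (C0 * F)).
    apply: lt_le_trans hs; rewrite ltr_pM2l //; apply: (lt_le_trans s1).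
    by rewrite lerDr.
  move: h2; rewrite natrD /om.
  have -> : t / n.+1%:R * gain M c * (n.+1%:R * ((del * F + 2 * t * (del `^ (p - 1) * (C0 * F))) / (t * gain M c)))
     = del * F + 2 * t * (del `^ (p - 1) * (C0 * F)).
    by field; rewrite !gt_eqF //= ?ltr0Sn.
  have -> : (n.+1%:R + n.+1%:R) * (t / n.+1%:R) = 2 * t :> R.
    by field; rewrite gt_eqF ?ltr0Sn.
  by rewrite ltxx.
have key del : 0 < del -> del * F <= c / 2 -> low_mass del (a^-1 \*o w) <= om del.
  move=> d0 dc; apply/ler_addgt0Pr => e e0.
  have ead : 0 < e * (a * del) by rewrite !mulr_gt0.
  have [n0 _ hn0] := L2cvg_norm_weight Lz Lw cV ead.
  have [k nk [k2 hk]] := pick del n0 d0 dc.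
  have hz := hn0 k (ltnW nk).
  have lk : t / k.+1%:R <= t / n0.+1%:R.
    by rewrite ler_pM2l // lef_pV2 ?posrE ?ltr0Sn // ler_nat (leq_trans nk).
  have lk2 : t / n0.+1%:R <= 2 * (t / k.+1%:R).
    rewrite mulrCA ler_pM2l // ler_pdivlMr // mulrC ler_pdivrMr // -natrM ler_nat //.
  have hm := scheme_time_monotone k.+1 (l0 k) lk lk2 Lf f0 (sV n0) (sV k).
  have h1 : low_mass del (a^-1 \*o V k k.+1) <= om del.
    apply: le_trans hk; apply: low_mass_le => //.
    - by apply: (@L2_measurable _ _ _ mu); rewrite L2Z.
    - exact: L2_measurable (LV _ _).
    - by apply: filterS hm => x hx; rewrite /= ler_pdivlMl.
  apply: (le_trans (low_mass_lip d0 (L2Z a^-1 (LV k k.+1)) (L2Z a^-1 Lw))).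
  apply: lerD => //.
  have -> : ip mu (fun x => `|(a^-1 \*o V k k.+1) x - (a^-1 \*o w) x|) phi =
      a^-1 * ip mu (fun x => `|V k k.+1 x - w x|) phi.
    rewrite -ipZl //; last exact: L2_weight.
      apply: eq_Rintegral => x _ /=; rewrite -mulrBr normrM (ger0_norm (_ : 0 <= a^-1)) //.
      by rewrite invr_ge0 ltW.
    apply: (L2_le _ _ (L2B (LV k k.+1) Lw)) => [|x]; last by rewrite normr_id.
    by apply: measurableT_comp => //; exact: L2_measurable (L2B (LV k k.+1) Lw).
  rewrite mulrA -invfM mulrC ler_pdivrMr ?mulr_gt0 // (mulrC del) //.
(* The cutoff equals one where [w] is nonpositive, for every value of [del]. *)
pose q x := phi x * (w x <= 0)%R%:R.
have mw := L2_measurable Lw.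
have mq : measurable_fun setT q.
  apply: measurable_funM; first exact: mphi.
  rewrite (_ : (fun x => _) = \1_(w @^-1` `]-oo, 0%R]) :> (T -> R)); last first.
    apply/funext => x; rewrite indicE; congr (_%:R); congr nat_of_bool.
    by apply/idP/idP; rewrite inE /= in_itv /=.
  by apply: measurable_indic; rewrite -[X in measurable X]setTI; exact: mw.
have Lq : q \in L2.
  apply: (L2_le mq _ L2_weight) => x; rewrite /q normrM ler_piMr //.
  by case: (w x <= 0); rewrite ?normr1 ?normr0.
have qle del : 0 < del -> del * F <= c / 2 -> ip mu q q <= om del.
  move=> d0 dc; apply: le_trans (key del d0 dc).
  have ma : measurable_fun setT (a^-1 \*o w).
    by apply: (@L2_measurable _ _ _ mu); rewrite L2Z.
  apply: le_Rintegral => //; first exact: L2_mul.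
    exact: low_mass_integrable.
  move=> x _; rewrite /q; case: (leP (w x) 0) => wx; last first.
    by rewrite mulr0 mul0r !mulr_ge0 // cut_ge0.
  rewrite mulr1 cut_neg ?mulr1 //= mulr_ge0_le0 // invr_ge0 ltW //.
have q00 : ip mu q q = 0.
  apply/le_anti; rewrite ip_ge0 andbT.
  apply/ler_addgt0Pr => e e0; rewrite add0r.
  pose A : R := (F + 2 * t * (C0 * F)) / (t * gain M c).
  have A0 : 0 <= A.
    have tg : 0 <= t * gain M c by rewrite mulr_ge0 // ltW.
    have tF : 0 <= 2 * t * (C0 * F) by rewrite !mulr_ge0 ?(weight_C0 W) // ltW.
    by rewrite /A divr_ge0 // addr_ge0 // ltW.
  have A1 : 0 < A + 1 by rewrite ltr_wpDl.
  have r0 : 0 < p - 1 by rewrite subr_gt0.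
  (* For [del <= 1] both terms of [om del] are of order [del ^ (p - 1)]. *)
  pose del := Num.min 1 (Num.min (c / 2 / F) ((e / (A + 1)) `^ (p - 1)^-1)).
  have d0 : 0 < del.
    by rewrite !lt_min ltr01 !divr_gt0 // powR_gt0 // divr_gt0.
  have d1 : del <= 1 by rewrite ge_min lexx.
  have d2 : del * F <= c / 2.
    by rewrite -ler_pdivlMr // /del ge_min; apply/orP; right; rewrite ge_min lexx.
  have d3 : del `^ (p - 1) <= e / (A + 1).
    have h : del <= (e / (A + 1)) `^ (p - 1)^-1.
      by rewrite /del ge_min; apply/orP; right; rewrite ge_min lexx orbT.
    have := powR_le (ltW r0) (ltW d0) h.
    by rewrite -powRrM mulVf ?gt_eqF // powRr1 // divr_ge0 // ltW.
  apply: (le_trans (qle del d0 d2)).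
  have d4 : del <= del `^ (p - 1).
    by apply: ger1_powR; rewrite ?d0 ?d1 // lerBlDr ltW.
  apply: (@le_trans _ _ (A * del `^ (p - 1))).
    have tg0 : 0 <= (t * gain M c)^-1 by rewrite invr_ge0 mulr_ge0 // ltW.
    rewrite /om /A [leRHS]mulrAC; apply: (ler_wpM2r tg0).
    have h5 : del * F <= F * del `^ (p - 1) by rewrite mulrC ler_wpM2l // ltW.
    rewrite [leRHS]mulrDl; apply: lerD => //.
    by rewrite (mulrC (_ `^ _)) !mulrA.
  apply: (le_trans (ler_wpM2l A0 d3)).
  by rewrite mulrCA ler_piMr ?(ltW e0) // ler_pdivrMr // mul1r lerDl ler01.
have := ip_eq0 Lq q00; apply: filterS => x; rewrite /q.
case: (leP (w x) 0) => // wx /eqP; rewrite mulr1 => /eqP h.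
by have := weight_gt0 W x; rewrite h ltxx.
Qed.

End Weighted.

End NonlocalEnergy.

(** * Euclidean distance *)

Section EuclideanMetric.
Context {R : realType} {N : nat}.
Implicit Types x y z : rN R N.

(** Minkowski's inequality, by the Cauchy-Schwarz inequality for finite sums. *)
Lemma sqrt_sumD (a b : 'I_N -> R) :
  Num.sqrt (\sum_i (a i + b i) ^+ 2) <=
  Num.sqrt (\sum_i a i ^+ 2) + Num.sqrt (\sum_i b i ^+ 2).
Proof.
set A := \sum_i a i ^+ 2; set B := \sum_i b i ^+ 2.
have A0 : 0 <= A by apply: sumr_ge0 => i _; exact: sqr_ge0.
have B0 : 0 <= B by apply: sumr_ge0 => i _; exact: sqr_ge0.
have sA := sqr_sqrtr A0; have sB := sqr_sqrtr B0.
have a0 := sqrtr_ge0 A; have b0 := sqrtr_ge0 B.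
set al := Num.sqrt A in sA a0 *; set be := Num.sqrt B in sB b0 *.
rewrite -[leRHS]ger0_norm ?addr_ge0 // -sqrtr_sqr ler_sqrt ?sqr_ge0 //.
have -> : \sum_i (a i + b i) ^+ 2 = A + 2 * (\sum_i a i * b i) + B.
  rewrite /A /B mulr_sumr -!big_split /=; apply: eq_bigr => i _.
  by rewrite sqrrD mulr_natl.
suff : \sum_i a i * b i <= al * be by move: (\sum_i _ * _) => ?; rewrite -sA -sB; nra.
have [z|nz] := eqVneq (al * be) 0.
  rewrite z big1 // => i _; apply/eqP; rewrite mulf_eq0.
  move/eqP: z; rewrite mulf_eq0 => /orP[] /eqP z.
    move: sA; rewrite z expr0n /= /A => /esym/eqP; rewrite psumr_eq0; last by move=> *; exact: sqr_ge0.
    by move=> /allP/(_ i (mem_index_enum _)); rewrite sqrf_eq0 implyTb => ->.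
  move: sB; rewrite z expr0n /= /B => /esym/eqP; rewrite psumr_eq0; last by move=> *; exact: sqr_ge0.
  by move=> /allP/(_ i (mem_index_enum _)); rewrite sqrf_eq0 implyTb => ->; rewrite orbT.
have ab0 : 0 < al * be by rewrite lt_neqAle eq_sym nz mulr_ge0.
have : 0 <= \sum_i (be * a i - al * b i) ^+ 2 by apply: sumr_ge0 => i _; exact: sqr_ge0.
have -> : \sum_i (be * a i - al * b i) ^+ 2 =
    be ^+ 2 * A - 2 * (al * be) * (\sum_i a i * b i) + al ^+ 2 * B.
  rewrite /A /B !mulr_sumr -sumrN -!big_split /=; apply: eq_bigr => i _; ring.
rewrite -sA -sB; move: (\sum_i _ * _) => s h.
rewrite -(ler_pM2l ab0); move: h; lra.
Qed.

Lemma eucl_dist_ge0 x y : 0 <= eucl_dist x y.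
Proof. exact: sqrtr_ge0. Qed.

Lemma eucl_distC x y : eucl_dist x y = eucl_dist y x.
Proof. by congr Num.sqrt; apply: eq_bigr => i _; rewrite -opprB sqrrN. Qed.

Lemma eucl_dist_triangle y x z : eucl_dist x z <= eucl_dist x y + eucl_dist y z.
Proof.
rewrite /eucl_dist; apply: le_trans (sqrt_sumD _ _).
rewrite le_eqVlt; apply/orP; left; apply/eqP; congr Num.sqrt.
by apply: eq_bigr => i _; rewrite addrA subrK.
Qed.

Lemma dist_coord x y i : `|tnth x i - tnth y i| <= eucl_dist x y.
Proof.
rewrite -sqrtr_sqr ler_sqrt; last by apply: sumr_ge0 => j _; exact: sqr_ge0.
by rewrite (bigD1 i) //= lerDl; apply: sumr_ge0 => j _; exact: sqr_ge0.
Qed.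

Lemma dist_le_coord x y (l : R) : (forall i, `|tnth x i - tnth y i| <= l) -> 0 <= l ->
  eucl_dist x y <= N%:R * l.
Proof.
move=> h l0; have n0 : 0 <= N%:R * l by rewrite mulr_ge0.
rewrite -[leRHS](ger0_norm n0) -sqrtr_sqr ler_sqrt ?sqr_ge0 //.
apply: (@le_trans _ _ (\sum_(i < N) l ^+ 2)).
  by apply: ler_sum => i _; rewrite -real_normK ?num_real // lerXn2r ?nnegrE.
rewrite sumr_const card_ord -[leLHS]mulr_natl [leRHS]exprMn; apply: ler_wpM2r; first exact: sqr_ge0.
rewrite -natrX ler_nat; case: (N) => // n; by rewrite -mulnn leq_pmulr.
Qed.

Lemma eucl_dist_gt0 x y : x <> y -> 0 < eucl_dist x y.
Proof.
move=> xy; rewrite lt_neqAle eucl_dist_ge0 andbT eq_sym; apply/eqP => d0.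
apply: xy; apply: eq_from_tnth => i; apply/eqP; rewrite -subr_eq0 -normr_le0 -d0.
exact: dist_coord.
Qed.

Lemma measurable_eucl_dist2 :
  measurable_fun setT (fun z : rN R N * rN R N => eucl_dist z.1 z.2).
Proof.
apply: (@measurableT_comp _ _ _ _ _ _ (@Num.sqrt R)).
  by apply: continuous_measurable_fun; exact: sqrt_continuous.
apply: measurable_sum => i; apply: measurable_funX; apply: measurable_funB.
  by apply: (@measurableT_comp _ _ _ _ _ _ (fun x : rN R N => tnth x i)); [exact: measurable_tnth|exact: measurable_fst].
by apply: (@measurableT_comp _ _ _ _ _ _ (fun x : rN R N => tnth x i)); [exact: measurable_tnth|exact: measurable_snd].
Qed.

Lemma measurable_dist x : measurable_fun setT (fun y : rN R N => eucl_dist y x).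
Proof.
exact: (measurableT_comp measurable_eucl_dist2 (measurable_pair2 x)).
Qed.

Lemma measurable_eucl_ball x r : measurable (eucl_ball x r : set (rN R N)).
Proof.
have := measurable_dist x measurableT (measurable_itv `]-oo, r[); rewrite setTI.
by congr measurable; apply/seteqP; split => y /=; rewrite in_itv.
Qed.

Lemma leb_ball_le x r : 0 <= r -> (leb N (eucl_ball x r) <= ((2 * r) ^+ N)%:E)%E.
Proof.
move=> r0; rewrite -(@leb_cubeI _ _ [tuple tnth x i - r | i < N]) ?mulr_ge0 //.
apply: le_measure; rewrite ?inE; [exact: measurable_eucl_ball|exact: measurable_cubeI|].
move=> y yr i; rewrite tnth_mktuple.
have := le_lt_trans (dist_coord y x i) yr; rewrite ltr_norml => /andP[h1 h2].
by apply/andP; split; lra.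
Qed.

End EuclideanMetric.

(** * Powers of the distance integrated over dyadic shells *)

Section DyadicShells.
Context {R : realType} {N : nat}.
Implicit Types (x y : rN R N) (h : rN R N -> R).

(** The function is dominated by the sum of the [c k] times the indicators of the
    balls of radius [r k]; a geometric decay of the terms makes the sum finite. *)
Lemma shell_integral h x (r c : nat -> R) (A q : R) :
  measurable_fun setT h -> (forall y, 0 <= h y) ->
  (forall k, 0 <= c k) -> (forall k, 0 <= r k) -> 0 <= q < 1 ->
  (forall y, h y != 0 -> exists2 k, eucl_dist y x < r k & h y <= c k) ->
  (forall k, c k * (2 * r k) ^+ N <= A * q ^+ k) ->
  (\int[leb N]_y (h y)%:E <= (A / (1 - q))%:E)%E.
Proof.
move=> mh h0 c0 r0 /andP[q0 q1] hc cA.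
pose u k (y : rN R N) : \bar R := (c k * \1_(eucl_ball x (r k)) y)%:E.
have u0 k y : (0 <= u k y)%E by rewrite lee_fin mulr_ge0.
have mu k : measurable_fun setT (u k).
  apply/measurable_EFinP; apply: measurable_funM => //.
  by apply: measurable_indic; exact: measurable_eucl_ball.
apply: (@le_trans _ _ (\int[leb N]_y (\sum_(k <oo) u k y))%E).
  apply: ge0_le_integral => //.
  - by move=> y _; rewrite lee_fin.
  - by apply/measurable_EFinP.
  - by apply: ge0_emeasurable_sum.
  - move=> y _; have [hz|/hc[k yk hk]] := eqVneq (h y) 0.
      by rewrite hz; apply: nneseries_ge0.
    apply: le_trans (nneseries_lim_ge k.+1 _) => //.
    rewrite big_nat_recr //=; apply: (@le_trans _ _ (u k y)); last first.
      by rewrite leeDr //; apply: sume_ge0.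
    by rewrite /u lee_fin indicE mem_set // mulr1.
rewrite integral_nneseries // -nneseries_geometric //.
apply: lee_nneseries => [k _ _|k _]; first exact: integral_ge0.
rewrite /u; under eq_integral do rewrite EFinM.
rewrite ge0_integralZl_EFin //; last first.
  by apply/measurable_EFinP; apply: measurable_indic; exact: measurable_eucl_ball.
rewrite integral_indic //; last exact: measurable_eucl_ball.
rewrite setIT; apply: (@le_trans _ _ (c k * (2 * r k) ^+ N)%:E); last by rewrite lee_fin.
by rewrite EFinM lee_wpmul2l ?lee_fin ?leb_ball_le.
Qed.

Lemma powR_shell (u e : R) : 0 < u -> u `^ (e - N%:R) * (2 * (2 * u)) ^+ N = 4 ^+ N * u `^ e.
Proof.
move=> u0; rewrite mulrA (_ : 2 * 2 = 4 :> R); last by ring.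
rewrite exprMn -(powR_mulrn N (ltW u0)) mulrCA -powRD ?(gt_eqF u0) ?implybT //.
by rewrite subrK.
Qed.

Lemma half_exp_lt (a b : R) : 0 < a -> 0 < b -> exists k, 2^-1 ^+ k.+1 * a < b.
Proof.
move=> a0 b0; exists (Num.bound (a / b)).
have := archi_boundP (ltW (divr_gt0 a0 b0)); set n := Num.bound _ => h.
rewrite exprVn mulrC ltr_pdivrMr ?exprn_gt0 // mulrC -ltr_pdivrMr //.
apply: (lt_trans h); rewrite -natrX ltr_nat.
by apply: (@ltn_trans n.+1) => //; exact: ltn_expl.
Qed.

Lemma measurable_radial (f : R -> R) x : measurable_fun setT f ->
  measurable_fun setT (fun y : rN R N => f (eucl_dist y x)).
Proof. by move=> mf; apply: (measurableT_comp mf); exact: measurable_dist. Qed.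

(** The powers [t ^ (- N - e)] outside the ball of radius [rho], and [t ^ (- N + e)]
    inside it, are integrable as functions of the distance for every [e > 0]. *)
Definition tail_fun (e rho t : R) : R := (rho <= t)%R%:R * t `^ (- e - N%:R).
Definition core_fun (e rho t : R) : R := (t < rho)%R%:R * t `^ (e - N%:R).

Lemma measurable_tail_fun e rho : measurable_fun setT (tail_fun e rho).
Proof.
apply: measurable_funM; last exact: measurable_powR.
rewrite (_ : (fun t => _) = \1_(`[rho, +oo[) :> (R -> R)); last first.
  by apply/funext => t; rewrite indicE mem_setE in_itv /= andbT.
exact: measurable_indic.
Qed.

Lemma measurable_core_fun e rho : measurable_fun setT (core_fun e rho).
Proof.
apply: measurable_funM; last exact: measurable_powR.
rewrite (_ : (fun t => _) = \1_(`]-oo, rho[) :> (R -> R)); last first.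
  by apply/funext => t; rewrite indicE mem_setE in_itv /=.
exact: measurable_indic.
Qed.

Lemma half_powR_bounds (e : R) : 0 < e -> 0 <= 2^-1 `^ e < 1.
Proof.
move=> e0; have e1 : (1 : R) `^ e = 1 by rewrite powR1.
rewrite powR_ge0 /= -[ltRHS]e1 gt0_ltr_powR ?nnegrE //.
by rewrite invf_lt1 ?ltr1n.
Qed.

Lemma powR_exprn (a e : R) k : 0 <= a -> (a ^+ k) `^ e = (a `^ e) ^+ k.
Proof. by move=> a0; rewrite -(powR_mulrn k a0) -(powR_mulrn k (powR_ge0 a e)) -!powRrM mulrC. Qed.

Lemma tail_integral (e rho : R) x : 0 < e -> 0 < rho ->
  (\int[leb N]_y (tail_fun e rho (eucl_dist y x))%:E <=
   (4 ^+ N / (1 - 2^-1 `^ e) * rho `^ (- e))%:E)%E.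
Proof.
move=> e0 r0; rewrite mulrAC.
pose u k : R := 2 ^+ k * rho.
have u0 k : 0 < u k by rewrite mulr_gt0 // exprn_gt0.
apply: (@shell_integral _ x (fun k => 2 * u k) (fun k => u k `^ (- e - N%:R))).
- by apply: measurable_radial; exact: measurable_tail_fun.
- by move=> y; rewrite mulr_ge0 ?powR_ge0.
- by move=> k; exact: powR_ge0.
- by move=> k; rewrite mulr_ge0 // ltW.
- exact: half_powR_bounds.
- move=> y; rewrite /tail_fun; set t := eucl_dist y x.
  case: (leP rho t) => [rt _|_]; last by rewrite mul0r eqxx.
  have t0 : 0 < t by exact: lt_le_trans rt.
  have ex : exists k, t < 2 * u k.
    have [k hk] := half_exp_lt t0 r0; exists k.
    by move: hk; rewrite exprVn ltr_pdivrMl ?exprn_gt0 // exprS /u mulrA.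
  (* The first [k] for which the ball of radius [2 * u k] contains [y]. *)
  exists (ex_minn ex); case: ex_minnP => // k hk kmin; rewrite mul1r.
  have ut : u k <= t.
    case: k hk kmin => [|k] hk kmin; first by rewrite /u expr0 mul1r.
    rewrite leNgt; apply/negP => h; have := kmin k; rewrite ltnn => /(_ _)/negP; apply => //.
    by rewrite /u mulrA -exprS.
  have -> : - e - N%:R = - (e + N%:R) by ring.
  by rewrite !powRN lef_pV2 ?posrE ?powR_gt0 // powR_le ?(ltW (u0 k)) ?addr_ge0 // ltW.
move=> k; rewrite powR_shell // /u powRM ?exprn_ge0 ?(ltW r0) // powR_exprn //.
by rewrite -[2^-1]powR_inv1 // -powRrM mulN1r mulrA mulrAC.
Qed.

Lemma core_integral (e rho : R) x : 0 < e -> e <= N%:R -> 0 < rho ->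
  (\int[leb N]_y (core_fun e rho (eucl_dist y x))%:E <=
   (4 ^+ N / (1 - 2^-1 `^ e) * rho `^ e)%:E)%E.
Proof.
move=> e0 eN r0; rewrite mulrAC.
pose u k : R := 2^-1 ^+ k.+1 * rho.
have u0 k : 0 < u k by rewrite mulr_gt0 // exprn_gt0.
have u2 k : 2 * u k = 2^-1 ^+ k * rho by rewrite /u exprS !mulrA divff // mul1r.
apply: (@shell_integral _ x (fun k => 2 * u k) (fun k => u k `^ (e - N%:R))).
- by apply: measurable_radial; exact: measurable_core_fun.
- by move=> y; rewrite mulr_ge0 ?powR_ge0.
- by move=> k; exact: powR_ge0.
- by move=> k; rewrite mulr_ge0 // ltW.
- exact: half_powR_bounds.
- move=> y; rewrite /core_fun; set t := eucl_dist y x.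
  case: (ltP t rho) => [tr|_]; last by rewrite mul0r eqxx.
  rewrite mul1r => tn.
  have [tz|tn0] := eqVneq t 0.
    exists 0%N; first by rewrite tz mulr_gt0.
    have [eN0|eN0] := eqVneq (e - N%:R) 0; first by rewrite eN0 !powRr0.
    by rewrite tz powR0 // powR_ge0.
  have t0 : 0 < t by rewrite lt_neqAle eq_sym tn0 eucl_dist_ge0.
  have ex : exists k, u k <= t by have [k hk] := half_exp_lt r0 t0; exists k; exact: ltW.
  (* The first [k] for which the ball of radius [u k] misses [y]. *)
  exists (ex_minn ex); case: ex_minnP => // k hk kmin.
    rewrite u2; case: k hk kmin => [|k] hk kmin; first by rewrite expr0 mul1r.
    by rewrite ltNge; apply/negP => h; have := kmin k h; rewrite ltnn.
  have -> : e - N%:R = - (N%:R - e) by ring.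
  by rewrite !powRN lef_pV2 ?posrE ?powR_gt0 // powR_le ?(ltW (u0 k)) ?subr_ge0 // ltW.
move=> k; rewrite powR_shell // /u powRM ?exprn_ge0 ?(ltW r0) // powR_exprn //.
have /andP[h0 h1] := half_powR_bounds e0.
rewrite -[leRHS]mulrA ler_wpM2l ?exprn_ge0 // mulrC ler_wpM2l ?powR_ge0 //.
by rewrite exprS ler_piMl ?exprn_ge0 // ltW.
Qed.

End DyadicShells.

(** * The weight with the decay of the kernel *)

Section Bump.
Context {R : realType} {N : nat}.
Variable sg : R.
Hypothesis N0 : (0 < N)%N.
Hypothesis sg0 : 0 < sg.
Hypothesis sg1 : sg < 1.
Implicit Types (x y : rN R N).

Let alpha : R := N%:R + sg.

Let alpha1 : 1 < alpha.
Proof. by rewrite /alpha ltr_pwDr // ler1n. Qed.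

Let alpha0 : 0 < alpha. Proof. exact: lt_trans alpha1. Qed.

Lemma powRN_anti (r a b : R) : 0 <= r -> 0 < a -> a <= b -> b `^ (- r) <= a `^ (- r).
Proof.
move=> r0 a0 ab; have b0 : 0 < b by exact: lt_le_trans ab.
by rewrite !powRN lef_pV2 ?posrE ?powR_gt0 // powR_le // ltW.
Qed.

Lemma far_dist (r a b d : R) : r + b < (r + a) / 2 -> a <= d + b -> (r + a) / 2 <= d.
Proof. by move=> *; lra. Qed.

Lemma far_small (f g k q c : R) : 0 < f -> 0 < g -> 0 <= k -> 0 <= q -> 1 <= c ->
  g <= c * f -> `|f - g| * k <= c * f * (k + q * g).
Proof.
move=> f0 g0 k0 q0 c1 gf; have cf : f <= c * f by rewrite ler_peMl // ltW.
have cf0 : 0 <= c * f by rewrite (le_trans _ cf) // ltW.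
rewrite mulrDr; apply: (@le_trans _ _ (c * f * k)); last first.
  by rewrite lerDl mulr_ge0 // mulr_ge0 // ltW.
by rewrite ler_wpM2r // ler_norml; apply/andP; split; lra.
Qed.

Lemma far_large (f g k q c : R) : 0 < f -> 0 < g -> 0 <= k -> 0 <= q -> 1 <= c ->
  c * f < g -> k <= c * f * q -> `|f - g| * k <= c * f * (k + q * g).
Proof.
move=> f0 g0 k0 q0 c1 gf kq; have cf : f <= c * f by rewrite ler_peMl // ltW.
have cf0 : 0 <= c * f by rewrite (le_trans _ cf) // ltW.
rewrite mulrDr; apply: (@le_trans _ _ (c * f * (q * g))); last first.
  by rewrite lerDr mulr_ge0.
rewrite mulrA [leRHS]mulrC; apply: ler_pM => //.
by rewrite ler_norml; apply/andP; split; lra.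
Qed.

Lemma bernoulli (a : R) : 0 < a -> 1 + alpha * (a - 1) <= a `^ alpha.
Proof.
move=> a0; have := powR_tangent 1 a alpha1.
have e1 (e : R) : (1 : R) `^ e = 1 by rewrite powR1.
by rewrite normr1 (gtr0_norm a0) ge0_Phi // !e1 mulr1.
Qed.

Lemma inv_powR_lip (u v : R) : 1 <= u -> u <= v ->
  u `^ (- alpha) - v `^ (- alpha) <= alpha * (v - u) * u `^ (- alpha).
Proof.
move=> u1 uv; have u0 : 0 < u by exact: lt_le_trans u1.
have v0 : 0 < v by exact: lt_le_trans uv.
have h := bernoulli (divr_gt0 u0 v0).
have -> : v `^ (- alpha) = (u / v) `^ alpha * u `^ (- alpha).
  rewrite powRM ?invr_ge0 ?(ltW u0) ?(ltW v0) // mulrAC -powRD ?(gt_eqF u0) ?implybT //.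
  by rewrite subrr powRr0 mul1r -(powR_inv1 (ltW v0)) -powRrM mulN1r.
rewrite -{1}[u `^ _]mul1r -mulrBl ler_wpM2r ?powR_ge0 //.
apply: (@le_trans _ _ (alpha * (1 - u / v))); first by move: h; lra.
rewrite ler_wpM2l ?(ltW alpha0) //.
have -> : 1 - u / v = (v - u) / v by rewrite mulrBl divff ?gt_eqF.
by rewrite ler_pdivrMr // ler_peMr ?subr_ge0 // (le_trans u1).
Qed.

(** When [v < u] the roles of [u] and [v] are exchanged in [inv_powR_lip]; as
    [u <= 2 * v], the two powers differ by at most the factor [2 ^ alpha]. *)
Lemma inv_powR_near (u v del : R) : 1 <= u -> 1 <= v -> `|u - v| <= del -> del <= 1 ->
  `|u `^ (- alpha) - v `^ (- alpha)| <= 2 `^ alpha * alpha * del * u `^ (- alpha).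
Proof.
move=> u1 v1; have u0 : 0 < u by exact: lt_le_trans u1.
have v0 : 0 < v by exact: lt_le_trans v1.
have two1 : 1 <= 2 `^ alpha :> R.
  have e1 : (1 : R) `^ alpha = 1 by rewrite powR1.
  by rewrite -[leLHS]e1 powR_le ?(ltW alpha0) // ler1n.
case: (leP u v) => [uv|/ltW vu] dd d1.
  have dl : v - u <= del by rewrite (le_trans _ dd) // ler0_norm ?subr_le0 // opprB.
  rewrite ger0_norm ?subr_ge0; last by exact: powRN_anti (ltW alpha0) u0 uv.
  apply: (le_trans (inv_powR_lip u1 uv)); rewrite ler_wpM2r ?powR_ge0 //.
  rewrite -mulrA; apply: (@le_trans _ _ (alpha * del)).
    by rewrite ler_wpM2l ?(ltW alpha0).
  by rewrite ler_peMl // mulr_ge0 ?(ltW alpha0) // (le_trans _ dl) // subr_ge0.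
have dl : u - v <= del by rewrite (le_trans _ dd) // ler_norm.
rewrite distrC ger0_norm ?subr_ge0; last by exact: powRN_anti (ltW alpha0) v0 vu.
apply: (le_trans (inv_powR_lip v1 vu)).
have h : v `^ (- alpha) <= 2 `^ alpha * u `^ (- alpha).
  have -> : 2 `^ alpha * u `^ (- alpha) = (u / 2) `^ (- alpha).
    rewrite powRM ?invr_ge0 ?(ltW u0) // mulrC; congr (_ * _).
    by rewrite -[2^-1]powR_inv1 // -powRrM mulN1r opprK.
  apply: powRN_anti; rewrite ?(ltW alpha0) ?divr_gt0 //.
  by rewrite ler_pdivrMr //; lra.
apply: (@le_trans _ _ (alpha * del * (2 `^ alpha * u `^ (- alpha)))); last first.
  by rewrite mulrA (mulrC _ (2 `^ alpha)) !mulrA.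
apply: ler_pM => //; rewrite ?mulr_ge0 ?powR_ge0 ?(ltW alpha0) ?subr_ge0 //.
by rewrite ler_wpM2l ?(ltW alpha0).
Qed.

(** A profile that decays like the kernel, at distance [r] from [x0]. *)
Definition bump x0 (r : R) x : R := (1 + eucl_dist x x0 / r) `^ (- alpha).

Definition kern x y : R := (eucl_dist x y `^ alpha)^-1.

Let two1 : 1 <= 2 `^ alpha :> R.
Proof.
have e1 : (1 : R) `^ alpha = 1 by rewrite powR1.
by rewrite -[leLHS]e1 powR_le ?(ltW alpha0) // ler1n.
Qed.

Section Scale.
Variables (x0 : rN R N) (r : R).
Hypothesis r0 : 0 < r.

Let base1 x : 1 <= 1 + eucl_dist x x0 / r.
Proof. by rewrite lerDl divr_ge0 ?eucl_dist_ge0 // ltW. Qed.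

Let base0 x : 0 < 1 + eucl_dist x x0 / r.
Proof. exact: lt_le_trans (base1 x). Qed.

Lemma bump_gt0 x : 0 < bump x0 r x.
Proof. exact: powR_gt0. Qed.

Lemma bump_le1 x : bump x0 r x <= 1.
Proof.
have e1 : (1 : R) `^ (- alpha) = 1 by rewrite powR1.
by rewrite -[leRHS]e1 powRN_anti // ltW.
Qed.

Lemma measurable_bump : measurable_fun setT (bump x0 r).
Proof.
apply: (measurableT_comp (measurable_powR _)).
apply: measurable_funD => //; apply: measurable_funM => //; exact: measurable_dist.
Qed.

Lemma kern_tail x y : x <> y -> kern x y = eucl_dist y x `^ (- sg - N%:R).
Proof. by move=> xy; rewrite /kern -powRN eucl_distC /alpha opprD addrC. Qed.

(** Either the two values are comparable, or the value at [y] is much larger; in the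
    latter case [y] is so much closer to [x0] than [x] that the distance of [x] and
    [y] is at least half of [r + |x - x0|], and the kernel is bounded by the value at
    [x]. *)
Lemma bump_far x y : r <= eucl_dist y x ->
  `|bump x0 r x - bump x0 r y| * kern x y <=
   2 `^ alpha * bump x0 r x * (kern x y + r `^ (- alpha) * bump x0 r y).
Proof.
move=> rd; have d0 : 0 < eucl_dist y x by exact: lt_le_trans rd.
have [f0 g0] := (bump_gt0 x, bump_gt0 y).
have k0 : 0 <= kern x y by rewrite invr_ge0 powR_ge0.
have c1 := two1.
case: (leP (bump x0 r y) (2 `^ alpha * bump x0 r x)) => h.
  apply: far_small => //; exact: powR_ge0.
apply: far_large => //; first exact: powR_ge0.
have uv : 1 + eucl_dist y x0 / r < (1 + eucl_dist x x0 / r) / 2.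
  rewrite ltNge; apply/negP => uv; move: h; rewrite ltNge => /negP; apply.
  have -> : 2 `^ alpha * bump x0 r x = ((1 + eucl_dist x x0 / r) / 2) `^ (- alpha).
    rewrite powRM ?invr_ge0 ?(ltW (base0 x)) // mulrC; congr (_ * _).
    by rewrite -[2^-1]powR_inv1 // -powRrM mulN1r opprK.
  by apply: powRN_anti; rewrite ?(ltW alpha0) ?divr_gt0.
have dd : r * (1 + eucl_dist x x0 / r) / 2 <= eucl_dist y x.
  have := eucl_dist_triangle y x x0; rewrite (eucl_distC x y).
  have e z : r * (1 + eucl_dist z x0 / r) = r + eucl_dist z x0 by field; rewrite gt_eqF.
  move: uv; rewrite -(ltr_pM2l r0) [ltRHS]mulrA !e; exact: far_dist.
have k1 : kern x y = eucl_dist y x `^ (- alpha) by rewrite /kern powRN eucl_distC.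
rewrite k1; apply: (le_trans (powRN_anti (ltW alpha0) _ dd)) => /=.
  by rewrite divr_gt0 // mulr_gt0.
rewrite powRM ?invr_ge0 ?mulr_ge0 ?(ltW r0) ?(ltW (base0 x)) //.
rewrite powRM ?(ltW r0) ?(ltW (base0 x)) // -[2^-1]powR_inv1 // -powRrM mulN1r opprK.
by rewrite [leLHS]mulrC mulrA [leRHS]mulrAC.
Qed.

(** The logarithm of the profile is Lipschitz with constant of order [1 / r]. *)
Lemma bump_near x y : eucl_dist y x < r ->
  `|bump x0 r x - bump x0 r y| * kern x y <=
   2 `^ alpha * bump x0 r x * (alpha / r * eucl_dist y x `^ ((1 - sg) - N%:R)).
Proof.
move=> dr; have [->|/eqP xy] := eqVneq x y.
  by rewrite subrr normr0 mul0r !mulr_ge0 ?powR_ge0 ?invr_ge0 // ltW.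
have d0 : 0 < eucl_dist y x by rewrite eucl_dist_gt0 // => yx; exact: xy.
pose del := eucl_dist y x / r.
have h : `|bump x0 r x - bump x0 r y| <= 2 `^ alpha * alpha * del * bump x0 r x.
  apply: inv_powR_near => //.
    rewrite opprD addrACA subrr add0r -mulrBl normrM (ger0_norm (_ : 0 <= r^-1)) ?invr_ge0 ?(ltW r0) //.
    rewrite ler_wpM2r ?invr_ge0 ?(ltW r0) // ler_norml.
    have := eucl_dist_triangle y x x0; have := eucl_dist_triangle x y x0.
    by rewrite (eucl_distC x y) => *; apply/andP; split; lra.
  by rewrite /del ler_pdivrMr // mul1r ltW.
apply: (le_trans (ler_wpM2r _ h)); first by rewrite invr_ge0 powR_ge0.
have k1 : del * kern x y = r^-1 * eucl_dist y x `^ ((1 - sg) - N%:R).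
  rewrite /kern eucl_distC -powRN /del mulrC mulrA mulrC; congr (_ * _).
  rewrite mulrC -{1}[eucl_dist y x](powRr1 (ltW d0)) -powRD ?(gt_eqF d0) ?implybT //.
  congr (_ `^ _); rewrite /alpha; ring.
rewrite le_eqVlt; apply/orP; left; apply/eqP.
rewrite -[RHS]mulrA [in RHS](mulrC (bump _ _ _)) -(mulrA alpha) -k1; ring.
Qed.

(** From [|x - y| <= a + b <= r * (1 + a / r) * (1 + b / r)], where [a] and [b] are
    the distances to [x0]. *)
Lemma kern_bump x y : x <> y -> r `^ (- alpha) * (bump x0 r x * bump x0 r y) <= kern x y.
Proof.
move=> xy; have d0 := eucl_dist_gt0 xy.
rewrite /kern -powRN -powRM ?(ltW (base0 _)) // -powRM ?(ltW r0) ?mulr_ge0 ?(ltW (base0 _)) //.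
apply: powRN_anti; rewrite ?(ltW alpha0) //.
have := eucl_dist_triangle x0 x y; rewrite (eucl_distC x0 y).
have := eucl_dist_ge0 x x0; have := eucl_dist_ge0 y x0.
move: (eucl_dist x y) (eucl_dist x x0) (eucl_dist y x0) => d a b b0 a0 dab.
apply: (le_trans dab).
have -> : r * ((1 + a / r) * (1 + b / r)) = r + a + b + a * b / r.
  by field; rewrite gt_eqF.
have : 0 <= a * b / r by rewrite divr_ge0 ?mulr_ge0 // ltW.
move: (a * b / r) r0 => *; lra.
Qed.

Definition core_const (e : R) : R := 4 ^+ N / (1 - 2^-1 `^ e).

Lemma core_const_gt0 e : 0 < e -> 0 < core_const e.
Proof.
move=> e0; have /andP[_ h] := half_powR_bounds e0.
by rewrite divr_gt0 ?exprn_gt0 ?subr_gt0.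
Qed.

Definition mass_const : R := 2 ^+ N + core_const sg.

Definition var_const : R :=
  2 `^ alpha * (alpha * core_const (1 - sg) + core_const sg + mass_const).

Lemma mass_const_gt0 : 0 < mass_const.
Proof. by rewrite addr_gt0 ?exprn_gt0 ?core_const_gt0. Qed.

Lemma var_const_gt0 : 0 < var_const.
Proof.
rewrite mulr_gt0 ?powR_gt0 // !addr_gt0 ?mass_const_gt0 ?core_const_gt0 //.
by rewrite mulr_gt0 ?core_const_gt0 ?subr_gt0.
Qed.

Let powRs (a b : R) : r `^ a * r `^ b = r `^ (a + b).
Proof. by rewrite -powRD ?(gt_eqF r0) ?implybT. Qed.

Lemma bump_mass : (\int[leb N]_x (bump x0 r x)%:E <= (mass_const * r ^+ N)%:E)%E.
Proof.
pose g y := r `^ alpha * tail_fun sg r (eucl_dist y x0) (N := N).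
have mt : measurable_fun setT (fun y : rN R N => tail_fun sg r (eucl_dist y x0) (N := N)).
  by apply: measurable_radial; exact: measurable_tail_fun.
have t0 y : 0 <= tail_fun sg r (eucl_dist y x0) (N := N) by rewrite mulr_ge0 ?powR_ge0.
have mb := measurable_eucl_ball x0 r.
apply: (@le_trans _ _ (\int[leb N]_y ((\1_(eucl_ball x0 r) y)%:E + (g y)%:E))%E).
  apply: ge0_le_integral => //.
  - by move=> y _; rewrite lee_fin ltW // bump_gt0.
  - by apply/measurable_EFinP; exact: measurable_bump.
  - apply: emeasurable_funD; apply/measurable_EFinP; first exact: measurable_indic.
    exact: measurable_funM.
  - move=> y _; rewrite -EFinD lee_fin indicE /g /tail_fun.
    have [yr|yr] := ltP (eucl_dist y x0) r.
      by rewrite mem_set // mul0r mulr0 addr0 bump_le1.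
    rewrite memNset ?add0r ?mul1r; last by rewrite /eucl_ball /= ltNge yr.
    have d0 : 0 < eucl_dist y x0 by exact: lt_le_trans yr.
    apply: (@le_trans _ _ ((eucl_dist y x0 / r) `^ (- alpha))).
      by apply: powRN_anti; rewrite ?(ltW alpha0) ?divr_gt0 // lerDr.
    rewrite powRM ?(ltW d0) ?invr_ge0 ?(ltW r0) // mulrC -(powR_inv1 (ltW r0)) -powRrM mulN1r opprK.
    by rewrite (_ : - sg - N%:R = - alpha) // /alpha opprD addrC.
rewrite ge0_integralD //; last 3 first.
- by apply/measurable_EFinP; exact: measurable_indic.
- by move=> y _; rewrite lee_fin mulr_ge0 ?powR_ge0.
- by apply/measurable_EFinP; exact: measurable_funM.
rewrite /mass_const mulrDl EFinD; apply: leeD.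
  by rewrite integral_indic // setIT -exprMn leb_ball_le // ltW.
rewrite /g; under eq_integral do rewrite EFinM.
rewrite ge0_integralZl_EFin ?powR_ge0 //; last first.
- by apply/measurable_EFinP.
- by move=> y _; rewrite lee_fin.
apply: (le_trans (lee_wpmul2l _ (tail_integral _ sg0 r0))); first by rewrite lee_fin powR_ge0.
rewrite -EFinM lee_fin -/(core_const sg) mulrCA powRs -powR_mulrn ?(ltW r0) //.
by rewrite /alpha addrK.
Qed.

(** The near part of the kernel is integrated against the distance, which needs
    [sg < 1]; the far part is integrable by itself, up to the mass of the profile. *)
Lemma bump_var x :
  (\int[leb N]_y (`|bump x0 r x - bump x0 r y| * kern x y)%:E <=
   (var_const * r `^ (- sg) * bump x0 r x)%:E)%E.
Proof.
pose g1 y := alpha / r * core_fun (1 - sg) r (eucl_dist y x) (N := N).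
pose g2 y := tail_fun sg r (eucl_dist y x) (N := N).
pose g3 y := r `^ (- alpha) * bump x0 r y.
have ar0 : 0 <= alpha / r by rewrite divr_ge0 ?ltW.
have c0 y : 0 <= core_fun (1 - sg) r (eucl_dist y x) (N := N) by rewrite mulr_ge0 ?powR_ge0.
have b0 y : 0 <= bump x0 r y by rewrite ltW ?bump_gt0.
have g10 y : 0 <= g1 y by rewrite mulr_ge0.
have g20 y : 0 <= g2 y by rewrite mulr_ge0 ?powR_ge0.
have g30 y : 0 <= g3 y by rewrite mulr_ge0 ?powR_ge0.
have mc : measurable_fun setT (fun y : rN R N => core_fun (1 - sg) r (eucl_dist y x) (N := N)).
  by apply: measurable_radial; exact: measurable_core_fun.
have m1 : measurable_fun setT g1 by exact: measurable_funM.
have m2 : measurable_fun setT g2 by apply: measurable_radial; exact: measurable_tail_fun.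
have m3 : measurable_fun setT g3 by apply: measurable_funM => //; exact: measurable_bump.
have a0 : 0 <= 2 `^ alpha * bump x0 r x by rewrite mulr_ge0 ?powR_ge0.
have k0 y : 0 <= kern x y by rewrite invr_ge0 powR_ge0.
have mk : measurable_fun setT (kern x).
  apply: (@measurableT_comp _ _ _ _ _ _ (fun t : R => (t `^ alpha)^-1) _ (fun y => eucl_dist x y)).
    under eq_fun do rewrite -powRN; exact: measurable_powR.
  by under eq_fun do rewrite eucl_distC; exact: measurable_dist.
have key y : `|bump x0 r x - bump x0 r y| * kern x y <=
    2 `^ alpha * bump x0 r x * (g1 y + (g2 y + g3 y)).
  have g230 : 0 <= g2 y + g3 y by exact: addr_ge0 (g20 y) (g30 y).
  have [xy|/eqP xy] := eqVneq x y.
    rewrite -xy subrr normr0 mul0r.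
    exact: mulr_ge0 a0 (addr_ge0 (g10 x) (addr_ge0 (g20 x) (g30 x))).
  have [yr|yr] := ltP (eucl_dist y x) r.
    apply: (le_trans (bump_near yr)); rewrite ler_wpM2l //.
    by rewrite {1}/g1 /core_fun yr mul1r lerDl.
  apply: (le_trans (bump_far yr)); rewrite ler_wpM2l // kern_tail //.
  by rewrite {1}/g2 /tail_fun yr mul1r lerDr.
have i1 : (\int[leb N]_y (g1 y)%:E <= (alpha * core_const (1 - sg) * r `^ (- sg))%:E)%E.
  rewrite /g1; under eq_integral do rewrite EFinM.
  rewrite ge0_integralZl_EFin //; last first.
  - by apply/measurable_EFinP.
  - by move=> y _; rewrite lee_fin.
  have sg' : 0 < 1 - sg by rewrite subr_gt0.
  have sN : 1 - sg <= N%:R.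
    by rewrite (@le_trans _ _ 1) ?ler1n // lerBlDr lerDl ltW.
  apply: (le_trans (lee_wpmul2l _ (core_integral x sg' sN r0))); first by rewrite lee_fin.
  rewrite -EFinM lee_fin -/(core_const _) mulrACA.
  rewrite -(powR_inv1 (ltW r0)) powRs (_ : -1 + (1 - sg) = - sg) //; ring.
have i2 : (\int[leb N]_y (g2 y)%:E <= (core_const sg * r `^ (- sg))%:E)%E.
  exact: tail_integral.
have i3 : (\int[leb N]_y (g3 y)%:E <= (mass_const * r `^ (- sg))%:E)%E.
  rewrite /g3; under eq_integral do rewrite EFinM.
  rewrite ge0_integralZl_EFin ?powR_ge0 //; last first.
  - by apply/measurable_EFinP; exact: measurable_bump.
  - by move=> y _; rewrite lee_fin.
  apply: (le_trans (lee_wpmul2l _ bump_mass)); first by rewrite lee_fin powR_ge0.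
  rewrite -EFinM lee_fin mulrCA -powR_mulrn ?(ltW r0) // powRs.
  by rewrite (_ : - alpha + N%:R = - sg) // /alpha; ring.
clearbody g1 g2 g3.
apply: (@le_trans _ _ (\int[leb N]_y ((2 `^ alpha * bump x0 r x)%:E * ((g1 y)%:E + ((g2 y)%:E + (g3 y)%:E))))%E).
  apply: ge0_le_integral => //.
  - by move=> y _; rewrite lee_fin mulr_ge0.
  - apply/measurable_EFinP; apply: measurable_funM => //; apply: measurableT_comp => //.
    by apply: measurable_funB => //; exact: measurable_bump.
  - apply: emeasurable_funM => //; apply: emeasurable_funD; first by apply/measurable_EFinP.
    by apply: emeasurable_funD; apply/measurable_EFinP.
  - move=> y _; rewrite -!EFinD -EFinM lee_fin.
    exact: key.
rewrite ge0_integralZl_EFin //; last 2 first.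
- by move=> y _; rewrite -!EFinD lee_fin !addr_ge0.
- apply: emeasurable_funD; first by apply/measurable_EFinP.
  by apply: emeasurable_funD; apply/measurable_EFinP.
rewrite ge0_integralD //; last 4 first.
- by move=> y _; rewrite lee_fin.
- by apply/measurable_EFinP.
- by move=> y _; rewrite -EFinD lee_fin addr_ge0.
- by apply: emeasurable_funD; apply/measurable_EFinP.
rewrite ge0_integralD //; last 4 first.
- by move=> y _; rewrite lee_fin.
- by apply/measurable_EFinP.
- by move=> y _; rewrite lee_fin.
- by apply/measurable_EFinP.
apply: (le_trans (lee_wpmul2l _ (leeD i1 (leeD i2 i3)))); first by rewrite lee_fin.
rewrite -!EFinD -EFinM lee_fin le_eqVlt; apply/orP; left; apply/eqP.
rewrite /var_const; ring.
Qed.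

Lemma weight_bump :
  weight (lebf N) kern (bump x0 r) (mass_const * r ^+ N) (var_const * r `^ (- sg)) (r `^ (- alpha)).
Proof.
split.
- exact: measurable_bump.
- exact: bump_gt0.
- exact: bump_le1.
- exact: bump_mass.
- exact: bump_var.
- by move=> x y xy; exact: kern_bump.
- by rewrite mulr_gt0 ?mass_const_gt0 ?exprn_gt0.
- by rewrite mulr_ge0 ?powR_ge0 ?ltW ?var_const_gt0.
- exact: powR_gt0.
Qed.

End Scale.
End Bump.

(** * From the abstract semigroup to the fractional p-Laplacian *)

Section SemigroupRN.
Context {R : realType} {N : nat}.
Variables s p : R.
Implicit Types (f w v g : rN R N -> R).

(** [leb N] is defined by recursion, so the equality with its repackaging does not
    hold by computation. *)
Lemma lebfE : (lebf N : {measure set (rN R N) -> \bar R}) = leb N.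
Proof. exact/eq_measure. Qed.

Lemma Lfun_lebf f (q : \bar R) : (f \in Lfun (leb N) q) = (f \in Lfun (lebf N) q).
Proof. by rewrite -lebfE. Qed.

Lemma Lnorm_lebf (f : rN R N -> \bar R) (q : \bar R) : 'N[leb N]_q[f]%E = 'N[lebf N]_q[f]%E.
Proof. by rewrite -lebfE. Qed.

Lemma subdiffE v g : subdiff s p v g <-> nsubdiff (lebf N) (kern (s * p)) p v g.
Proof.
split=> -[Lv Lg ev h]; (split; [| |exact: ev|]).
- by rewrite -Lfun_lebf.
- by rewrite -Lfun_lebf.
- by move=> w Lw; apply: h; rewrite Lfun_lebf.
- by rewrite Lfun_lebf.
- by rewrite Lfun_lebf.
- by move=> w Lw; apply: h; rewrite -Lfun_lebf.
Qed.

Lemma resolventE lam f v : resolvent s p lam f v <-> nresolvent (lebf N) (kern (s * p)) p lam f v.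
Proof. by split=> -[g /subdiffE sg e]; exists g. Qed.

Lemma semigroupE t f w : semigroup s p t f w <-> nsemigroup (lebf N) (kern (s * p)) p t f w.
Proof.
split=> -[Lf Lw h]; split.
- by rewrite -Lfun_lebf.
- by rewrite -Lfun_lebf.
- move: h; case: eqP => // _ [v [v0 hv cv]]; exists v; split => //.
    by move=> n k; exact/resolventE.
  by under eq_fun do rewrite -Lnorm_lebf; exact: cv.
- by rewrite Lfun_lebf.
- by rewrite Lfun_lebf.
- move: h; case: eqP => // _ [v [v0 hv cv]]; exists v; split => //.
    by move=> n k; exact/resolventE.
  by under eq_fun do rewrite Lnorm_lebf; exact: cv.
Qed.

End SemigroupRN.

(** * Lebesgue spaces *)

Section LebesguePowers.
Context d (T : measurableType d) (R : realType).
Variable mu : {measure set T -> \bar R}.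
Implicit Types (f g : T -> R) (q e M : R).

Lemma measurable_normpow f q : measurable_fun setT f ->
  measurable_fun setT (fun x => (`|f x| `^ q)%:E : \bar R).
Proof.
move=> mf; apply/measurable_EFinP; apply: (measurableT_comp (measurable_powR _)).
exact: measurableT_comp.
Qed.

Lemma LnormE f q : 'N[mu]_q%:E[EFin \o f]%E = ((\int[mu]_x (`|f x| `^ q)%:E) `^ q^-1)%E.
Proof. by rewrite unlock /Lnorm. Qed.

Lemma LfunP f q : 0 < q ->
  f \in Lfun mu q%:E <-> measurable_fun setT f /\ (\int[mu]_x (`|f x| `^ q)%:E < +oo)%E.
Proof.
move=> q0; split=> [|[mf fi]].
  move=> /andP[]; rewrite !inE /= => mf; rewrite /finite_norm LnormE => h; split => //.
  by apply: lty_poweRy h; rewrite invr_eq0 gt_eqF.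
by apply/andP; split; rewrite inE //= /finite_norm LnormE poweR_lty.
Qed.

Lemma Lnorm_lt f q e : 0 < q -> 0 < e ->
  ('N[mu]_q%:E[EFin \o f] < e%:E)%E = (\int[mu]_x (`|f x| `^ q)%:E < (e `^ q)%:E)%E.
Proof.
move=> q0 e0; rewrite LnormE.
have : (0 <= \int[mu]_x (`|f x| `^ q)%:E)%E by apply: integral_ge0 => x _; rewrite lee_fin powR_ge0.
case: (\int[mu]_x _)%E => [r| |] // r0.
  have iq : 0 < q^-1 by rewrite invr_gt0.
  have h := powR_rootP iq (ltW e0) (r0 : 0 <= r).
  by rewrite poweR_EFin !lte_fin !ltNge -h invrK.
by rewrite poweRyr ?invr_neq0 ?gt_eqF.
Qed.

Lemma Lfun_bounded_support f q (A : set T) M : 0 < q -> measurable A ->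
  (mu A < +oo)%E -> measurable_fun setT f -> 0 <= M ->
  (forall x, `|f x| <= M * \1_A x) -> f \in Lfun mu q%:E.
Proof.
move=> q0 mA Afin mf M0 fM; apply/LfunP => //; split => //.
apply: (@le_lt_trans _ _ (\int[mu]_x ((M `^ q)%:E * (\1_A x)%:E))%E).
  apply: ge0_le_integral => //.
  - exact: measurable_normpow.
  - by apply: emeasurable_funM => //; apply/measurable_EFinP; exact: measurable_indic.
  - move=> x _; rewrite -EFinM lee_fin.
    have := fM x; rewrite indicE; case: (x \in A) => /=; rewrite ?mulr1 ?mulr0 => h.
      by rewrite powR_le // ltW.
    by rewrite (@le_anti _ _ `|f x| 0) ?powR0 ?gt_eqF // h normr_ge0.
rewrite ge0_integralZl_EFin ?powR_ge0 //; last first.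
  by apply/measurable_EFinP; exact: measurable_indic.
rewrite integral_indic // setIT.
by apply: lte_mul_pinfty; rewrite ?lee_fin ?powR_ge0.
Qed.

Lemma Lfun1y_L2 f : f \in Lfun mu 1%:E -> f \in Lfun mu +oo%E ->
  f \in Lfun mu 2%:E /\ exists2 M, 0 < M & {ae mu, forall x, f x <= M}.
Proof.
move=> /(LfunP _ ltr01)[mf f1] /andP[_]; rewrite inE /= /finite_norm unlock /Lnorm.
case: ifPn => mu0; last first.
  move=> _.
  (* Every property holds almost everywhere for a null measure. *)
  have m0 : mu setT = 0%E by apply/eqP; rewrite eq_le measure_ge0 andbT leNgt.
  have ae0 (P : T -> Prop) : {ae mu, forall x, P x} by exists setT; split.
  split; last by exists 1 => //; exact: ae0.
  apply/L2P; split => //.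
  rewrite (@ge0_ae_eq_integral _ _ _ mu setT (fun x => (f x ^+ 2)%:E) (cst 0%E)) //.
  - by rewrite integral0 ltry.
  - by apply/measurable_EFinP; exact: measurable_funX.
  - by move=> x _; rewrite lee_fin sqr_ge0.
  - exact: ae0.
move=> /ess_sup_inf.ess_supr_bounded[M hM].
pose M1 := Num.max 1 M.
have M10 : 0 < M1 by rewrite lt_max ltr01.
have fM : {ae mu, forall x, `|f x| <= M1}.
  by apply: filterS hM => x /= h; rewrite le_max h orbT.
split; last by exists M1 => //; apply: filterS fM => x; exact: le_trans (ler_norm _).
apply/L2P; split => //.
apply: (@le_lt_trans _ _ (\int[mu]_x (M1%:E * (`|f x| `^ 1)%:E))%E).
  apply: ae_ge0_le_integral => //.
  - by move=> x _; rewrite lee_fin sqr_ge0.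
  - by apply/measurable_EFinP; exact: measurable_funX.
  - by move=> x _; rewrite -EFinM lee_fin mulr_ge0 ?powR_ge0 // ltW.
  - by apply: emeasurable_funM => //; exact: measurable_normpow.
  - apply: filterS fM => x h _; rewrite -EFinM lee_fin powRr1 //.
    by rewrite -real_normK ?num_real // expr2 ler_wpM2r.
rewrite ge0_integralZl_EFin ?(ltW M10) //; last exact: measurable_normpow.
by apply: lte_mul_pinfty; rewrite ?lee_fin ?(ltW M10).
Qed.

(** The positive part of [h - w] is at most [|h_ n - w|]. *)
Lemma ae_le_Lnorm (h : T -> R) (h_ : nat -> T -> R) (w : T -> R) (q : R) : 0 < q ->
  measurable_fun setT h -> (forall n, measurable_fun setT (h_ n)) -> measurable_fun setT w ->
  (\forall n \near \oo, {ae mu, forall x, h x <= h_ n x}) ->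
  (forall e : R, 0 < e -> \forall n \near \oo,
     (\int[mu]_x (`|h_ n x - w x| `^ q)%:E < e%:E)%E) ->
  {ae mu, forall x, h x <= w x}.
Proof.
move=> q0 mh mh_ mw hh hw.
pose g x := (`|Num.max 0 (h x - w x)| `^ q)%:E : \bar R.
have mg : measurable_fun setT g.
  apply: measurable_normpow; apply: measurable_maxr => //; exact: measurable_funB.
have g0 x : (0 <= g x)%E by rewrite lee_fin powR_ge0.
have ig : (\int[mu]_x g x = 0)%E.
  apply/eqP; rewrite eq_le integral_ge0 ?andbT //.
  apply/lee_addgt0Pr => e e0; rewrite add0e.
  have [n [hn1 hn2]] : exists n, {ae mu, forall x, h x <= h_ n x} /\
      (\int[mu]_x (`|h_ n x - w x| `^ q)%:E < e%:E)%E.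
    have [n _ hn] := filterI hh (hw e e0); exists n; exact: (hn n (leqnn n)).
  apply: le_trans (ltW hn2); apply: ae_ge0_le_integral => //.
  - by apply: measurable_normpow; exact: measurable_funB.
  - apply: filterS hn1 => x hx _; rewrite lee_fin powR_le ?(ltW q0) //.
    rewrite ger0_norm ?le_max ?lexx // ge_max normr_ge0 /=.
    by rewrite (le_trans _ (ler_norm _)) // lerD2r.
have [h1 _] := ae_eq_integral_abs mu measurableT mg.
have : (\int[mu]_x `|g x| = 0)%E.
  by under eq_integral do rewrite gee0_abs //.
move=> /h1; apply: filterS => x /(_ Logic.I) /= [] /eqP.
rewrite powR_eq0 normr_eq0 => /andP[/eqP hx _].
by rewrite -subr_le0 -hx le_max lexx orbT.
Qed.

End LebesguePowers.

(** * Order preservation and truncation *)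

Section SemigroupOrder.
Context d (T : measurableType d) (R : realType).
Variable mu : {sigma_finite_measure set T -> \bar R}.
Variables (K : T -> T -> R) (p : R).
Hypothesis K0 : forall x y, 0 <= K x y.
Hypothesis mK : measurable_fun setT (fun z : T * T => K z.1 z.2).
Hypothesis p1 : 1 < p.
Hypothesis p2 : p < 2.
Implicit Types f g v w : T -> R.

Notation L2 := (Lfun mu 2%:E).

(** Testing the inequalities with the positive part of [w - z]. *)
Lemma L2cvg_ae_le (u v : nat -> T -> R) w z : (forall n, u n \in L2) -> (forall n, v n \in L2) ->
  w \in L2 -> z \in L2 -> L2cvg mu u w -> L2cvg mu v z ->
  (forall n, {ae mu, forall x, u n x <= v n x}) -> {ae mu, forall x, w x <= z x}.
Proof.
move=> Lu Lv Lw Lz uw vz uv.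
pose h x := Num.max 0 (w x - z x).
have Lh : h \in L2 by apply: L2_pos; exact: L2B.
have h0 x : 0 <= h x by rewrite /h le_max lexx.
have cu := L2cvg_ip Lu Lw Lh uw; have cv := L2cvg_ip Lv Lz Lh vz.
have wz : ip mu w h <= ip mu z h.
  apply: ler_cvg_to cu cv _; apply: nearW => n; apply: le_Rintegral_ae.
  - exact: L2_mul.
  - exact: L2_mul.
  - by apply: filterS (uv n) => x hx; rewrite ler_wpM2r.
have hh : ip mu h h = ip mu (w \- z) h.
  apply: eq_Rintegral => x _; rewrite /h /=; case: (leP (w x - z x) 0) => //.
  by rewrite mul0r mulr0.
have h00 : ip mu h h = 0.
  apply/le_anti; rewrite ip_ge0 andbT hh ipBl // subr_le0 //.
have := ip_eq0 Lh h00; apply: filterS => x hx.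
by rewrite -subr_le0 -hx /h le_max lexx orbT.
Qed.

Lemma nsemigroup_le t f g w z : 0 <= t -> nsemigroup mu K p t f w -> nsemigroup mu K p t g z ->
  {ae mu, forall x, f x <= g x} -> {ae mu, forall x, w x <= z x}.
Proof.
move=> t0 sf sg fg; have [Lf Lw hw] := sf; have [Lg Lz hz] := sg.
have [tz|tn] := eqVneq t 0.
  move: hw hz; rewrite tz eqxx => hw hz.
  by apply: filterS3 hw hz fg => x -> ->.
have tp : 0 < t by rewrite lt_neqAle eq_sym tn.
have [U sU cU] := nsemigroup_L2cvg tp sf; have [V sV cV] := nsemigroup_L2cvg tp sg.
apply: L2cvg_ae_le cU cV _ => // n.
- exact: scheme_L2 (sU n).
- exact: scheme_L2 (sV n).
- have l0 : 0 < t / n.+1%:R by rewrite divr_gt0.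
  exact: scheme_le l0 Lf Lg (sU n) (sV n) fg.
Qed.

End SemigroupOrder.

Section Truncation.
Context {R : realType} {N : nat}.
Implicit Types (f : rN R N -> R) (x : rN R N) (q : R).

Definition origin : rN R N := [tuple 0 | i < N].

Lemma eucl_norm_dist x : eucl_norm x = eucl_dist x origin.
Proof. by congr Num.sqrt; apply: eq_bigr => i _; rewrite tnth_mktuple subr0. Qed.

Definition trunc f (n : nat) x : R :=
  Num.min (Num.max 0 (f x)) n.+1%:R * \1_(eucl_ball origin n.+1%:R) x.

Lemma trunc_ge0 f n x : 0 <= trunc f n x.
Proof. by rewrite mulr_ge0 // le_min ler0n le_max lexx. Qed.

Lemma trunc_le f n x : trunc f n x <= Num.max 0 (f x).
Proof.
have h : 0 <= Num.max 0 (f x) by rewrite le_max lexx.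
rewrite /trunc indicE; case: (x \in _); rewrite ?mulr0 // mulr1.
by rewrite ge_min lexx.
Qed.

Lemma trunc_ub f n x : trunc f n x <= n.+1%:R * \1_(eucl_ball origin n.+1%:R) x.
Proof. by rewrite ler_wpM2r // ge_min lexx orbT. Qed.

Lemma measurable_trunc f n : measurable_fun setT f -> measurable_fun setT (trunc f n).
Proof.
move=> mf; apply: measurable_funM; last first.
  by apply: measurable_indic; exact: measurable_eucl_ball.
by apply: measurable_minr => //; exact: measurable_maxr.
Qed.

Lemma trunc_mono f n x : trunc f n x <= trunc f n.+1 x.
Proof.
have nn : n.+1%:R <= n.+2%:R :> R by rewrite ler_nat.
apply: ler_pM => //.
- by rewrite le_min ler0n le_max lexx.
- by rewrite le_min2.
- rewrite !indicE; case: (boolP (x \in _)) => // /set_mem h.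
  by rewrite mem_set //; exact: lt_le_trans nn.
Qed.

Lemma trunc_eventually f x : \forall n \near \oo, trunc f n x = Num.max 0 (f x).
Proof.
pose m := Num.max (Num.max 0 (f x)) (eucl_dist x origin).
exists (Num.bound m) => // n /= hn.
have mn : m < n.+1%:R.
  have m0 : 0 <= m by rewrite !le_max lexx.
  by rewrite (lt_le_trans (archi_boundP m0)) // ler_nat ltnW.
move: mn; rewrite gt_max => /andP[h1 h2].
by rewrite /trunc indicE mem_set // mulr1 min_l // ltW.
Qed.

Lemma trunc_cvg f x : trunc f n x @[n --> \oo] --> Num.max 0 (f x).
Proof. by apply: cvg_near_cst; exact: trunc_eventually. Qed.

Lemma leb_ball_lty x r : (leb N (eucl_ball x r) < +oo)%E.
Proof.
apply: (@le_lt_trans _ _ (leb N (eucl_ball x (Num.max 0 r)))); last first.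
  by rewrite (le_lt_trans (leb_ball_le _ _)) ?ltry // le_max lexx.
apply: le_measure; rewrite ?inE; [exact: measurable_eucl_ball|exact: measurable_eucl_ball|].
by move=> y; rewrite /eucl_ball /= => h; rewrite lt_max h orbT.
Qed.

Lemma trunc_Lfun f n q : 0 < q -> measurable_fun setT f -> trunc f n \in Lfun (leb N) q%:E.
Proof.
move=> q0 m0; apply: (@Lfun_bounded_support _ _ _ (leb N) _ _ (eucl_ball origin n.+1%:R) n.+1%:R) => //.
- exact: measurable_eucl_ball.
- exact: leb_ball_lty.
- exact: measurable_trunc.
- by move=> x; rewrite ger0_norm ?trunc_ge0 ?trunc_ub.
Qed.

Lemma trunc_Lfuny f n : measurable_fun setT f -> trunc f n \in Lfun (leb N) +oo%E.
Proof.
move=> m0; apply/andP; split; rewrite inE /=; first exact: measurable_trunc.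
rewrite /finite_norm unlock /Lnorm; case: ifPn => _; last by rewrite ltry.
apply: (@le_lt_trans _ _ (n.+1%:R : R)%:E); last exact: ltry.
apply/ess_sup_inf.ess_supP; apply: aeW => x /=; rewrite lee_fin ger0_norm ?trunc_ge0 //.
apply: (le_trans (trunc_ub _ _ _)); by rewrite ler_piMr // indicE.
Qed.

Lemma trunc_Lq_cvg f q : 0 < q -> f \in Lfun (leb N) q%:E -> {ae leb N, forall x, 0 <= f x} ->
  (\int[leb N]_x (`|trunc f n x - f x| `^ q)%:E)%E @[n --> \oo] --> 0%E.
Proof.
move=> q0 /(LfunP _ _ q0)[m0 i0] f0.
have := @dominated_convergence _ _ _ (leb N) setT measurableT
  (fun n x => (`|trunc f n x - f x| `^ q)%:E) (cst 0%E) (fun x => (`|f x| `^ q)%:E).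
case=> //.
- by move=> n; apply: measurable_normpow; apply: measurable_funB => //; exact: measurable_trunc.
- apply: filterS f0 => x fx _; apply: cvg_near_cst.
  apply: filterS (trunc_eventually f x) => n ->.
  by rewrite max_r // subrr normr0 powR0 // gt_eqF.
- apply/integrableP; split; first exact: measurable_normpow.
  by under eq_integral do rewrite gee0_abs ?lee_fin ?powR_ge0 //.
- apply: filterS f0 => x fx n _; rewrite gee0_abs ?lee_fin ?powR_ge0 //.
  apply: powR_le; rewrite ?(ltW q0) // distrC (ger0_norm fx).
  have := trunc_le f n x; rewrite max_r // => h.
  by rewrite ger0_norm ?subr_ge0 // lerBlDr lerDl trunc_ge0.
by move=> _ _; rewrite integral0.
Qed.

End Truncation.

(** * Mass estimates for solutions *)

Lemma measurable_kern {R : realType} {N : nat} (sg : R) :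
  measurable_fun setT (fun z : rN R N * rN R N => kern sg z.1 z.2).
Proof.
apply: (@measurableT_comp _ _ _ _ _ _ (fun t : R => (t `^ (N%:R + sg))^-1) _
  (fun z : rN R N * rN R N => eucl_dist z.1 z.2)).
  under eq_fun do rewrite -powRN; exact: measurable_powR.
exact: measurable_eucl_dist2.
Qed.

Section Solutions.
Context {R : realType} {N : nat}.
Variables s p : R.
Hypothesis N0 : (0 < N)%N.
Hypothesis sp0 : 0 < s * p.
Hypothesis sp1 : s * p < 1.
Hypothesis p1 : 1 < p.
Hypothesis p2 : p < 2.
Implicit Types (f h w : rN R N -> R) (x : rN R N).

Local Notation K := (kern (s * p)).
Local Notation mu := (lebf N).
Local Notation gam := (s * p / (2 - p)).

Let K0 x y : 0 <= K x y.
Proof. by rewrite invr_ge0 powR_ge0. Qed.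

Let mK := measurable_kern (R := R) (N := N) (s * p).

Let Ksym x y : K x y = K y x.
Proof. by rewrite /kern eucl_distC. Qed.

(** A minimal solution is the limit of its own nondecreasing approximations. For the
    extension of the semigroup to [L^q], the truncations of the datum converge in
    [L^q], the definition of the extension carries the convergence over to their
    evolutions, and these are nondecreasing. *)
Lemma solution_approximants f (u : R -> rN R N -> \bar R) t :
  measurable_fun setT f -> {ae leb N, forall x, 0 <= f x} -> is_solution s p f u -> 0 <= t ->
  exists (f_ h_ : nat -> rN R N -> R) (M_ : nat -> R),
    (forall n, [/\ nsemigroup mu K p t (f_ n) (h_ n), 0 < M_ n,
       {ae leb N, forall x, 0 <= f_ n x}, {ae leb N, forall x, f_ n x <= M_ n} &
       {ae leb N, forall x, ((h_ n x)%:E <= u t x)%E}]) /\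
    {ae leb N, forall x, f_ n x @[n --> \oo] --> f x}.
Proof.
move=> mf f0 sol t0; case: sol => [[q q1 [w hw]]|[f_ [u_ [Lf_ hf_ su_ cu]]]].
  have q0 : 0 < q by exact: lt_le_trans q1.
  have [[Lf Lw hq] uw] := hw t t0.
  have m_ n := measurable_trunc n mf.
  have /choice[h_ hh] : forall n, exists h, nsemigroup mu K p t (trunc f n) h.
    by move=> n; apply: nsemigroup_exists => //; rewrite -Lfun_lebf trunc_Lfun.
  exists (trunc f), h_, (fun n => n.+1%:R); split; last first.
    by apply: filterS f0 => x fx; have := @trunc_cvg _ _ f x; rewrite max_r.
  have Lh n : h_ n \in Lfun (leb N) 2%:E by have [_] := hh n; rewrite -Lfun_lebf.
  move=> n; split => //.
  - by apply: aeW => x; exact: trunc_ge0.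
  - apply: aeW => x; apply: (le_trans (trunc_ub _ _ _)); rewrite ler_piMr // indicE.
  - suff : {ae leb N, forall x, h_ n x <= w t x}.
      by apply: filterS2 uw => x -> ?; rewrite lee_fin.
    have [mw _] := (LfunP (leb N) (w t) q0).1 Lw.
    apply: (@ae_le_Lnorm _ _ _ (leb N) _ h_ _ q) => //.
    + exact: L2_measurable (Lh n).
    + by move=> k; exact: L2_measurable (Lh k).
    + exists n => // k /= nk; apply: (nsemigroup_le K0 mK p1 p2 t0 (hh n) (hh k)).
      apply: aeW => x; rewrite -(subnKC nk); elim: (k - n)%N => [|j IH]; first by rewrite addn0.
      by rewrite addnS (le_trans IH) // trunc_mono.
    + move=> e e0.
      have e1 : 0 < e `^ q^-1 by rewrite powR_gt0.
      have [del d0 hd] := hq _ e1.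
      have dq : (0 < (del `^ q)%:E)%E by rewrite lte_fin powR_gt0.
      have := trunc_Lq_cvg q0 Lf f0.
      move=> /fine_cvgP[fin /cvgrPdist_lt/(_ _ (powR_gt0 q d0)) h].
      apply: filterS2 fin h => k fk /= hk.
      have ek : e = (e `^ q^-1) `^ q by rewrite -powRrM mulVf ?gt_eqF // powRr1 // ltW.
      rewrite ek -Lnorm_lt //; apply: (hd (trunc f k)).
      * exact: trunc_Lfun.
      * exact: trunc_Lfun.
      * rewrite Lnorm_lt // -(fineK fk) lte_fin.
        by apply: le_lt_trans hk; rewrite sub0r normrN ler_norm.
      * exact/semigroupE.
have L2f n : f_ n \in Lfun (leb N) 2%:E.
  by have [a b] := Lf_ n; have [] := Lfun1y_L2 a b.
have /choice[M_ hM] : forall n, exists M, 0 < M /\ {ae leb N, forall x, f_ n x <= M}.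
  by move=> n; have [a b] := Lf_ n; have [_ [M M0 hM]] := Lfun1y_L2 a b; exists M.
exists f_, (fun n => u_ n t), M_; split; last by apply: filterS hf_ => x [].
move=> n; have [M0 fM] := hM n.
have S k : nsemigroup mu K p t (f_ k) (u_ k t) by apply/semigroupE; exact: su_.
have mono : {ae leb N, forall x, forall k, u_ k t x <= u_ k.+1 t x}.
  apply: ae_foralln => k; apply: (nsemigroup_le K0 mK p1 p2 t0 (S k) (S k.+1)).
  by apply: filterS hf_ => x [].
split => //; first by apply: filterS hf_ => x [].
apply: filterS2 mono (cu t t0) => x hx cx.
have nd : {homo (fun k => (u_ k t x)%:E) : a b / (a <= b)%N >-> (a <= b)%E}.
  move=> a b ab; rewrite lee_fin -(subnKC ab); elim: (b - a)%N => [|j IH]; first by rewrite addn0.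
  by rewrite addnS (le_trans IH).
have h := ereal_nondecreasing_cvgn nd.
rewrite (cvg_unique _ cx h) //; apply: ereal_sup_ubound; by exists n.
Qed.

(** Fatou's lemma. *)
Lemma approximants_mass (f_ : nat -> rN R N -> R) f phi (B : R) :
  (forall n, f_ n \in Lfun mu 2%:E) -> phi \in Lfun mu 2%:E -> (forall x, 0 <= phi x) ->
  measurable_fun setT f -> (forall n, {ae leb N, forall x, 0 <= f_ n x}) ->
  {ae leb N, forall x, f_ n x @[n --> \oo] --> f x} ->
  (forall n, ip mu (f_ n) phi <= B) ->
  (\int[leb N]_x (`|f x| * phi x)%:E <= B%:E)%E.
Proof.
move=> Lf Lphi phi0 mf f0 ff hB.
have mphi := L2_measurable Lphi.
have La n : (fun x => `|f_ n x|) \in Lfun mu 2%:E.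
  apply: (L2_le _ _ (Lf n)) => [|x]; last by rewrite normr_id.
  by apply: measurableT_comp => //; exact: L2_measurable (Lf n).
apply: (@fatou_ae _ _ _ (leb N) (fun n x => `|f_ n x| * phi x)).
- by move=> n; apply: measurable_funM => //; exact: L2_measurable (La n).
- by apply: measurable_funM => //; exact: measurableT_comp.
- by move=> n x; rewrite mulr_ge0.
- by apply: filterS ff => x fx; apply: cvgM; [exact: cvg_norm|exact: cvg_cst].
- apply: nearW => n.
  have := L2_mul (La n) Lphi => /(integrable_fin_num measurableT) /fineK hfin.
  rewrite (_ : (\int[leb N]_x _)%E = (ip mu (fun x => `|f_ n x|) phi)%:E) ?lee_fin; last first.
    by rewrite -hfin.
  apply: le_trans (hB n); rewrite le_eqVlt; apply/orP; left; apply/eqP.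
  by apply: ip_ae => //; apply: filterS (f0 n) => x /ger0_norm.
Qed.

Definition threshold_const : R := 2 * var_const (N := N) (s * p) * mass_const (N := N) (s * p) `^ (2 - p).

Lemma threshold_const_gt0 : 0 < threshold_const.
Proof.
have v0 := var_const_gt0 N0 sp0 sp1; have m0 := mass_const_gt0 (N := N) sp0.
by apply: mulr_gt0; [exact: mulr_gt0|exact: powR_gt0].
Qed.

(** The largest mass that the decay estimate allows to vanish within the time [t], at
    the scale [r]. *)
Definition threshold (t r : R) : R := (t * threshold_const) `^ (2 - p)^-1 * r `^ (N%:R - gam).

Lemma threshold_ge0 (t r : R) : 0 <= threshold t r.
Proof. by rewrite mulr_ge0 ?powR_ge0. Qed.

Lemma thresholdE (t r : R) : 0 <= t -> 0 < r ->
  t * cK p (mass_const (N := N) (s * p) * r ^+ N) (var_const (N := N) (s * p) * r `^ (- (s * p))) =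
  threshold t r `^ (2 - p).
Proof.
move=> t0 r0; have q0 : 0 < 2 - p by rewrite subr_gt0.
have m0 := mass_const_gt0 (N := N) sp0.
rewrite /threshold powRM ?powR_ge0 // -!powRrM mulVf ?gt_eqF // powRr1; last first.
  by rewrite mulr_ge0 // ltW // threshold_const_gt0.
rewrite /cK powRM ?exprn_ge0 ?(ltW r0) ?(ltW m0) // -powR_mulrn ?(ltW r0) // -powRrM.
have -> : (N%:R - gam) * (2 - p) = - (s * p) + N%:R * (2 - p) by field; rewrite gt_eqF.
rewrite [r `^ (_ + _)]powRD ?(gt_eqF r0) ?implybT // /threshold_const; ring.
Qed.

Lemma extinct_mass_le f (u : R -> rN R N -> \bar R) (t : R) x0 (r : R) :
  measurable_fun setT f -> {ae leb N, forall x, 0 <= f x} -> is_solution s p f u -> 0 <= t ->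
  0 < r -> {ae leb N, forall x, u t x = 0%E} ->
  (\int[leb N]_x (`|f x| * bump (s * p) x0 r x)%:E <= (threshold t r)%:E)%E.
Proof.
move=> mf f0 sol t0 r0 ut; have q0 : 0 < 2 - p by rewrite subr_gt0.
have [f_ [h_ [M_ [hn cf]]]] := solution_approximants mf f0 sol t0.
have W := weight_bump N0 sp0 sp1 x0 r0.
have Lphi := L2_weight W.
apply: (@approximants_mass f_) => //.
- by move=> n; have [[]] := hn n.
- by move=> x; rewrite ltW // bump_gt0.
- by move=> n; have [] := hn n.
move=> n; have [S _ fn0 _ hu] := hn n; have [Lf Lh _] := S.
have := mass_semigroup K0 mK p1 p2 Ksym W t0 S fn0.
have hle : ip mu (h_ n) (bump (s * p) x0 r) <= 0.
  have z : ip mu (cst 0) (bump (s * p) x0 r) = 0.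
    rewrite /ip /Rintegral (eq_integral (cst 0%E)) ?integral0 // => x _.
    by rewrite /= mul0r.
  rewrite -z; apply: le_Rintegral_ae; [exact: L2_mul|exact: L2_mul (L2_0 _) Lphi|].
  apply: filterS2 hu ut => x hx ux; rewrite mul0r; apply: mulr_le0_ge0; last by rewrite ltW // bump_gt0.
  by move: hx; rewrite ux lee_fin.
rewrite max_l // powR0 ?gt_eqF // add0r thresholdE // => h.
rewrite leNgt; apply/negP => hlt; move: h; rewrite leNgt => /negP; apply.
by rewrite gt0_ltr_powR // nnegrE ?threshold_ge0 // (le_trans (threshold_ge0 t r)) // ltW.
Qed.

Lemma positive_of_mass f (u : R -> rN R N -> \bar R) (t : R) x0 (r : R) :
  measurable_fun setT f -> {ae leb N, forall x, 0 <= f x} -> is_solution s p f u -> 0 < t ->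
  0 < r -> ((threshold (2 * t) r)%:E < \int[leb N]_x (`|f x| * bump (s * p) x0 r x)%:E)%E ->
  {ae leb N, forall x, (0 < u t x)%E}.
Proof.
move=> mf f0 sol t0 r0 big; have q0 : 0 < 2 - p by rewrite subr_gt0.
have [f_ [h_ [M_ [hn cf]]]] := solution_approximants mf f0 sol (ltW t0).
have W := weight_bump N0 sp0 sp1 x0 r0.
have Lphi := L2_weight W.
have [n hb] : exists n, threshold (2 * t) r < ip mu (f_ n) (bump (s * p) x0 r).
  apply/not_existsP => h; move: big; rewrite ltNge => /negP; apply.
  apply: (@approximants_mass f_) => //.
  - by move=> n; have [[]] := hn n.
  - by move=> x; rewrite ltW // bump_gt0.
  - by move=> n; have [] := hn n.
  - by move=> n; rewrite leNgt; apply/negP; exact: h.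
have [S M0 fn0 fM hu] := hn n.
have pos : {ae leb N, forall x, 0 < h_ n x}.
  apply: (positivity_semigroup K0 mK p1 p2 Ksym W t0 M0 S fn0 fM).
  rewrite thresholdE ?mulr_ge0 ?(ltW t0) // gt0_ltr_powR // nnegrE ?threshold_ge0 //.
  by rewrite (le_trans (threshold_ge0 (2 * t) r)) // ltW.
by apply: filterS2 pos hu => x hx; apply: lt_le_trans; rewrite lte_fin.
Qed.

End Solutions.

(** * Annuli, Morrey spaces and powers *)

Section Consequences.
Context {R : realType} {N : nat}.
Variables s p : R.
Hypothesis N0 : (0 < N)%N.
Hypothesis sp0 : 0 < s * p.
Hypothesis sp1 : s * p < 1.
Hypothesis p1 : 1 < p.
Hypothesis p2 : p < 2.
Implicit Types (f : rN R N -> R) (x : rN R N) (u : R -> rN R N -> \bar R).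

Local Notation gam := (s * p / (2 - p)).
Local Notation alpha := (N%:R + s * p).
Local Notation bump := (bump (s * p)).

Let alpha0 : 0 < alpha.
Proof. by rewrite addr_gt0 // ltr0n. Qed.

Lemma extinctP u : (extinction_time u < +oo)%E ->
  exists t, 0 <= t /\ forall tau, t <= tau -> {ae leb N, forall x, u tau x = 0%E}.
Proof.
move=> h; apply: contrapT => /forallNP hn; move: h.
rewrite /extinction_time [X in ereal_inf X](_ : _ = set0) ?ereal_inf0 //.
by rewrite -subset0 => y [t ht _]; exact: (hn t ht).
Qed.

(** Lebesgue measure charges the unit cube. *)
Lemma leb_not_null (P : rN R N -> Prop) :
  {ae leb N, forall x, P x} -> {ae leb N, forall x, ~ P x} -> False.
Proof.
move=> h1 h2.
have [A [mA A0 hA]] : {ae leb N, forall x : rN R N, False} by apply: filterS2 h1 h2.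
have : (leb N (cubeI origin 1) <= leb N A)%E.
  apply: le_measure; rewrite ?inE //; first exact: measurable_cubeI.
  by move=> x _; apply: hA => /=.
by rewrite A0 leb_cubeI // expr1n lee_fin leNgt ltr01.
Qed.

Lemma positive_for_all_timeP u :
  (forall t, 0 < t -> {ae leb N, forall x, (0 < u t x)%E}) -> positive_for_all_time u.
Proof.
move=> pos; split=> //; apply/eqP; rewrite eq_le leey /= leNgt; apply/negP => /extinctP[t [t0 h]].
have t1 : 0 < t + 1 by rewrite ltr_wpDl.
apply: (leb_not_null (h (t + 1) _)); first by rewrite lerDl.
by apply: filterS (pos _ t1) => x hx ux; move: hx; rewrite ux ltxx.
Qed.

Definition ring_const : R := (1 + 2 * N%:R) `^ (- alpha).

Lemma ring_const_gt0 : 0 < ring_const.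
Proof. by rewrite powR_gt0 // ltr_wpDr. Qed.

(** A cube of side [r] inside the annulus [r < |x - x0| <= 2 * N * r], convenient
    because its measure is explicit. *)
Definition cube_at x0 (r : R) : set (rN R N) := cubeI [tuple tnth x0 i + r | i < N] r.

Lemma cube_at_dist x0 r x : 0 < r -> cube_at x0 r x ->
  r < eucl_dist x x0 <= 2 * N%:R * r.
Proof.
move=> r0 hx; have h i : r < tnth x i - tnth x0 i < 2 * r.
  by have := hx i; rewrite tnth_mktuple => /andP[a b]; apply/andP; split; lra.
apply/andP; split.
  have /andP[a _] := h (Ordinal N0).
  by apply: (lt_le_trans a); apply: le_trans (dist_coord _ _ _); exact: ler_norm.
rewrite -mulrA mulrCA; apply: dist_le_coord; last by rewrite mulr_ge0 // ltW.
move=> i; have /andP[a b] := h i.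
by rewrite ger0_norm ltW // (lt_trans r0).
Qed.

Lemma cube_mass f x0 (r c : R) : 0 < r -> 0 <= c -> measurable_fun setT f ->
  {ae leb N, forall x, cube_at x0 r x -> c <= `|f x|} ->
  ((c * ring_const * r ^+ N)%:E <= \int[leb N]_x (`|f x| * bump x0 r x)%:E)%E.
Proof.
move=> r0 c0 mf hf.
have mC : measurable (cube_at x0 r) by exact: measurable_cubeI.
have cr0 : 0 <= c * ring_const by rewrite mulr_ge0 // ltW // ring_const_gt0.
have b0 x : 0 <= bump x0 r x by rewrite ltW // bump_gt0.
apply: (@le_trans _ _ (\int[leb N]_x ((c * ring_const)%:E * (\1_(cube_at x0 r) x)%:E))%E).
  rewrite ge0_integralZl_EFin //; last by apply/measurable_EFinP; exact: measurable_indic.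
  by rewrite integral_indic // setIT leb_cubeI ?(ltW r0) // -EFinM.
apply: ae_ge0_le_integral => //.
- by move=> x _; rewrite -EFinM lee_fin mulr_ge0.
- by apply: emeasurable_funM => //; apply/measurable_EFinP; exact: measurable_indic.
- by move=> x _; rewrite lee_fin mulr_ge0.
- apply/measurable_EFinP; apply: measurable_funM; last exact: measurable_bump.
  exact: measurableT_comp.
- apply: filterS hf => x hx _; rewrite -EFinM lee_fin indicE.
  case: (boolP (x \in _)) => [/set_mem xC|_]; last by rewrite mulr0 mulr_ge0.
  rewrite mulr1; apply: ler_pM => //; [exact: ltW ring_const_gt0|exact: hx|].
  have /andP[_ h] := cube_at_dist r0 xC.
  apply: powRN_anti; first exact: ltW.
    by rewrite ltr_wpDr // divr_ge0 ?eucl_dist_ge0 // ltW.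
  by rewrite lerD2l ler_pdivrMr.
Qed.

Definition growth (t : R) : R := (t * threshold_const (N := N) s p) `^ (2 - p)^-1.

Lemma growth_ge0 t : 0 <= growth t. Proof. exact: powR_ge0. Qed.

Lemma gam_gt0 : 0 < gam.
Proof. by rewrite divr_gt0 // subr_gt0. Qed.

Definition ann_const (g : R) : R := (2 * N%:R) `^ (- g) * ring_const.

Let N2 : 0 < 2 * N%:R :> R. Proof. by rewrite mulr_gt0 // ltr0n. Qed.

Lemma ann_const_gt0 g : 0 < ann_const g.
Proof. by rewrite mulr_gt0 ?powR_gt0 ?ring_const_gt0. Qed.

Lemma ann_constE g r c : 0 < r ->
  c * (2 * N%:R * r) `^ (- g) * ring_const * r ^+ N = c * ann_const g * r `^ (N%:R - g).
Proof.
move=> r0; rewrite powRM ?(ltW N2) ?(ltW r0) // -powR_mulrn ?(ltW r0) //.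
rewrite [N%:R - g]addrC [r `^ (- g + N%:R)]powRD ?(gt_eqF r0) ?implybT // /ann_const; ring.
Qed.

(** Both the threshold and the mass on the annulus scale like [r ^ (N - gam)], so the
    condition on [A] does not involve the radius. *)
Lemma positive_of_annulus f u (t : R) x0 (r A : R) :
  measurable_fun setT f -> {ae leb N, forall x, 0 <= f x} -> is_solution s p f u -> 0 < t ->
  0 < r -> growth (2 * t) < A * ann_const gam ->
  (forall x, r < eucl_dist x x0 <= 2 * N%:R * r -> A <= f x * eucl_dist x x0 `^ gam) ->
  {ae leb N, forall x, (0 < u t x)%E}.
Proof.
move=> mf f0 sol t0 r0 hA hf.
have A0 : 0 < A.
  rewrite -(pmulr_lgt0 A (ann_const_gt0 gam)); exact: le_lt_trans (growth_ge0 _) hA.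
apply: (positive_of_mass N0 sp0 sp1 p1 p2 mf f0 sol t0 r0 (x0 := x0)).
pose c := A * (2 * N%:R * r) `^ (- gam).
have c0 : 0 <= c by rewrite mulr_ge0 ?powR_ge0 // ltW.
apply: lt_le_trans (cube_mass r0 c0 mf _).
  by rewrite lte_fin /c ann_constE // /threshold -/(growth _) ltr_pM2r ?powR_gt0.
apply: aeW => x xC; have h := cube_at_dist r0 xC; have /andP[h1 h2] := h.
have d0 : 0 < eucl_dist x x0 by exact: lt_trans h1.
apply: (@le_trans _ _ (f x)); last exact: ler_norm.
apply: (@le_trans _ _ (A * eucl_dist x x0 `^ (- gam))).
  by rewrite ler_wpM2l ?(ltW A0) // powRN_anti // ltW // gam_gt0.
by rewrite powRN ler_pdivrMr ?powR_gt0 // hf.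
Qed.

(** The weight is at least [2 ^ (- alpha)] on the ball of radius [r], and the mass
    bound of an extinct solution scales like the Morrey bound. *)
Lemma extinct_morrey f u : locally_integrable_rN f -> {ae leb N, forall x, 0 <= f x} ->
  is_solution s p f u -> (extinction_time u < +oo)%E -> morrey (N%:R * (2 - p) / (s * p)) f.
Proof.
move=> lf f0 sol /extinctP[t [t0 /(_ t (lexx t)) ut]]; split=> //; have [mf _] := lf.
exists (2 `^ alpha * growth t) => x0 r r0.
have -> : N%:R * (N%:R * (2 - p) / (s * p) - 1) / (N%:R * (2 - p) / (s * p)) = N%:R - gam.
  have q0 : 0 < 2 - p by rewrite subr_gt0.
  have Nr : 0 < N%:R :> R by rewrite ltr0n.
  have s0 : s != 0 by apply: contraTneq sp0 => ->; rewrite mul0r ltxx.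
  have pn0 : p != 0 by apply: contraTneq sp0 => ->; rewrite mulr0 ltxx.
  by field; rewrite s0 pn0 !gt_eqF.
have b0 x : 0 <= bump x0 r x by rewrite ltW // bump_gt0.
have mb := measurable_eucl_ball x0 r.
have two0 : 0 < 2 `^ alpha :> R by rewrite powR_gt0.
apply: (@le_trans _ _ (\int[leb N]_x ((2 `^ alpha)%:E * (`|f x| * bump x0 r x)%:E))%E).
  rewrite integral_mkcond; apply: ge0_le_integral => //.
  - by move=> x _; rewrite patchE; case: ifP => // _; rewrite lee_fin.
  - apply/measurable_restrict => //; apply/measurable_EFinP.
    by apply: measurable_funTS; exact: measurableT_comp.
  - apply: emeasurable_funM => //; apply/measurable_EFinP; apply: measurable_funM.
      exact: measurableT_comp.
    exact: measurable_bump.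
  - move=> x _; rewrite patchE -EFinM; case: ifP => [/set_mem xr|_]; last first.
      by rewrite lee_fin !mulr_ge0 // ltW.
    rewrite lee_fin mulrCA ler_peMr // -ler_pdivrMl // mulr1 -powRN.
    apply: powRN_anti; first exact: ltW.
      by rewrite ltr_wpDr // divr_ge0 ?eucl_dist_ge0 // ltW.
    by rewrite -[leRHS]/(1 + 1 : R) lerD2l ler_pdivrMr // mul1r ltW.
rewrite ge0_integralZl_EFin ?powR_ge0 //; last 2 first.
- by move=> x _; rewrite lee_fin mulr_ge0.
- apply/measurable_EFinP; apply: measurable_funM; last exact: measurable_bump.
  exact: measurableT_comp.
have h := extinct_mass_le N0 sp0 sp1 p1 p2 x0 mf f0 sol t0 r0 ut.
apply: (le_trans (lee_wpmul2l _ h)); first by rewrite lee_fin ltW.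
by rewrite -EFinM lee_fin /threshold mulrA.
Qed.

Lemma powR_bounded (e C : R) : (forall r, 0 < r -> r `^ e <= C) -> e = 0.
Proof.
move=> h; apply/eqP/negPn/negP => e0.
have c1 : 0 < `|C| + 1 by rewrite ltr_wpDl.
(* At the radius [(|C| + 1) ^ (1 / e)] the power takes the value [|C| + 1]. *)
have := h _ (powR_gt0 e^-1 c1).
rewrite -powRrM mulVf // powRr1 ?(ltW c1) //.
have := ler_norm C; lra.
Qed.

(** At the scale [r] the mass of the datum is of order [r ^ (N - g)], whereas
    extinction bounds it by a multiple of [r ^ (N - gam)], for every [r]. *)
Lemma extinct_power f u g : {ae leb N, forall x, f x = eucl_norm x `^ (- g)} ->
  measurable_fun setT f -> 0 < g -> is_solution s p f u ->
  (extinction_time u < +oo)%E -> g = gam.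
Proof.
move=> hf mf g0 sol /extinctP[t [t0 /(_ t (lexx t)) ut]].
have f0 : {ae leb N, forall x, 0 <= f x} by apply: filterS hf => x ->; exact: powR_ge0.
apply/eqP; rewrite -subr_eq0 -oppr_eq0 opprB; apply/eqP.
apply: (@powR_bounded _ (growth t / ann_const g)) => r r0.
rewrite ler_pdivlMr ?ann_const_gt0 // -(ler_pM2r (powR_gt0 (N%:R - gam) r0)).
have := extinct_mass_le N0 sp0 sp1 p1 p2 origin mf f0 sol t0 r0 ut.
pose c := (2 * N%:R * r) `^ (- g).
have c0 : 0 <= c by exact: powR_ge0.
have hc : {ae leb N, forall x, cube_at origin r x -> c <= `|f x|}.
  apply: filterS hf => x -> xC; have /andP[h1 h2] := cube_at_dist r0 xC.
  rewrite ger0_norm ?powR_ge0 // eucl_norm_dist powRN_anti ?(ltW g0) //.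
  exact: lt_trans h1.
move=> /(le_trans (cube_mass r0 c0 mf hc)); rewrite lee_fin -[c]mul1r ann_constE // /threshold -/(growth t).
rewrite mul1r [X in X <= _ -> _](_ : _ = r `^ (gam - g) * ann_const g * r `^ (N%:R - gam)) //.
have -> : N%:R - g = (gam - g) + (N%:R - gam) by ring.
by rewrite [r `^ (_ + _)]powRD ?(gt_eqF r0) ?implybT // mulrCA mulrA.
Qed.

(** The evolutions of the truncations are nondecreasing, hence converge in the
    extended reals. *)
Lemma minimal_solution_exists f : measurable_fun setT f -> (forall x, 0 <= f x) ->
  exists u, minimal_solution s p f u.
Proof.
move=> mf f0.
have K0 x y : 0 <= kern (s * p) x y :> R by rewrite invr_ge0 powR_ge0.
have mK := measurable_kern (R := R) (N := N) (s * p).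
have /choice[u_ hu] : forall nt : nat * R, exists w, 0 <= nt.2 ->
    nsemigroup (lebf N) (kern (s * p)) p nt.2 (trunc f nt.1) w.
  move=> [n t] /=; have [t0|t0] := leP 0 t; last by exists (cst 0).
  have Lf : trunc f n \in Lfun (lebf N) 2%:E by rewrite -Lfun_lebf trunc_Lfun.
  by have [w hw] := nsemigroup_exists K0 mK p1 p2 t0 Lf; exists w.
exists (fun t x => ereal_sup (range (fun n => (u_ (n, t) x)%:E))).
exists (trunc f), (fun n t => u_ (n, t)); split.
- by move=> n; rewrite trunc_Lfun // trunc_Lfuny.
- apply: aeW => x; split => [n|n|]; [exact: trunc_ge0|exact: trunc_mono|].
  by have := @trunc_cvg _ _ f x; rewrite max_r.
- by move=> n t t0; apply/semigroupE; exact: (hu (n, t)).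
move=> t t0.
have mono : {ae leb N, forall x, forall k, u_ (k, t) x <= u_ (k.+1, t) x}.
  apply: ae_foralln => k.
  apply: (nsemigroup_le K0 mK p1 p2 t0 (hu (k, t) t0) (hu (k.+1, t) t0)).
  by apply: aeW => x; exact: trunc_mono.
apply: filterS mono => x hx; apply: ereal_nondecreasing_cvgn => a b ab.
rewrite lee_fin -(subnKC ab); elim: (b - a)%N => [|j IH]; first by rewrite addn0.
by rewrite addnS (le_trans IH).
Qed.

End Consequences.

Section PowerData.
Context {R : realType} {N : nat}.

Lemma measurable_norm_powR (g : R) :
  measurable_fun setT (fun x : rN R N => eucl_norm x `^ g).
Proof.
apply: (measurableT_comp (measurable_powR _)).
rewrite (_ : eucl_norm = (fun x => eucl_dist x origin)); first exact: measurable_dist.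
by apply/funext => x; exact: eucl_norm_dist.
Qed.

(** Inside the ball of radius [r] around the origin the power is integrable; outside
    it is at most [r ^ (- g)]. *)
Lemma norm_powR_ball (g : R) (x0 : rN R N) (r : R) : 0 < g -> g < N%:R -> 0 < r ->
  (\int[leb N]_(x in eucl_ball x0 r) `|eucl_norm x `^ (- g)|%:E <=
   ((core_const (N := N) (N%:R - g) + 2 ^+ N) * r `^ (N%:R - g))%:E)%E.
Proof.
move=> g0 gN r0.
have mb := measurable_eucl_ball x0 r.
have e0 : 0 < N%:R - g by rewrite subr_gt0.
have eN : N%:R - g <= N%:R by rewrite gerBl ltW.
pose a (x : rN R N) : R := core_fun (N := N) (N%:R - g) r (eucl_dist x origin).
have ma : measurable_fun setT a by apply: measurable_radial; exact: measurable_core_fun.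
have a0 x : 0 <= a x by rewrite mulr_ge0 ?powR_ge0.
have ia : (\int[leb N]_x (a x)%:E <= (core_const (N := N) (N%:R - g) * r `^ (N%:R - g))%:E)%E.
  exact: core_integral.
have ha x : eucl_norm x < r -> a x = eucl_norm x `^ (- g).
  rewrite eucl_norm_dist /a /core_fun => ->; rewrite mul1r; congr (_ `^ _); ring.
clearbody a.
apply: (@le_trans _ _ (\int[leb N]_x ((a x)%:E + (r `^ (- g))%:E * (\1_(eucl_ball x0 r) x)%:E))%E).
  rewrite integral_mkcond; apply: ge0_le_integral => //.
  - by move=> x _; rewrite patchE; case: ifP => // _; rewrite lee_fin.
  - apply/measurable_restrict => //; apply/measurable_EFinP.
    by apply: measurable_funTS; apply: measurableT_comp => //; exact: measurable_norm_powR.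
  - apply: emeasurable_funD; first by apply/measurable_EFinP.
    by apply: emeasurable_funM => //; apply/measurable_EFinP; exact: measurable_indic.
  - move=> x _; rewrite patchE indicE -EFinM -EFinD; case: ifP => _; last first.
      by rewrite mulr0 addr0 lee_fin.
    rewrite mulr1 lee_fin ger0_norm ?powR_ge0 //.
    have [xr|xr] := ltP (eucl_norm x) r; first by rewrite ha // lerDl powR_ge0.
    by rewrite (le_trans (powRN_anti (ltW g0) r0 xr)) // lerDr.
rewrite ge0_integralD //; last 4 first.
- by move=> x _; rewrite lee_fin.
- by apply/measurable_EFinP.
- by move=> x _; rewrite -EFinM lee_fin mulr_ge0 ?powR_ge0.
- by apply: emeasurable_funM => //; apply/measurable_EFinP; exact: measurable_indic.
rewrite ge0_integralZl_EFin ?powR_ge0 //; last first.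
  by apply/measurable_EFinP; exact: measurable_indic.
rewrite integral_indic // setIT mulrDl EFinD; apply: leeD => //.
apply: (le_trans (lee_wpmul2l _ (leb_ball_le x0 (ltW r0)))); first by rewrite lee_fin powR_ge0.
rewrite -EFinM lee_fin exprMn mulrCA -(powR_mulrn N (ltW r0)).
by rewrite [N%:R - g]addrC powRD ?(gt_eqF r0) ?implybT.
Qed.

Lemma morrey_norm_powR (q : R) : (0 < N)%N -> 1 < q ->
  morrey q (fun x : rN R N => eucl_norm x `^ (- (N%:R / q))).
Proof.
move=> N0 q1; have q0 : 0 < q by exact: lt_trans q1.
have Nr : 0 < N%:R :> R by rewrite ltr0n.
have g0 : 0 < N%:R / q by rewrite divr_gt0.
have gN : N%:R / q < N%:R by rewrite ltr_pdivrMr // ltr_pMr.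
have hb x0 r := @norm_powR_ball _ x0 r g0 gN.
have mf := measurable_norm_powR (- (N%:R / q)).
split; first split => //.
  move=> x0 r; have [r0|r0] := ltP 0 r; first by rewrite (le_lt_trans (hb x0 r r0)) ?ltry.
  rewrite (_ : eucl_ball x0 r = set0) ?integral_set0 ?ltry //.
  apply/seteqP; split => y //=; rewrite /eucl_ball /= => h.
  by have := le_lt_trans (eucl_dist_ge0 y x0) h; rewrite ltNge r0.
exists (core_const (N := N) (N%:R - N%:R / q) + 2 ^+ N) => x0 r r0.
apply: (le_trans (hb x0 r r0)); rewrite lee_fin le_eqVlt; apply/orP; left; apply/eqP.
by congr (_ * _ `^ _); field; rewrite gt_eqF.
Qed.

End PowerData.

Theorem corollary8p1 (R : realType) (N : nat) (s p : R)
    (hN : (2 <= N)%N) (hs : 0 < s < 1)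
    (hp : 1 < p < 2 * N%:R / (N%:R + s)) (hsp : s * p < 1) :
  let q_star : R := N%:R * (2 - p) / (s * p) in
  let gamma_star : R := s * p / (2 - p) in
  (forall (u0 : rN R N -> R) (u : R -> rN R N -> \bar R) (T : \bar R),
      locally_integrable_rN u0 ->
      {ae leb N, forall x, 0 <= u0 x} ->
      is_solution s p u0 u ->
      T = extinction_time u -> (0 < T)%E ->
      [/\ ~ morrey q_star u0 -> T = +oo%E,
          u0 x * eucl_norm x `^ gamma_star @[x --> nbhs_infty] --> +oo ->
            positive_for_all_time u,
          (exists x0 : rN R N,
             u0 x * eucl_dist x x0 `^ gamma_star @[x --> nbhs_punctured x0]
               --> +oo) ->
            positive_for_all_time u &
          forall gamma : R, 0 < `|gamma| < N%:R ->
            {ae leb N, forall x, u0 x = eucl_norm x `^ (- `|gamma|)} ->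
            (T < +oo)%E -> `|gamma| = gamma_star]) /\
  (forall q : R, 1 < q -> q != q_star ->
     exists u0 : rN R N -> R,
       [/\ morrey q u0, {ae leb N, forall x, 0 <= u0 x},
           exists u : R -> rN R N -> \bar R, is_solution s p u0 u &
           forall u : R -> rN R N -> \bar R, is_solution s p u0 u ->
             extinction_time u = +oo%E]).
Proof.
move=> qs gs.
have /andP[s0 s1] := hs; have /andP[p1 pc] := hp.
have N0 : (0 < N)%N by exact: ltn_trans hN.
have Nr : 0 < N%:R :> R by rewrite ltr0n.
have p0 : 0 < p by exact: lt_trans p1.
have p2 : p < 2.
  by apply: (lt_trans pc); rewrite ltr_pdivrMr ?addr_gt0 // mulrDr ltrDl mulr_gt0.
have sp0 : 0 < s * p by rewrite mulr_gt0.
have q0 : 0 < 2 - p by rewrite subr_gt0.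
(* The growth conditions hold with every constant [A]; this one exceeds the
   threshold. *)
have large t : exists A : R, growth (N := N) s p (2 * t) < A * ann_const (N := N) s p gs.
  have a0 : 0 < ann_const (N := N) s p gs by apply: ann_const_gt0.
  exists ((growth (N := N) s p (2 * t) + 1) / ann_const (N := N) s p gs).
  by rewrite divfK ?gt_eqF // ltrDl.
have atoo (A : R) : pinfty_nbhs R [set y | A <= y].
  by exists A; split; [exact: num_real|move=> y /ltW].
split.
  move=> u0 u T lu0 u00 sol TE T0; have [mu0 _] := lu0; split.
  - move=> nm; apply/eqP; rewrite eq_le leey /= leNgt; apply/negP => Tlt; apply: nm.
    by apply: (extinct_morrey N0 sp0 hsp p1 p2 lu0 u00 sol); rewrite -TE.
  - move=> h; apply: positive_for_all_timeP => t t0; have [A hA] := large t.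
    have [r0 _ hr] := h _ (atoo A).
    have r1 : 0 < Num.max 1 r0 by rewrite lt_max ltr01.
    apply: (positive_of_annulus N0 sp0 hsp p1 p2 mu0 u00 sol t0 r1 hA (x0 := origin)).
    move=> x /andP[hx _]; rewrite -eucl_norm_dist; apply: hr => /=.
    by rewrite eucl_norm_dist (le_lt_trans _ hx) // le_max lexx orbT.
  - move=> [x0 h]; apply: positive_for_all_timeP => t t0; have [A hA] := large t.
    have [r0 /= r00 hr] := h _ (atoo A).
    have N21 : 0 < 2 * N%:R + 1 :> R by rewrite ltr_wpDl // mulr_ge0.
    (* The annulus of this radius lies inside the punctured ball of radius [r0]. *)
    have r1 : 0 < r0 / (2 * N%:R + 1) by rewrite divr_gt0.
    apply: (positive_of_annulus N0 sp0 hsp p1 p2 mu0 u00 sol t0 r1 hA (x0 := x0)).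
    move=> x /andP[hx1 hx2]; apply: hr => /=; rewrite (lt_trans r1 hx1) /=.
    apply: (le_lt_trans hx2); rewrite mulrCA gtr_pMr // ltr_pdivrMr // mul1r ltrDl.
    exact: ltr01.
  - move=> gamma /andP[g0 gN] hu Tlt.
    by apply: (extinct_power N0 sp0 hsp p1 p2 hu mu0 g0 sol); rewrite -TE.
move=> q q1 qn; have qp : 0 < q by exact: lt_trans q1.
have g0 : 0 < N%:R / q by rewrite divr_gt0.
have mf := measurable_norm_powR (N := N) (- (N%:R / q)).
exists (fun x => eucl_norm x `^ (- (N%:R / q))); split.
- exact: morrey_norm_powR.
- by apply: aeW => x; exact: powR_ge0.
- have [u hu] := minimal_solution_exists s p1 p2 mf (fun x => powR_ge0 _ _).
  by exists u; right.
move=> u sol; apply/eqP; rewrite eq_le leey /= leNgt; apply/negP => Tlt.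
have := extinct_power N0 sp0 hsp p1 p2 (aeW _ (fun x => erefl)) mf g0 sol Tlt.
move=> e; move/negP: qn; apply; apply/eqP.
have -> : q = N%:R / (N%:R / q) by rewrite invfM invrK mulrA divff ?mul1r ?gt_eqF.
by rewrite e /qs invf_div mulrA.
Qed.
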